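(* Let $\phi \in \mathcal{G}AP$ admit an $AP$ asymmetric factorization $\phi=\phi_{-}\, e_{\lambda}\, \phi_{e}$ (with $\lambda\in\mathbb{R}$, $\phi_-\in\mathcal{G}AP^-$, $\phi_e\in\mathcal{G}L^\infty(\mathbb{R})$, $\widetilde{\phi_e}=\phi_e$), and let $W\!H_\phi : L^2_+(\mathbb{R})\to L^2(\mathbb{R}_+)$ be the Wiener-Hopf plus Hankel operator with Fourier symbol $\phi$. (a) If $\lambda < 0$, then $W\!H_\phi$ is properly right-Fredholm and right-invertible. (b) If $\lambda > 0$, then $W\!H_\phi$ is properly left-Fredholm and left-invertible. (c) If $\lambda = 0$, then $W\!H_\phi$ is invertible.
   Context: Operators: $\mathbb{R}_+=(0,+\infty)$; $L^2_+(\mathbb{R})$ is the subspace of $L^2(\mathbb{R})$ of functions supported in the closure of $\mathbb{R}_+$; $r_+:L^2(\mathbb{R})\to L^2(\mathbb{R}_+)$ is restriction. $\mathcal{F}$ is the Fourier transformation on $L^2(\mathbb{R})$, with the convention $\mathcal{F}f(\xi)=\int_{\mathbb{R}} e^{i\xi x}f(x)\,dx$ (extended to $L^2$ as usual). $J\varphi(x)=\widetilde{\varphi}(x)=\varphi(-x)$ is the reflection. For $\phi\in L^\infty(\mathbb{R})$, $W_\phi=r_+\mathcal{F}^{-1}\phi\cdot\mathcal{F}$ and $H_\phi=r_+\mathcal{F}^{-1}\phi\cdot\mathcal{F}J$ (both $L^2_+(\mathbb{R})\to L^2(\mathbb{R}_+)$) are the Wiener-Hopf and Hankel operators, and $W\!H_\phi=W_\phi+H_\phi$.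 Function classes: $e_\lambda(x)=e^{i\lambda x}$ for $\lambda, x\in\mathbb{R}$. $AP$ is the smallest closed subalgebra of $L^\infty(\mathbb{R})$ containing all $e_\lambda$, $\lambda\in\mathbb{R}$; $AP^-$ is the smallest closed subalgebra of $L^\infty(\mathbb{R})$ containing all $e_\lambda$ with $\lambda\le 0$. $\mathcal{G}B$ denotes the group of invertible elements of a Banach algebra $B$. A function $\phi\in\mathcal{G}AP$ admits an $AP$ asymmetric factorization if $\phi=\phi_-\,e_\lambda\,\phi_e$ with $\lambda\in\mathbb{R}$, $\phi_-\in\mathcal{G}AP^-$, $\phi_e\in\mathcal{G}L^\infty(\mathbb{R})$ and $\widetilde{\phi_e}=\phi_e$. Fredholm notions: for a bounded linear operator $T:X\to Y$ between Banach spaces with closed image (normally solvable), put $n(T)=\dim\operatorname{Ker}T$ and $d(T)=\dim (Y/\operatorname{Im}T)$. $T$ is properly left-Fredholm if it is normally solvable with $n(T)<\infty$ and $d(T)=\infty$; properly right-Fredholm if it is normally solvable with $d(T)<\infty$ and $n(T)=\infty$. Right-, left-invertibility and invertibility are meant with bounded linear inverses. *)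

(* Defs.v *)
From HB Require Import structures.
From mathcomp Require Import all_boot all_order all_algebra.
From mathcomp Require Import complex.
From mathcomp Require Import all_classical all_reals all_analysis.
From mathcomp Require Import measurable_realfun ess_sup_inf.

Set Implicit Arguments.
Unset Strict Implicit.
Unset Printing Implicit Defensive.
Import Order.TTheory GRing.Theory Num.Theory.
Import numFieldNormedType.Exports.
Import ComplexField.Normc.

Local Open Scope classical_set_scope.
Local Open Scope ring_scope.
Local Open Scope complex_scope.

Lemma normc_ge0 (R : rcfType) (z : R[i]) : 0 <= normc z.
Proof. by case: z => a b; exact: sqrtr_ge0. Qed.

Section complex_Lfun.
Context d (T : measurableType d) (R : realType).
Variables (mu : {measure set T -> \bar R}) (p : \bar R).

Definition cmeasurable (f : T -> R[i]) :=
  measurable_fun [set: T] (fun x => complex.Re (f x)) /\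
  measurable_fun [set: T] (fun x => complex.Im (f x)).

Definition cLnorm (f : T -> R[i]) : \bar R :=
  (Lnorm mu p (fun x => (normc (f x))%:E))%E.

Definition cLfun : set (T -> R[i]) :=
  [set f | cmeasurable f /\ (cLnorm f < +oo)%E].

Lemma cmeasurable_normc f : cmeasurable f ->
  measurable_fun [set: T] (fun x => normc (f x)).
Proof.
move=> [mr mi]; rewrite (_ : (fun x => _) =
  (fun x => Num.sqrt (complex.Re (f x) ^+ 2 + complex.Im (f x) ^+ 2))); last first.
  by apply/funext => x; case: (f x).
apply: (@measurableT_comp _ _ _ _ _ _ (@Num.sqrt R)) => //.
  by apply: continuous_measurable_fun; exact: sqrt_continuous.
by apply: measurable_funD; apply: measurable_funX.
Qed.

Lemma cmeasurable_cst (c : R[i]) : cmeasurable (fun=> c).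
Proof. by split; exact: measurable_cst. Qed.

Lemma cmeasurableD f g : cmeasurable f -> cmeasurable g ->
  cmeasurable (fun x => f x + g x).
Proof.
move=> [fr fi] [gr gi]; split.
- under eq_fun do rewrite raddfD/=; exact: measurable_funD.
- under eq_fun do rewrite raddfD/=; exact: measurable_funD.
Qed.

Lemma cmeasurableM f g : cmeasurable f -> cmeasurable g ->
  cmeasurable (fun x => f x * g x).
Proof.
move=> [fr fi] [gr gi]; split.
- rewrite (_ : (fun x => _) =
    (fun x => complex.Re (f x) * complex.Re (g x) - complex.Im (f x) * complex.Im (g x))); last first.
    by apply/funext => x; case: (f x) (g x) => ? ? [].
  by apply: measurable_funB; apply: measurable_funM.
- rewrite (_ : (fun x => _) =
    (fun x => complex.Re (f x) * complex.Im (g x) + complex.Im (f x) * complex.Re (g x))); last first.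
    by apply/funext => x; case: (f x) (g x) => ? ? [].
  by apply: measurable_funD; apply: measurable_funM.
Qed.

Hypothesis p1 : (1 <= p)%E.

Lemma le_Lnorm_ae (u v : T -> R) :
  measurable_fun [set: T] u -> measurable_fun [set: T] v ->
  (forall x, 0 <= u x) -> (forall x, 0 <= v x) ->
  (\forall x \ae mu, u x <= v x) ->
  (Lnorm mu p (fun x => (u x)%:E) <= Lnorm mu p (fun x => (v x)%:E))%E.
Proof.
move=> mu_ mv u0 v0 uv; rewrite unlock /Lnorm.
case: p p1 => [r|_|//].
- rewrite lee_fin => r1.
  have r0 : 0 < r by apply: lt_le_trans r1.
  apply: gt0_ler_poweR.
  + by rewrite invr_ge0 ltW.
  + by rewrite in_itv/= leey integral_ge0// => x _; exact: poweR_ge0.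
  + by rewrite in_itv/= leey integral_ge0// => x _; exact: poweR_ge0.
  have mpow (w : T -> R) : measurable_fun [set: T] w ->
      measurable_fun [set: T] (fun x => (`|(w x)%:E| `^ r)%E).
    move=> mw.
    apply: (@measurableT_comp _ _ _ _ _ _ (fun x : \bar R => (x `^ r)%E)).
      exact: measurable_poweR.
    by apply: measurableT_comp => //; exact/measurable_EFinP.
  apply: ae_ge0_le_integral => //.
  + by move=> x _; exact: poweR_ge0.
  + exact: mpow.
  + by move=> x _; exact: poweR_ge0.
  + exact: mpow.
  + apply: filterS uv => x uvx _ /=.
    rewrite lee_fin ger0_norm// ger0_norm//.
    by apply: ge0_ler_powR => //; [exact: ltW|rewrite nnegrE..].
- case: ifPn => // _; apply: le_ess_sup.
  by apply: filterS uv => x uvx /=; rewrite lee_fin !ger0_norm.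
Qed.

Lemma LnormMl (u : T -> R) (r : R) : 0 <= r ->
  measurable_fun [set: T] u -> (Lnorm mu p (fun x => (u x)%:E) < +oo)%E ->
  (Lnorm mu p (fun x => (r * u x)%:E) = r%:E * Lnorm mu p (fun x => (u x)%:E))%E.
Proof.
move=> r0 mu_ fu.
have Pu : u \in Lfun mu p by apply/andP; rewrite !inE.
by have := @LnormZ _ _ _ mu p p1 (Lfun_Sub p1 Pu) r; rewrite ger0_norm.
Qed.

Lemma cLnorm_ge0 f : (0 <= cLnorm f)%E.
Proof. exact: Lnorm_ge0. Qed.

Lemma cLnorm_ae f g : cmeasurable f -> cmeasurable g ->
  (\forall x \ae mu, f x = g x) -> cLnorm f = cLnorm g.
Proof.
move=> mf mg fg; apply/eqP; rewrite eq_le; apply/andP; split.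
- apply: le_Lnorm_ae; try exact: cmeasurable_normc.
  + by move=> x; exact: normc_ge0.
  + by move=> x; exact: normc_ge0.
  + by apply: filterS fg => x ->.
- apply: le_Lnorm_ae; try exact: cmeasurable_normc.
  + by move=> x; exact: normc_ge0.
  + by move=> x; exact: normc_ge0.
  + by apply: filterS fg => x ->.
Qed.


Lemma cLfun_cst0 : cLfun (fun=> 0).
Proof.
split; first exact: cmeasurable_cst.
rewrite /cLnorm; under eq_fun do rewrite normc0.
by rewrite [X in (X < _)%E]Lnorm0// gt_eqF// (lt_le_trans _ p1).
Qed.

Lemma cLnormD f g : cmeasurable f -> cmeasurable g ->
  (cLnorm (fun x => f x + g x)%R <= cLnorm f + cLnorm g)%E.
Proof.
move=> mf mg.
have mnf := cmeasurable_normc mf; have mng := cmeasurable_normc mg.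
apply: (@le_trans _ _ (Lnorm mu p (fun x => (normc (f x) + normc (g x))%:E))).
  apply: le_Lnorm_ae.
  - exact/cmeasurable_normc/cmeasurableD.
  - exact: measurable_funD.
  - by move=> x; exact: normc_ge0.
  - by move=> x; rewrite addr_ge0// normc_ge0.
  - by apply: nearW => x; exact: le_normcD.
exact: (@eminkowski _ _ _ mu _ _ p mnf mng p1).
Qed.

Lemma cLfunD f g : cLfun f -> cLfun g -> cLfun (fun x => f x + g x).
Proof.
move=> [mf lf] [mg lg]; split; first exact: cmeasurableD.
by rewrite (le_lt_trans (cLnormD mf mg))// lte_add_pinfty.
Qed.

Lemma cLnormZ (a : R[i]) f : cLfun f ->
  cLnorm (fun x => a * f x) = ((normc a)%:E * cLnorm f)%E.
Proof.
move=> [mf lf]; rewrite /cLnorm; under eq_fun do rewrite normcM.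
by rewrite LnormMl//; [exact: normc_ge0|exact: cmeasurable_normc].
Qed.

Lemma cLfunZ (a : R[i]) f : cLfun f -> cLfun (fun x => a * f x).
Proof.
move=> /[dup] Lf [mf lf]; split.
  by apply: cmeasurableM => //; exact: cmeasurable_cst.
by rewrite cLnormZ// lte_mul_pinfty// lee_fin normc_ge0.
Qed.

Lemma cLfunM (phi f : T -> R[i]) (M : R) : 0 <= M -> cmeasurable phi ->
  (\forall x \ae mu, normc (phi x) <= M) -> cLfun f ->
  cLfun (fun x => phi x * f x).
Proof.
move=> M0 mphi phiM [mf lf]; split; first exact: cmeasurableM.
apply: (@le_lt_trans _ _ (Lnorm mu p (fun x => (M * normc (f x))%:E))).
  apply: le_Lnorm_ae.
  - exact/cmeasurable_normc/cmeasurableM.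
  - by apply: measurable_funM => //; exact: cmeasurable_normc.
  - by move=> x; exact: normc_ge0.
  - by move=> x; rewrite mulr_ge0// normc_ge0.
  - by apply: filterS phiM => x xM; rewrite normcM ler_wpM2r// normc_ge0.
rewrite LnormMl//; last exact: cmeasurable_normc.
by rewrite lte_mul_pinfty// ?lee_fin.
Qed.

End complex_Lfun.

Section complex_Lp.
Context d (T : measurableType d) (R : realType).
Variables (mu : {measure set T -> \bar R}) (p : \bar R) (p1 : (1 <= p)%E).

Definition Lfunc := {f : T -> R[i] | `[< cLfun mu p f >]}.

Definition MkLfunc f (Lf : cLfun mu p f) : Lfunc := exist _ f (asboolT Lf).

Definition Lfunc_ae (f g : Lfunc) := `[< \forall x \ae mu, val f x = val g x >].

Let Lfunc_ae_refl : reflexive Lfunc_ae.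
Proof. by move=> f; apply/asboolP/nearW. Qed.

Let Lfunc_ae_sym : symmetric Lfunc_ae.
Proof.
by move=> f g; apply/asboolP/asboolP; apply: filterS => x ->.
Qed.

Let Lfunc_ae_trans : transitive Lfunc_ae.
Proof.
move=> f g h /asboolP gf /asboolP fh; apply/asboolP.
by apply: filterS2 gf fh => x -> ->.
Qed.

Canonical Lfunc_ae_canonical :=
  EquivRel Lfunc_ae Lfunc_ae_refl Lfunc_ae_sym Lfunc_ae_trans.

Local Open Scope quotient_scope.

(* Complex-valued counterpart of [LspaceType], which is for real-valued
   functions only. *)
Definition Lspc of (1 <= p)%E : Type := {eq_quot Lfunc_ae}.
Local Notation L := (Lspc p1).
HB.instance Definition _ := Choice.on L.
HB.instance Definition _ := EqQuotient.on L.

Definition Lspc_fun (f : L) : T -> R[i] := val (repr f).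
Coercion Lspc_fun : L >-> Funclass.

Lemma Lspc_funP (f : L) : cLfun mu p f.
Proof. exact/asboolP/(valP (repr f)). Qed.

(* total in [f]: a function outside the L^p class is sent to 0 *)
Definition Lcls (f : T -> R[i]) : L :=
  match pselect (cLfun mu p f) with
  | left Lf => \pi_L (MkLfunc Lf)
  | right _ => \pi_L (MkLfunc (cLfun_cst0 mu p1))
  end.

Lemma LclsE f : cLfun mu p f -> \forall x \ae mu, Lcls f x = f x.
Proof.
move=> Lf; rewrite /Lcls; case: pselect => // Lf'.
rewrite /Lspc_fun; case: piP => g /eqmodP/asboolP.
by apply: filterS => x /= ->.
Qed.

Lemma Lspc_eq (f g : L) : (\forall x \ae mu, f x = g x) -> f = g.
Proof.
move=> fg; rewrite -[f]reprK -[g]reprK; apply/eqmodP/asboolP; exact: fg.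
Qed.

Lemma Lcls_eq f g : cLfun mu p f -> cLfun mu p g ->
  (\forall x \ae mu, f x = g x) -> Lcls f = Lcls g.
Proof.
move=> Lf Lg fg; apply: Lspc_eq; have := LclsE Lf; have := LclsE Lg.
by apply: filterS3 fg => x -> -> ->.
Qed.

Lemma LclsK (f : L) : Lcls f = f.
Proof. exact/Lspc_eq/LclsE/Lspc_funP. Qed.

Definition Lspc_zero : L := Lcls (fun=> 0).
Definition Lspc_opp (f : L) : L := Lcls (fun x => -1 * f x).
Definition Lspc_add (f g : L) : L := Lcls (fun x => f x + g x).
Definition Lspc_scale (a : R[i]) (f : L) : L := Lcls (fun x => a * f x).

Let zeroE : \forall x \ae mu, Lspc_zero x = 0.
Proof. exact: LclsE (cLfun_cst0 mu p1). Qed.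

Let scaleE a f : \forall x \ae mu, Lspc_scale a f x = a * f x.
Proof. exact/LclsE/cLfunZ/Lspc_funP. Qed.

Let addE f g : \forall x \ae mu, Lspc_add f g x = f x + g x.
Proof. by apply/LclsE/cLfunD => //; exact: Lspc_funP. Qed.

Let addA : associative Lspc_add.
Proof.
move=> f g h; apply: Lspc_eq; near=> x.
rewrite (near (addE f (Lspc_add g h)) x)// (near (addE g h) x)//.
by rewrite (near (addE (Lspc_add f g) h) x)// (near (addE f g) x)// addrA.
Unshelve. all: by end_near. Qed.

Let addC : commutative Lspc_add.
Proof. by move=> f g; congr Lcls; apply/funext => x; rewrite addrC. Qed.

Let add0 : left_id Lspc_zero Lspc_add.
Proof.
move=> f; apply: Lspc_eq; near=> x.
by rewrite (near (addE Lspc_zero f) x)// (near zeroE x)// add0r.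
Unshelve. all: by end_near. Qed.

Let addN : left_inverse Lspc_zero Lspc_opp Lspc_add.
Proof.
move=> f; apply: Lspc_eq; near=> x.
rewrite (near (addE (Lspc_opp f) f) x)// (near zeroE x)//.
by rewrite (near (scaleE (-1) f) x)// mulN1r addNr.
Unshelve. all: by end_near. Qed.

HB.instance Definition _ := GRing.isZmodule.Build L addA addC add0 addN.

Let scaleA a b (f : L) : Lspc_scale a (Lspc_scale b f) = Lspc_scale (a * b) f.
Proof.
apply: Lspc_eq; near=> x.
rewrite (near (scaleE a (Lspc_scale b f)) x)// (near (scaleE b f) x)//.
by rewrite (near (scaleE (a * b) f) x)// mulrA.
Unshelve. all: by end_near. Qed.

Let scale1 : left_id 1 Lspc_scale.
Proof.
move=> f; apply: Lspc_eq; near=> x.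
by rewrite (near (scaleE 1 f) x)// mul1r.
Unshelve. all: by end_near. Qed.

Let scaleDr : right_distributive Lspc_scale +%R.
Proof.
move=> a f g; apply: Lspc_eq; near=> x.
rewrite (near (scaleE a (f + g)) x)// (near (addE f g) x)//.
rewrite (near (addE (Lspc_scale a f) (Lspc_scale a g)) x)//.
by rewrite (near (scaleE a f) x)// (near (scaleE a g) x)// mulrDr.
Unshelve. all: by end_near. Qed.

Let scaleDl (f : L) : {morph Lspc_scale^~ f : a b / a + b}.
Proof.
move=> a b /=; apply: Lspc_eq; near=> x.
rewrite (near (scaleE (a + b) f) x)//.
rewrite (near (addE (Lspc_scale a f) (Lspc_scale b f)) x)//.
by rewrite (near (scaleE a f) x)// (near (scaleE b f) x)// mulrDl.
Unshelve. all: by end_near. Qed.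

HB.instance Definition _ := GRing.Zmodule_isLmodule.Build R[i] L
  scaleA scale1 scaleDr scaleDl.

Lemma Lspc0E : \forall x \ae mu, (0 : L) x = 0.
Proof. exact: zeroE. Qed.

Lemma LspcDE (f g : L) : \forall x \ae mu, (f + g : L) x = f x + g x.
Proof. exact: addE. Qed.

Lemma LspcZE a (f : L) : \forall x \ae mu, (a *: f : L) x = a * f x.
Proof. exact: scaleE. Qed.

(* a [normedModType R[i]] has an [R[i]]-valued norm *)
Definition Lspc_norm (f : L) : R[i] := (fine (cLnorm mu p f))%:C.

Let fineK_norm (f : L) : (fine (cLnorm mu p f))%:E = cLnorm mu p f.
Proof.
rewrite fineK// ge0_fin_numE; last exact: cLnorm_ge0.
by have [] := Lspc_funP f.
Qed.

Let normD (f g : L) : Lspc_norm (f + g) <= Lspc_norm f + Lspc_norm g.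
Proof.
have [mf _] := Lspc_funP f; have [mg _] := Lspc_funP g.
rewrite -rmorphD lecR -lee_fin EFinD !fineK_norm.
rewrite (cLnorm_ae p1 _ (cmeasurableD mf mg) (LspcDE f g)).
  exact: cLnormD.
by have [] := Lspc_funP (f + g).
Qed.

Let normZ (a : R[i]) (f : L) : Lspc_norm (a *: f) = `|a| * Lspc_norm f.
Proof.
have [mf _] := Lspc_funP f.
have -> : `|a| = (normc a)%:C by [].
rewrite -rmorphM; congr (_%:C); apply: EFin_inj.
rewrite EFinM !fineK_norm -cLnormZ//; last exact: Lspc_funP.
have [maf _] := Lspc_funP (a *: f).
have maf' := cmeasurableM (cmeasurable_cst T a) mf.
exact: (cLnorm_ae p1 maf maf' (LspcZE a f)).
Qed.

Let norm_eq0 (f : L) : Lspc_norm f = 0 -> f = 0.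
Proof.
move=> f0'; have {f0'} f0 : cLnorm mu p f = 0%E.
  by rewrite -fineK_norm; case: f0' => ->.
have [mf _] := Lspc_funP f.
have mnf : measurable_fun [set: T] (fun x => (normc (f x))%:E).
  exact/measurable_EFinP/cmeasurable_normc.
have := Lnorm_eq0_eq0 mnf (lt_le_trans lte01 p1) f0.
move=> nf0; apply: Lspc_eq; have z := Lspc0E.
by apply: filterS2 nf0 z => x /(_ I)[] /eq0_normc -> ->.
Qed.

HB.instance Definition _ := Lmodule_isNormed.Build R[i] L normD normZ norm_eq0.

End complex_Lp.

Section multiplication.
Context d (T : measurableType d) (R : realType).
Variables (mu : {measure set T -> \bar R}) (p : \bar R) (p1 : (1 <= p)%E).

(* the product of an L^oo class with an L^p class *)
Definition Lmul (phi : Lspc mu (leey 1)) (f : Lspc mu p1) : Lspc mu p1 :=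
  Lcls mu p1 (fun x => phi x * f x).

Lemma Lspcy_bounded (phi : Lspc mu (leey 1)) :
  exists2 M, 0 <= M & \forall x \ae mu, normc (phi x) <= M.
Proof.
have [_] := Lspc_funP phi; rewrite /cLnorm unlock /Lnorm.
case: ifPn => [_|mu0 _].
  rewrite (_ : _ \o _ = EFin \o (fun x => normc (phi x))); last first.
    by apply/funext => x /=; rewrite ger0_norm// normc_ge0.
  move=> /ess_supr_bounded[M phiM]; exists `|M| => //.
  by apply: filterS phiM => x xM; rewrite (le_trans xM)// ler_norm.
exists 0 => //; exists setT; split => //.
by apply/eqP; rewrite eq_le measure_ge0 andbT leNgt.
Qed.

Lemma LmulE phi f : \forall x \ae mu, Lmul phi f x = phi x * f x.
Proof.
have [M M0 phiM] := Lspcy_bounded phi; apply: LclsE.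
apply: (cLfunM p1 M0 _ phiM (Lspc_funP f)).
by have [] := Lspc_funP phi.
Qed.

End multiplication.

Section fredholm.
Context (K : numFieldType) (X Y : normedModType K).

Definition bounded_linear (T : X -> Y) :=
  linear T /\ exists M : K, forall x, `|T x| <= M * `|x|.

Definition normally_solvable (T : X -> Y) :=
  bounded_linear T /\ closed (range T).

End fredholm.

(* [dim (V / W) < oo], for linear subspaces [W `<=` V] *)
Definition fin_dim_quot (K : numFieldType) (X : normedModType K)
    (V W : set X) :=
  exists (n : nat) (v : 'I_n -> X), (forall i, V (v i)) /\
    forall x, V x -> exists c : 'I_n -> K, W (x - \sum_(i < n) c i *: v i).

Section fredholm_classes.
Context (K : numFieldType) (X Y : normedModType K).
Implicit Type T : X -> Y.

Definition finite_nullity T := fin_dim_quot [set x | T x = 0] [set 0].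

Definition finite_deficiency T := fin_dim_quot [set: Y] (range T).

Definition properly_left_Fredholm T :=
  [/\ normally_solvable T, finite_nullity T & ~ finite_deficiency T].

Definition properly_right_Fredholm T :=
  [/\ normally_solvable T, finite_deficiency T & ~ finite_nullity T].

Definition left_invertible T :=
  bounded_linear T /\ exists2 S : Y -> X, bounded_linear S & cancel T S.

Definition right_invertible T :=
  bounded_linear T /\ exists2 S : Y -> X, bounded_linear S & cancel S T.

Definition two_sided_invertible T := bounded_linear T /\
  exists2 S : Y -> X, bounded_linear S & cancel T S /\ cancel S T.

End fredholm_classes.


Section half_line.
Variable R : realType.

Definition half_line : set R := `]0, +oo[.

Lemma measurable_half_line :
  measurable (half_line : set (measurableTypeR R)).
Proof. exact: measurable_itv. Qed.

End half_line.

Notation Linf R := (Lspc (@lebesgue_measure R) (leey 1)).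
Notation L2 R := (Lspc (@lebesgue_measure R) (lee1n 2)).
Notation L2_half_line R :=
  (Lspc (mrestr (@lebesgue_measure R) (@measurable_half_line R)) (lee1n 2)).

Section L2_plus.
Variable R : realType.
Local Notation leb := (@lebesgue_measure R).

(* the support of a class is the essential one *)
Definition supp_half_line : {pred L2 R} := [pred f : L2 R |
  `[< \forall x \ae leb, f x != 0 -> closure (@half_line R) x >]].

Lemma supp_half_line_submod : submod_closed supp_half_line.
Proof.
split=> [|a f g].
  apply/asboolP; have := Lspc0E (@lebesgue_measure R) (lee1n 2).
  by apply: filterS => x ->; rewrite eqxx.
move=> /asboolP f0 /asboolP g0; apply/asboolP; near=> x.
rewrite (near (LspcDE (a *: f) g) x)// (near (LspcZE a f) x)//.
have [->|fx0 _] := eqVneq ((f : L2 R) x) 0.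
  by rewrite mulr0 add0r; near: x; exact: g0.
by move: fx0; near: x; exact: f0.
Unshelve. all: by end_near. Qed.

HB.instance Definition _ := GRing.isSubmodClosed.Build _ _ supp_half_line
  supp_half_line_submod.

Record L2_plus := L2Plus {
  L2_plus_val :> L2 R;
  L2_plusP : L2_plus_val \in supp_half_line
}.

HB.instance Definition _ := [isSub for L2_plus_val].
HB.instance Definition _ := [Choice of L2_plus by <:].
HB.instance Definition _ := [SubChoice_isSubLmodule of L2_plus by <:].

Let norm (f : L2_plus) : R[i] := `|val f|.

Let normD (f g : L2_plus) : norm (f + g) <= norm f + norm g.
Proof.
rewrite /norm; have -> : val (f + g) = val f + val g by exact: raddfD.
exact: ler_normD.
Qed.

Let normZ (a : R[i]) (f : L2_plus) : norm (a *: f) = `|a| * norm f.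
Proof.
rewrite /norm; have -> : val (a *: f) = a *: val f by exact: linearZ.
exact: normrZ.
Qed.

Let norm_eq0 (f : L2_plus) : norm f = 0 -> f = 0.
Proof. by move=> /normr0_eq0 f0; apply: val_inj; rewrite f0 raddf0. Qed.

HB.instance Definition _ := Lmodule_isNormed.Build R[i] L2_plus
  normD normZ norm_eq0.

End L2_plus.

Section operators.
Variable R : realType.
Local Notation leb := (@lebesgue_measure R).

Definition expi (t : R) : R[i] := cos t +i* sin t.

Definition cintegral (f : R -> R[i]) : R[i] :=
  (\int[leb]_x complex.Re (f x)) +i* (\int[leb]_x complex.Im (f x)).

Definition fourier_integral (f : R -> R[i]) (xi : R) : R[i] :=
  cintegral (fun x => expi (xi * x) * f x).

Definition truncation (n : nat) (f : R -> R[i]) (x : R) : R[i] :=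
  if x \in `[- n%:R, n%:R] then f x else 0.

(* the limit is taken in the norm of L^2; each truncation is in L^1 and L^2,
   so that, by Plancherel's theorem, its Fourier integral is in L^2 *)
Definition fourier (f : L2 R) : L2 R :=
  lim ((fun n : nat => Lcls leb (lee1n 2) (fourier_integral (truncation n f)))
        @ \oo).

(* [fourier] is bijective on L^2, by Plancherel's theorem *)
Definition inverse_fourier (g : L2 R) : L2 R := xget 0 [set f | fourier f = g].

Definition reflection p (p1 : (1 <= p)%E) (f : Lspc leb p1) : Lspc leb p1 :=
  Lcls leb p1 (fun x : R => f (- x)).

Definition restriction (f : L2 R) : L2_half_line R := Lcls _ (lee1n 2) f.

Definition wiener_hopf (phi : Linf R) (f : L2_plus R) : L2_half_line R :=
  restriction (inverse_fourier (Lmul phi (fourier f))).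

Definition hankel (phi : Linf R) (f : L2_plus R) : L2_half_line R :=
  restriction (inverse_fourier (Lmul phi (fourier (reflection f)))).

Definition wiener_hopf_plus_hankel (phi : Linf R) (f : L2_plus R) :
  L2_half_line R := wiener_hopf phi f + hankel phi f.

End operators.

Section almost_periodic.
Variable R : realType.
Local Notation leb := (@lebesgue_measure R).

Definition e_ (lambda : R) : Linf R :=
  Lcls leb (leey 1) (fun x : R => expi (lambda * x)).

Definition Linf1 : Linf R := Lcls leb (leey 1) (fun=> 1).

Definition closed_subalgebra (A : set (Linf R)) :=
  [/\ closed A, A 0,
      forall (a : R[i]) f g, A f -> A g -> A (a *: f + g)
    & forall f g, A f -> A g -> A (Lmul f g)].

Definition generated_algebra (E : set (Linf R)) : set (Linf R) :=
  smallest closed_subalgebra E.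

Definition AP : set (Linf R) := generated_algebra (range e_).

Definition APminus : set (Linf R) :=
  generated_algebra [set e_ lambda | lambda in [set lambda | lambda <= 0]].

(* [B] is a unital subalgebra of L^oo *)
Definition invertibles (B : set (Linf R)) : set (Linf R) :=
  [set f | B f /\ exists2 g, B g & Lmul f g = Linf1].

Definition AP_asymmetric_factorization (phi phi_minus : Linf R) (lambda : R)
    (phi_e : Linf R) :=
  [/\ invertibles APminus phi_minus, invertibles setT phi_e,
      reflection phi_e = phi_e
    & phi = Lmul (Lmul phi_minus (e_ lambda)) phi_e].

End almost_periodic.

(* Main.v *)
(** The Fourier transformation F is bounded on L^2 by a Schur estimate with the
    Poisson kernel, and F F = 2 pi J is tested on indicators of intervals, so the
    multipliers W(phi) = F^-1 phi F multiply like their symbols and W(e_l) is a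
    translation. Translations to the left preserve the functions vanishing on
    R_+, hence so does W(phi_-) for every phi_- in AP^-. Write r for restriction
    to R_+, Z and Q for extension by zero and even extension; since W(phi_e)
    commutes with J,
      WH_phi = [r W(phi_-) Z] [r W(e_l) Q] [r W(phi_e) Q] r.
    The outer factors are invertible, with inverses given by the inverse symbols.
    The middle factors M_l = r W(e_l) Q satisfy M_(-l) M_l = id for l >= 0, and
    the kernel of M_(-l) is infinite-dimensional for l > 0. *)
Require Import Defs.
From mathcomp Require Import all_boot all_order all_algebra.
From mathcomp Require Import complex.
From mathcomp Require Import all_classical all_reals all_analysis.
From mathcomp Require Import measurable_realfun ess_sup_inf.
From mathcomp Require Import ring lra zify.
Set Implicit Arguments.
Unset Strict Implicit.
Unset Printing Implicit Defensive.
Import Order.TTheory GRing.Theory Num.Theory.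
Import numFieldNormedType.Exports.
Import ComplexField.Normc.
Local Open Scope classical_set_scope.
Local Open Scope ring_scope.
Local Open Scope complex_scope.

(** * Complex-valued integrals *)

(** [fourier] is a [lim] and [inverse_fourier] an [xget]: both may be default values until
    convergence of the transformed truncations and surjectivity are known, so the L^2 theory must
    come before any statement about symbols. For the bound, |F f|^2 is damped by e^{-e|xi|}. The
    damped integral is a double integral of f against its conjugate with the Poisson kernel, whose
    mass 2 pi does not depend on e, and Fatou's lemma removes the damping. Pairings are bilinear,
    without conjugation, because F is symmetric for them. The two outer factors are inverted for
    different reasons. A minus symbol keeps the functions vanishing on R_+, so a cut to R_+ before
    W(phi_-) loses nothing; the inverse must have the same one-sided property, whence invertibility
    inside AP^-. An even symbol keeps even functions even, and these are determined by their values
    on R_+. Finally f + J f = Q r f for f supported in the closed half-line, which merges the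
    Wiener-Hopf and Hankel parts into one compressed multiplier. *)

Section complex_numbers.
Variable R : rcfType.
Implicit Types z : R[i].

Lemma normr_Re_le z : `|complex.Re z| <= normc z.
Proof.
case: z => a b /=; rewrite -sqrtr_sqr ler_wsqrtr//.
by rewrite lerDl sqr_ge0.
Qed.

Lemma normr_Im_le z : `|complex.Im z| <= normc z.
Proof.
case: z => a b /=; rewrite -sqrtr_sqr ler_wsqrtr//.
by rewrite lerDr sqr_ge0.
Qed.

Lemma normc_le_ReIm z : normc z <= `|complex.Re z| + `|complex.Im z|.
Proof.
case: z => a b /=.
rewrite -(@ler_pXn2r _ 2)// ?nnegrE ?sqrtr_ge0 ?addr_ge0//.
rewrite sqr_sqrtr ?addr_ge0 ?sqr_ge0//.
rewrite sqrrD !real_normK ?num_real// lerD2r lerDl.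
by rewrite mulrn_wge0// mulr_ge0.
Qed.

Lemma eq_ReIm z w :
  complex.Re z = complex.Re w -> complex.Im z = complex.Im w -> z = w.
Proof. by case: z w => a b [c d] /= -> ->. Qed.

Lemma normcN z : normc (- z) = normc z.
Proof. by case: z => a b /=; rewrite !sqrrN. Qed.

Lemma normc_sqr z : normc z ^+ 2 = complex.Re z ^+ 2 + complex.Im z ^+ 2.
Proof. by case: z => a b /=; rewrite sqr_sqrtr// addr_ge0// sqr_ge0. Qed.

Lemma normc_real (x : R) : normc x%:C = `|x|.
Proof. by rewrite /= expr0n/= addr0 sqrtr_sqr. Qed.

Lemma normc_conj z : normc (z^*) = normc z.
Proof. by case: z => a b /=; rewrite sqrrN. Qed.

Lemma conjcM z w : (z * w)^* = z^* * w^*.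
Proof. exact: rmorphM. Qed.

Lemma mulc_conj z : z * z^* = (normc z ^+ 2)%:C.
Proof.
rewrite normc_sqr; case: z => a b; apply/eqP; rewrite eq_complex/=.
by apply/andP; split; apply/eqP; ring.
Qed.

Lemma ReM z w : complex.Re (z * w) =
  complex.Re z * complex.Re w - complex.Im z * complex.Im w.
Proof. by case: z w => ? ? []. Qed.

Lemma ImM z w : complex.Im (z * w) =
  complex.Re z * complex.Im w + complex.Im z * complex.Re w.
Proof. by case: z w => ? ? []. Qed.

End complex_numbers.

Section expi.
Variable R : realType.

Lemma expiD (s t : R) : expi (s + t) = expi s * expi t.
Proof.
by apply/eqP; rewrite eq_complex/= cosD sinD; apply/andP; split; apply/eqP; ring.
Qed.

Lemma expiN (t : R) : expi (- t) = (expi t)^*.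
Proof. by rewrite /expi cosN sinN. Qed.

Lemma normc_expi (t : R) : normc (expi t) = 1.
Proof. by rewrite /= cos2Dsin2 sqrtr1. Qed.

Lemma cmeasurable_comp_expi d (T : measurableType d) (h : T -> R) :
  measurable_fun [set: T] h -> cmeasurable (fun x => expi (h x)).
Proof.
move=> mh; split => /=.
  apply: (@measurableT_comp _ _ _ _ _ _ (@cos R)) => //.
  by apply: continuous_measurable_fun; exact: continuous_cos.
apply: (@measurableT_comp _ _ _ _ _ _ (@sin R)) => //.
by apply: continuous_measurable_fun; exact: continuous_sin.
Qed.

Lemma cmeasurable_expi (t : R) :
  cmeasurable (fun x : measurableTypeR R => expi (t * x)).
Proof. by apply: cmeasurable_comp_expi; exact: measurable_funM. Qed.

End expi.

Section cmeasurable.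
Context d (T : measurableType d) (R : realType).
Implicit Types f : T -> R[i].

Lemma cmeasurable_conj f : cmeasurable f -> cmeasurable (fun x => (f x)^*).
Proof.
move=> [mr mi]; split.
  by rewrite (_ : (fun x => _) = (fun x => complex.Re (f x)))//;
     apply/funext => x; case: (f x).
rewrite (_ : (fun x => _) = (fun x => - complex.Im (f x))); last first.
  by apply/funext => x; case: (f x).
exact: measurableT_comp.
Qed.

Lemma cmeasurable_real (h : T -> R) : measurable_fun [set: T] h ->
  cmeasurable (fun x => (h x)%:C).
Proof. by move=> mh; split => //=; exact: measurable_cst. Qed.

Lemma cmeasurable_comp d' (T' : measurableType d') (f : T -> R[i])
    (h : T' -> T) :
  cmeasurable f -> measurable_fun [set: T'] h -> cmeasurable (fun x => f (h x)).
Proof.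
move=> [mr mi] mh; split.
  exact: (@measurableT_comp _ _ _ _ _ _ (fun x => complex.Re (f x))).
exact: (@measurableT_comp _ _ _ _ _ _ (fun x => complex.Im (f x))).
Qed.

Lemma cmeasurable_normcE f : cmeasurable f ->
  measurable_fun [set: T] (fun x => (normc (f x))%:E).
Proof. by move=> mf; exact/measurable_EFinP/cmeasurable_normc. Qed.

End cmeasurable.

Section complex_integral.
Variable R : realType.
Local Notation leb := (@lebesgue_measure R).
Implicit Types f g : measurableTypeR R -> R[i].

Definition cL1 f :=
  cmeasurable f /\ (\int[leb]_x (normc (f x))%:E < +oo)%E.

Lemma cL1_integrable f : cL1 f ->
  leb.-integrable setT (EFin \o (fun x => normc (f x))).
Proof.
move=> [mf lf]; apply/integrableP; split; first exact: cmeasurable_normcE.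
by under eq_integral do rewrite /= ger0_norm ?normc_ge0//.
Qed.

Lemma cL1_Re f : cL1 f ->
  leb.-integrable setT (EFin \o (fun x => complex.Re (f x))).
Proof.
move=> Lf; apply: le_integrable (cL1_integrable Lf) => //.
  by apply/measurable_EFinP; have [[]] := Lf.
by move=> x _ /=; rewrite lee_fin [leRHS]ger0_norm ?normc_ge0// normr_Re_le.
Qed.

Lemma cL1_Im f : cL1 f ->
  leb.-integrable setT (EFin \o (fun x => complex.Im (f x))).
Proof.
move=> Lf; apply: le_integrable (cL1_integrable Lf) => //.
  by apply/measurable_EFinP; have [[]] := Lf.
by move=> x _ /=; rewrite lee_fin [leRHS]ger0_norm ?normc_ge0// normr_Im_le.
Qed.

Lemma le_cL1 f (h : R -> R) : cmeasurable f ->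
  (forall x, normc (f x) <= h x) -> leb.-integrable setT (EFin \o h) -> cL1 f.
Proof.
move=> mf fh /integrableP[mh ih]; split => //.
apply: le_lt_trans ih; apply: ge0_le_integral => //.
- by move=> x _; rewrite lee_fin normc_ge0.
- exact: cmeasurable_normcE.
- exact: measurableT_comp.
- by move=> x _ /=; rewrite lee_fin (le_trans (fh x))// ler_norm.
Qed.

Lemma cL1D f g : cL1 f -> cL1 g -> cL1 (fun x => f x + g x).
Proof.
move=> Lf Lg; apply: (@le_cL1 _ (fun x => normc (f x) + normc (g x))).
- by apply: cmeasurableD; [case: Lf|case: Lg].
- by move=> x; exact: le_normcD.
- exact: (integrableD measurableT (cL1_integrable Lf) (cL1_integrable Lg)).
Qed.

Lemma cL1_Mbnd f g (M : R) : cmeasurable f -> (forall x, normc (f x) <= M) ->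
  cL1 g -> cL1 (fun x => f x * g x).
Proof.
move=> mf fM Lg; apply: (@le_cL1 _ (fun x => M * normc (g x))).
- by apply: cmeasurableM => //; case: Lg.
- by move=> x; rewrite normcM ler_wpM2r ?normc_ge0.
- exact: (integrableZl measurableT M (cL1_integrable Lg)).
Qed.

Lemma cL1Z (a : R[i]) f : cL1 f -> cL1 (fun x => a * f x).
Proof.
by apply: (@cL1_Mbnd (fun=> a) _ (normc a)) => //; exact: cmeasurable_cst.
Qed.

Lemma cL1_conj f : cL1 f -> cL1 (fun x => (f x)^*).
Proof.
move=> [mf lf]; split; first exact: cmeasurable_conj.
by under eq_integral do rewrite normc_conj.
Qed.

Lemma cintegralD f g : cL1 f -> cL1 g ->
  cintegral (fun x => f x + g x) = cintegral f + cintegral g.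
Proof.
move=> Lf Lg; apply/eqP; rewrite eq_complex/=; apply/andP; split; apply/eqP.
  under eq_Rintegral do rewrite raddfD/=.
  by rewrite RintegralD//; exact: cL1_Re.
under eq_Rintegral do rewrite raddfD/=.
by rewrite RintegralD//; exact: cL1_Im.
Qed.

Lemma cintegralZ (a : R[i]) f : cL1 f ->
  cintegral (fun x => a * f x) = a * cintegral f.
Proof.
move=> Lf; have iR := cL1_Re Lf; have iI := cL1_Im Lf.
apply/eqP; rewrite eq_complex ReM ImM/=; apply/andP; split; apply/eqP.
  under eq_Rintegral do rewrite ReM.
  rewrite RintegralB//; last 2 first.
    exact: (integrableZl measurableT (complex.Re a) iR).
    exact: (integrableZl measurableT (complex.Im a) iI).
  by rewrite !RintegralZl.
under eq_Rintegral do rewrite ImM.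
rewrite RintegralD//; last 2 first.
  exact: (integrableZl measurableT (complex.Re a) iI).
  exact: (integrableZl measurableT (complex.Im a) iR).
by rewrite !RintegralZl.
Qed.

Lemma eq_cintegral f g : f =1 g -> cintegral f = cintegral g.
Proof. by move=> fg; congr cintegral; exact/funext. Qed.

Lemma ae_eq_cintegral f g : cmeasurable f -> cmeasurable g ->
  (\forall x \ae leb, f x = g x) -> cintegral f = cintegral g.
Proof.
move=> [mfr mfi] [mgr mgi] fg; congr (_ +i* _); congr fine.
  apply: ae_eq_integral => //; try exact/measurable_EFinP.
  by apply: filterS fg => x ->.
apply: ae_eq_integral => //; try exact/measurable_EFinP.
by apply: filterS fg => x ->.
Qed.

Lemma normr_Rintegral_le (h : R -> R) (k : R -> R) :
  measurable_fun setT h -> measurable_fun setT k -> (forall x, `|h x| <= k x) ->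
  (`|\int[leb]_x h x|%:E <= \int[leb]_x (k x)%:E)%E.
Proof.
move=> mh mk hk; apply: (@le_trans _ _ `|\int[leb]_x (h x)%:E|%E).
  (* [fine] turns an infinite integral into 0, so the bound stays valid for a nonintegrable [h]. *)
  rewrite /Rintegral; case: (\int[leb]_x (h x)%:E)%E => [r| |] /=.
  - by [].
  - by rewrite normr0 leey.
  - by rewrite normr0 leey.
apply: (le_trans (le_abse_integral _ _ _)) => //; first exact/measurable_EFinP.
apply: ge0_le_integral => //.
- by apply: measurableT_comp => //; exact/measurable_EFinP.
- exact/measurable_EFinP.
- by move=> x _; rewrite lee_fin hk.
Qed.

(** The real and imaginary parts are each bounded by the integral of |f|, which is where the factor
    2 comes from; it reappears in the constant of the L^2 bound. *)
Lemma normc_cintegral_le f : cmeasurable f ->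
  ((normc (cintegral f))%:E <= 2%:E * \int[leb]_x (normc (f x))%:E)%E.
Proof.
move=> mf; have mn := cmeasurable_normc mf; case: (mf) => mr mi.
apply: (@le_trans _ _ (`|\int[leb]_x complex.Re (f x)|%:E +
                       `|\int[leb]_x complex.Im (f x)|%:E)%E).
  by rewrite -EFinD lee_fin; exact: normc_le_ReIm.
have -> : 2%:E = (1 + 1)%:E :> \bar R by [].
rewrite EFinD ge0_muleDl// !mul1e; apply: leeD.
  by apply: normr_Rintegral_le => // x; exact: normr_Re_le.
by apply: normr_Rintegral_le => // x; exact: normr_Im_le.
Qed.

End complex_integral.

(** * Changes of variable preserving Lebesgue measure *)

Section measure_preserving.
Variable R : realType.
Local Notation leb := (@lebesgue_measure R).
Implicit Types phi : measurableTypeR R -> measurableTypeR R.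

Definition measure_preserving phi :=
  measurable_fun setT phi /\
  forall A, measurable A -> leb (phi @^-1` A) = leb A.

Lemma integral_measure_preserving phi (f : measurableTypeR R -> \bar R) :
  measure_preserving phi -> measurable_fun setT f ->
  (\int[leb]_x f (phi x) = \int[leb]_x f x)%E.
Proof.
move=> [mphi pphi].
have ge0 (g : measurableTypeR R -> \bar R) : measurable_fun setT g ->
    (forall x, 0 <= g x)%E -> (\int[leb]_x g (phi x) = \int[leb]_x g x)%E.
  move=> mg g0; have := @ge0_integral_pushforward _ _ _ _ _ _ mphi leb setT g
    measurableT mg (fun y _ => g0 y).
  rewrite preimage_setT => <-; apply: eq_measure_integral => A mA _.
  exact: pphi.
move=> mf; rewrite [LHS]integralE [RHS]integralE; congr (_ - _)%E.
  have -> : (fun x => f (phi x))^\+%E = f^\+%E \o phi.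
    by apply/funext => x; rewrite -funepos_comp.
  by apply: (ge0 f^\+%E) => //; exact: measurable_funepos.
have -> : (fun x => f (phi x))^\-%E = f^\-%E \o phi.
  by apply/funext => x; rewrite -funeneg_comp.
by apply: (ge0 f^\-%E) => //; exact: measurable_funeneg.
Qed.

Lemma ae_measure_preserving phi (P : R -> Prop) :
  measure_preserving phi ->
  (\forall x \ae leb, P x) -> \forall x \ae leb, P (phi x).
Proof.
move=> [mphi pphi] [A [mA A0 PA]]; exists (phi @^-1` A); split.
- by rewrite -[X in measurable X]setTI; exact: mphi.
- by rewrite pphi.
- by move=> x /= Px; exact: PA.
Qed.

Lemma cintegral_measure_preserving phi (f : R -> R[i]) :
  measure_preserving phi -> cmeasurable (f : measurableTypeR R -> R[i]) ->
  cintegral (fun x => f (phi x)) = cintegral f.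
Proof.
move=> pphi [mr mi]; apply: eq_ReIm; congr fine.
  by apply: (integral_measure_preserving pphi (f := fun x => (complex.Re (f x))%:E));
     exact/measurable_EFinP.
by apply: (integral_measure_preserving pphi (f := fun x => (complex.Im (f x))%:E));
   exact/measurable_EFinP.
Qed.

Lemma measure_preserving_shift (a : R) :
  measure_preserving (fun x => x + a : measurableTypeR R).
Proof.
have mphi : measurable_fun setT (fun x : measurableTypeR R => x + a : measurableTypeR R).
  exact: measurable_funD.
split => // A mA; apply/esym.
apply: (@lebesgue_measure_unique R (pushforward leb (fun x : measurableTypeR R => x + a : measurableTypeR R))) => //.
move=> X [[u v] /= uv <-]; rewrite /pushforward.
rewrite (_ : _ @^-1` _ = `]u - a, v - a]%classic); last first.
  by apply/seteqP; split => x /=; rewrite !in_itv/= ltrBlDr lerBrDr.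
by rewrite !lebesgue_measure_itv/= !lte_fin ltrD2r -!EFinD opprD opprK addrACA addNr addr0.
Qed.

Lemma measure_preserving_opp :
  measure_preserving (fun x => - x : measurableTypeR R).
Proof.
have mphi : measurable_fun setT (fun x : measurableTypeR R => - x : measurableTypeR R).
  exact: measurableT_comp.
split => // A mA; apply/esym.
apply: (@lebesgue_measure_unique R (pushforward leb (fun x : measurableTypeR R => - x : measurableTypeR R))) => //.
move=> X [[u v] /= uv <-]; rewrite /pushforward.
rewrite (_ : _ @^-1` _ = `[- v, - u[%classic); last first.
  by apply/seteqP; split => x /=; rewrite !in_itv/= lerNl ltrNr andbC.
by rewrite !lebesgue_measure_itv/= !lte_fin ltrN2 -!EFinD opprK addrC.
Qed.

End measure_preserving.

(** * The Fourier integral on L^1 *)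

Section fourier_integral_L1.
Variable R : realType.
Local Notation leb := (@lebesgue_measure R).
Implicit Types f g : measurableTypeR R -> R[i].

(** The inner real integrals are [fine] of extended ones, which are infinite on a null set at most;
    up to that set this is Fubini's theorem for extended integrals. *)
Lemma Rintegral_Fubini (u : measurableTypeR R * measurableTypeR R -> R) :
  (leb \x leb)%E.-integrable setT (EFin \o u) ->
  \int[leb]_x \int[leb]_y u (x, y) = \int[leb]_y \int[leb]_x u (x, y).
Proof.
move=> iu; congr fine.
transitivity (\int[leb]_x \int[leb]_y (u (x, y))%:E)%E.
  apply: ae_eq_integral => //.
  - apply/measurable_EFinP.
    by apply: measurableT_comp => //; exact: (measurable_fubini_F iu).
  - exact: (measurable_fubini_F iu).
  - apply: filterS (integrable_ae measurableT (integrable_fubini_F iu)).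
    by move=> x /(_ I) xfin _ /=; rewrite fineK.
rewrite (Fubini iu); apply: ae_eq_integral => //.
- exact: (measurable_fubini_G iu).
- apply/measurable_EFinP.
  by apply: measurableT_comp => //; exact: (measurable_fubini_G iu).
- apply: filterS (ae_integrable2 iu).
  by move=> x ix _ /=; rewrite fineK//; exact: integrable_fin_num ix.
Qed.

Lemma cFubini (k : measurableTypeR R * measurableTypeR R -> R[i]) :
  cmeasurable k ->
  (\int[leb]_x \int[leb]_y (normc (k (x, y)))%:E < +oo)%E ->
  cintegral (fun x => cintegral (fun y => k (x, y))) =
  cintegral (fun y => cintegral (fun x => k (x, y))).
Proof.
move=> mk ik.
have ikn : (leb \x leb)%E.-integrable setT (EFin \o (fun z => normc (k z))).
  apply/integrable12ltyP; first exact: cmeasurable_normcE.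
  rewrite (eq_integral (fun x => \int[leb]_y (normc (k (x, y)))%:E))%E//.
  move=> x _; apply: eq_integral => y _ /=.
  by rewrite ger0_norm ?normc_ge0.
have swap (u : measurableTypeR R * measurableTypeR R -> R) :
    measurable_fun setT u -> (forall z, `|u z| <= normc (k z)) ->
    \int[leb]_x \int[leb]_y u (x, y) = \int[leb]_y \int[leb]_x u (x, y).
  move=> mu uk; apply: Rintegral_Fubini.
  apply: le_integrable ikn => //; first exact/measurable_EFinP.
  by move=> z _ /=; rewrite lee_fin [leRHS]ger0_norm ?normc_ge0.
apply: eq_ReIm.
  exact: (swap (fun z => complex.Re (k z)) mk.1 (fun z => normr_Re_le (k z))).
exact: (swap (fun z => complex.Im (k z)) mk.2 (fun z => normr_Im_le (k z))).
Qed.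

Lemma cL1_expi f xi : cL1 f -> cL1 (fun x => expi (xi * x) * f x).
Proof.
apply: (@cL1_Mbnd R _ _ 1); first exact: cmeasurable_expi.
by move=> x; rewrite normc_expi.
Qed.

Lemma fourier_integralD f g : cL1 f -> cL1 g ->
  fourier_integral (fun x => f x + g x) =
  (fun xi => fourier_integral f xi + fourier_integral g xi).
Proof.
move=> Lf Lg; apply/funext => xi.
rewrite -cintegralD; try exact: cL1_expi.
by apply: eq_cintegral => x; rewrite mulrDr.
Qed.

Lemma fourier_integralZ (a : R[i]) f : cL1 f ->
  fourier_integral (fun x => a * f x) = (fun xi => a * fourier_integral f xi).
Proof.
move=> Lf; apply/funext => xi.
rewrite -cintegralZ; last exact: cL1_expi.
by apply: eq_cintegral => x; rewrite mulrCA.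
Qed.

Lemma ae_eq_fourier_integral f g : cmeasurable f -> cmeasurable g ->
  (\forall x \ae leb, f x = g x) -> fourier_integral f = fourier_integral g.
Proof.
move=> mf mg fg; apply/funext => xi; apply: ae_eq_cintegral.
- by apply: cmeasurableM => //; exact: cmeasurable_expi.
- by apply: cmeasurableM => //; exact: cmeasurable_expi.
- by apply: filterS fg => x ->.
Qed.

Definition L1norm f : R := fine (\int[leb]_x (normc (f x))%:E)%E.

Lemma L1normE f : cL1 f -> (L1norm f)%:E = (\int[leb]_x (normc (f x))%:E)%E.
Proof.
move=> [mf lf]; rewrite fineK// ge0_fin_numE//.
by apply: integral_ge0 => x _; rewrite lee_fin normc_ge0.
Qed.

Lemma fourier_integral_bounded f xi : cL1 f ->
  normc (fourier_integral f xi) <= 2 * L1norm f.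
Proof.
move=> Lf; rewrite -lee_fin EFinM L1normE//.
apply: (le_trans (normc_cintegral_le (cL1_expi xi Lf).1)).
by under eq_integral do rewrite normcM normc_expi mul1r.
Qed.

(** Measurability is derived from continuity, itself a case of continuity under the integral sign:
    |expi| = 1, so |f| is an integrable majorant for all frequencies at once. *)
Lemma cmeasurable_fourier_integral f : cL1 f ->
  cmeasurable (fourier_integral f : measurableTypeR R -> R[i]).
Proof.
move=> Lf.
have cont (u : R -> R -> R) : (forall y, continuous (u^~ y)) ->
    (forall x, measurable_fun [set: measurableTypeR R] (u x)) ->
    (forall x y, `|u x y| <= normc (f y)) ->
    continuous (fun x => \int[leb]_y u x y).
  move=> cu mu uf x.
  apply: (@continuity_under_integral _ _ _ leb u setT measurableT (x - 1) (x + 1)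
    _ _ (fun y => normc (f y)) (cL1_integrable Lf)).
  - move=> z _; apply: le_integrable (cL1_integrable Lf) => //.
      exact/measurable_EFinP.
    by move=> y _ /=; rewrite lee_fin [leRHS]ger0_norm ?normc_ge0.
  - by apply: nearW => y _ z _; exact: cu.
  - by move=> z _; apply: nearW => y _.
  - by rewrite inE/= in_itv/= ltrBlDr ltrDl ltr01.
have mk (xi : R) : cmeasurable (fun x : measurableTypeR R => expi (xi * x) * f x).
  by have [] := cL1_expi xi Lf.
have ce (z : R[i]) : continuous (fun t : R => complex.Re (expi t * z)) /\
    continuous (fun t : R => complex.Im (expi t * z)).
  split => t.
    under eq_fun do rewrite ReM/=.
    by apply: cvgB; apply: cvgMl; [exact: continuous_cos|exact: continuous_sin].
  under eq_fun do rewrite ImM/=.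
  by apply: cvgD; apply: cvgMl; [exact: continuous_cos|exact: continuous_sin].
split; apply: continuous_measurable_fun.
  apply: (cont (fun xi y => complex.Re (expi (xi * y) * f y))).
  - move=> y xi; have [c _] := ce (f y).
    exact: (cvg_comp (fun t => t * y) (fun t => complex.Re (expi t * f y))
      (@mulrr_continuous _ y xi) (c (xi * y))).
  - by move=> xi; have [] := mk xi.
  - move=> xi y; apply: (le_trans (normr_Re_le _)).
    by rewrite normcM normc_expi mul1r.
apply: (cont (fun xi y => complex.Im (expi (xi * y) * f y))).
- move=> y xi; have [_ c] := ce (f y).
  exact: (cvg_comp (fun t => t * y) (fun t => complex.Im (expi t * f y))
    (@mulrr_continuous _ y xi) (c (xi * y))).
- by move=> xi; have [] := mk xi.
- move=> xi y; apply: (le_trans (normr_Im_le _)).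
  by rewrite normcM normc_expi mul1r.
Qed.

Lemma cL1_Mfourier_integral f g : cL1 f -> cL1 g ->
  cL1 (fun x => f x * fourier_integral g x).
Proof.
move=> Lf Lg.
rewrite (_ : (fun x => _) = (fun x => fourier_integral g x * f x)); last first.
  by apply/funext => x; rewrite mulrC.
apply: (cL1_Mbnd _ (fun x => fourier_integral_bounded x Lg)) => //.
exact: cmeasurable_fourier_integral.
Qed.

(** Fubini for f(x) g(y) e^{ixy}, whose modulus |f(x)| |g(y)| has a finite double integral. *)
Lemma multiplication_formula f g : cL1 f -> cL1 g ->
  cintegral (fun x => f x * fourier_integral g x) =
  cintegral (fun y => g y * fourier_integral f y).
Proof.
move=> Lf Lg; have [mf _] := Lf; have [mg _] := Lg.
pose k (z : measurableTypeR R * measurableTypeR R) :=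
  f z.1 * g z.2 * expi (z.1 * z.2).
have mk : cmeasurable k.
  apply: cmeasurableM.
    by apply: cmeasurableM; apply: cmeasurable_comp.
  by apply: cmeasurable_comp_expi; apply: measurable_funM.
have nk x y : normc (k (x, y)) = normc (f x) * normc (g y).
  by rewrite /k/= !normcM normc_expi mulr1.
have ik : (\int[leb]_x \int[leb]_y (normc (k (x, y)))%:E < +oo)%E.
  have n0 (h : measurableTypeR R -> R[i]) x :
    (0 <= (normc (h x))%:E)%E by rewrite lee_fin normc_ge0.
  rewrite (eq_integral (fun x => (normc (f x))%:E * (L1norm g)%:E)%E).
    rewrite (ge0_integralZr leb measurableT) //.
    - by rewrite -L1normE// -EFinM ltry.
    - exact: cmeasurable_normcE.
    - by rewrite L1normE//; apply: integral_ge0.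
  move=> x _; rewrite L1normE// -(ge0_integralZl leb measurableT)//.
    by apply: eq_integral => y _; rewrite nk EFinM.
  exact: cmeasurable_normcE.
have := @cFubini k mk ik; rewrite /k/= => fub.
transitivity (cintegral (fun x => cintegral (fun y => f x * g y * expi (x * y)))).
  apply: eq_cintegral => x; rewrite -cintegralZ; last exact: cL1_expi.
  by apply: eq_cintegral => y; ring.
rewrite fub.
apply: eq_cintegral => y; rewrite -cintegralZ; last exact: cL1_expi.
by apply: eq_cintegral => x; rewrite [y * x]mulrC; ring.
Qed.

End fourier_integral_L1.

(** * Abel means and the Poisson kernel *)

Section poisson_kernel.
Variable R : realType.
Local Notation leb := (@lebesgue_measure R).
Implicit Types (e t x : R).

Definition abel_weight e x : R := expR (- (e * `|x|)).

(** Normalized to be the Fourier integral of [abel_weight e], so that its total mass is 2 pi instead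
    of 1. *)
Definition poisson e t : R := 2 * e / (e ^+ 2 + t ^+ 2).

Lemma abel_weight_gt0 e x : 0 < abel_weight e x.
Proof. exact: expR_gt0. Qed.

Lemma abel_weight_le1 e x : 0 <= e -> abel_weight e x <= 1.
Proof. by move=> e0; rewrite -expR0 ler_expR oppr_le0 mulr_ge0. Qed.

Lemma poisson_ge0 e t : 0 <= e -> 0 <= poisson e t.
Proof.
by move=> e0; rewrite /poisson divr_ge0 ?mulr_ge0// addr_ge0 ?sqr_ge0.
Qed.

Lemma continuous_abel_weight e : continuous (abel_weight e).
Proof.
move=> x; apply: (cvg_comp (fun t => - (e * `|t|)) expR); last exact: continuous_expR.
by apply: cvgN; apply: cvgMr; apply: cvg_norm; exact: cvg_id.
Qed.

Lemma is_derive1_linear (c x : R) : is_derive x 1 (fun y => c * y) c.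
Proof.
have := @is_deriveZ R R^o R^o id c x 1 1 (is_derive_id x 1).
by rewrite [c *: 1]mulr1.
Qed.

(** Closed-form antiderivative of e^{-ex}(1 + cos(tx)). It vanishes at infinity, so the integral
    over the positive half-line is -F(0). *)
Let F e t x : R := expR (- (e * x)) *
  (- e^-1 + (e ^+ 2 + t ^+ 2)^-1 * (t * sin (t * x) - e * cos (t * x))).

Let is_derive_F e t x : 0 < e ->
  is_derive x 1 (F e t) (expR (- (e * x)) * (1 + cos (t * x))).
Proof.
move=> e0.
have de : is_derive x 1 (fun x => expR (- (e * x))) (expR (- (e * x)) * (- e)).
  apply: (@is_derive1_comp R expR (fun x => - (e * x)) x).
  exact: (@is_deriveN _ _ _ (fun x => e * x) x 1 e (is_derive1_linear e x)).
have ds : is_derive x 1 (fun x => sin (t * x)) (cos (t * x) * t).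
  exact: (@is_derive1_comp R sin (fun x => t * x) x _ _ _ (is_derive1_linear t x)).
have dc : is_derive x 1 (fun x => cos (t * x)) (- sin (t * x) * t).
  exact: (@is_derive1_comp R cos (fun x => t * x) x _ _ _ (is_derive1_linear t x)).
have dG : is_derive x 1 (fun x => - e^-1 + (e ^+ 2 + t ^+ 2)^-1 *
      (t * sin (t * x) - e * cos (t * x)))
    (0 + (e ^+ 2 + t ^+ 2)^-1 * (t * (cos (t * x) * t) - e * (- sin (t * x) * t))).
  apply: (@is_deriveD _ _ _ (fun=> - e^-1) (fun x => (e ^+ 2 + t ^+ 2)^-1 *
      (t * sin (t * x) - e * cos (t * x)))).
have := is_deriveM de dG; rewrite /F => /is_derive_eq; apply.
rewrite /GRing.scale/=.
have d0 : e ^+ 2 + t ^+ 2 != 0.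
  by rewrite gt_eqF// ltr_pwDl ?sqr_ge0 ?exprn_gt0.
have e0' : e != 0 by rewrite gt_eqF.
by field; rewrite e0' d0.
Qed.

(** The added 1 makes the integrand nonnegative, as the improper form of the fundamental theorem of
    calculus requires. The cosine integral alone is recovered later by subtracting the weight. *)
Lemma integral_abel_cos e t : 0 < e ->
  (\int[leb]_x (abel_weight e x * (1 + cos (t * x)))%:E =
   (2 / e + poisson e t)%:E)%E.
Proof.
move=> e0.
have f0 x : 0 <= abel_weight e x * (1 + cos (t * x)).
  by rewrite mulr_ge0 ?(ltW (abel_weight_gt0 _ _))// -lerBlDl sub0r cos_geN1.
have cc : continuous (fun x => cos (t * x)).
  move=> x; apply: (cvg_comp (fun x => t * x) cos); last exact: continuous_cos.
  exact: mulrl_continuous.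
rewrite ge0_symfun_integralT//; last 2 first.
- move=> x; apply: cvgM; first exact: continuous_abel_weight.
  by apply: cvgD; [exact: cvg_cst|exact: cc].
- by move=> x /=; rewrite /abel_weight normrN mulrN cosN.
rewrite (_ : [set x | _] = `[0, +oo[%classic); last first.
  by apply/seteqP; split => x /=; rewrite in_itv/= andbT.
transitivity (2 * \int[leb]_(x in `[0%R, +oo[)
    (expR (- (e * x)) * (1 + cos (t * x)))%:E)%E.
  congr (2 * _)%E; apply: eq_integral => x; rewrite inE/= in_itv/= andbT => x0.
  by rewrite /abel_weight ger0_norm.
have cF x : {for x, continuous (F e t)}.
  apply: differentiable_continuous; apply/derivable1_diffP.
  by have [] := is_derive_F t x e0.
rewrite (@ge0_continuous_FTC2y _ _ (F e t) 0 0).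
- rewrite /F mulr0 oppr0 expR0 mulr0 sin0 cos0 mulr0 mulr1 sub0r mul1r.
  rewrite -EFinD -EFinM; congr EFin; rewrite /poisson.
  have d0 : e ^+ 2 + t ^+ 2 != 0.
    by rewrite gt_eqF// ltr_pwDl ?sqr_ge0 ?exprn_gt0.
  have e0' : e != 0 by rewrite gt_eqF.
  by field; rewrite e0' d0.
- move=> x x0; have := f0 x; rewrite /abel_weight ger0_norm//.
- apply: continuous_subspaceT => x; apply: cvgM.
    apply: (cvg_comp (fun t => - (e * t)) expR); last exact: continuous_expR.
    by apply: cvgN; exact: mulrl_continuous.
  by apply: cvgD; [exact: cvg_cst|exact: cc].
(* [C] bounds the second factor of [F], by |sin|, |cos| <= 1, so that C e^{-ex} squeezes [F] to 0 at
   infinity. *)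
- pose C := e^-1 + (e ^+ 2 + t ^+ 2)^-1 * (`|t| + e).
  have Fle x : `|F e t x| <= C * expR (- (e * x)).
    rewrite /F normrM ger0_norm ?expR_ge0// mulrC ler_wpM2r ?expR_ge0//.
    rewrite (le_trans (ler_normD _ _))// normrN gtr0_norm ?invr_gt0// lerD2l.
    rewrite normrM ger0_norm ?invr_ge0 ?addr_ge0 ?sqr_ge0//.
    rewrite ler_wpM2l ?invr_ge0 ?addr_ge0 ?sqr_ge0//.
    rewrite (le_trans (ler_normB _ _))// lerD// normrM.
      by rewrite ler_piMr// ler_norml sin_geN1 sin_le1.
    by rewrite (gtr0_norm e0) ler_piMr ?(ltW e0)// ler_norml cos_geN1 cos_le1.
  have lim0 : C * expR (- (e * x)) @[x --> +oo] --> 0.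
    rewrite -[X in _ --> X](mulr0 C); apply: cvgMr.
    apply: (cvg_comp (fun x => e * x) (fun x => expR (- x))); last exact: cvgr_expR.
    exact: gt0_cvgMry.
  apply: norm_cvg0; apply: squeeze_cvgr (cvg_cst 0) lim0.
  by apply: nearW => x; rewrite normr_ge0 Fle.
- by move=> x _; have [] := is_derive_F t x e0.
- by apply: cvg_at_right_filter; exact: cF.
- by move=> x _; rewrite derive1E; have [] := is_derive_F t x e0.
Qed.

End poisson_kernel.

Section poisson_fourier.
Variable R : realType.
Local Notation leb := (@lebesgue_measure R).
Implicit Types (e t x : R).

Lemma measurable_abel_weight e :
  measurable_fun [set: measurableTypeR R] (abel_weight e).
Proof. by apply: continuous_measurable_fun; exact: continuous_abel_weight. Qed.

Lemma integrable_abel_weight e : 0 < e ->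
  leb.-integrable setT (EFin \o abel_weight e).
Proof.
move=> e0.
apply: (@le_integrable _ _ _ leb _ measurableT _
    (EFin \o (fun x => abel_weight e x * (1 + cos (0 * x))))).
- by apply/measurable_EFinP; exact: measurable_abel_weight.
- move=> x _ /=; rewrite mul0r cos0 lee_fin !ger0_norm ?mulr_ge0 ?(ltW (abel_weight_gt0 _ _))//.
  by rewrite ler_peMr ?(ltW (abel_weight_gt0 _ _))// lerDl.
- apply/integrableP; split.
    apply/measurable_EFinP; apply: measurable_funM; first exact: measurable_abel_weight.
    apply: measurable_funD => //.
    under eq_fun do rewrite mul0r.
    exact: measurable_cst.
  under eq_integral.
    move=> x _ /=; rewrite ger0_norm; last first.
      by rewrite mul0r cos0 mulr_ge0 ?(ltW (abel_weight_gt0 _ _)).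
    over.
  by rewrite integral_abel_cos// ltry.
Qed.

(** At t = 0 the integrand of [integral_abel_cos] is twice the weight and [poisson e 0] is 2/e, so
    twice the integral is 4/e. *)
Lemma Rintegral_abel_weight e : 0 < e -> \int[leb]_x abel_weight e x = 2 / e.
Proof.
move=> e0; have := integral_abel_cos 0 e0 => /(congr1 fine) /=.
under eq_integral do rewrite mul0r cos0.
move=> h.
have : \int[leb]_x (abel_weight e x * (1 + 1)) = 2 / e + poisson e 0 by [].
rewrite RintegralZr//; last exact: integrable_abel_weight.
rewrite /poisson expr0n addr0 => {}h.
have e0' : e != 0 by rewrite gt_eqF.
have : \int[leb]_x abel_weight e x * 2 = (2 / e) * 2 by rewrite h; field.
by move/mulIf; apply; rewrite pnatr_eq0.
Qed.

Lemma cL1_abel_weight e : 0 < e ->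
  cL1 (fun x : measurableTypeR R => (abel_weight e x)%:C).
Proof.
move=> e0; apply: (le_cL1 _ _ (integrable_abel_weight e0)).
  by apply: cmeasurable_real; exact: measurable_abel_weight.
by move=> x; rewrite normc_real gtr0_norm ?abel_weight_gt0.
Qed.

Lemma fourier_integral_abel_weight e t : 0 < e ->
  fourier_integral (fun x => (abel_weight e x)%:C) t = (poisson e t)%:C.
Proof.
move=> e0.
have L : cL1 (fun x : measurableTypeR R => expi (t * x) * (abel_weight e x)%:C).
  by apply: cL1_expi; exact: cL1_abel_weight.
apply: eq_ReIm => /=.
  have := integral_abel_cos t e0 => /(congr1 fine) /= h.
  transitivity (\int[leb]_x (abel_weight e x * (1 + cos (t * x)) - abel_weight e x)).
    by apply: eq_Rintegral => x _; ring.
  rewrite RintegralB//.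
  - rewrite Rintegral_abel_weight// /Rintegral h; ring.
  - apply/integrableP; split.
      apply/measurable_EFinP; apply: measurable_funM; first exact: measurable_abel_weight.
      apply: measurable_funD => //; have [] := cmeasurable_expi t; by [].
    under eq_integral.
      move=> x _ /=; rewrite ger0_norm; last first.
        by rewrite mulr_ge0 ?(ltW (abel_weight_gt0 _ _))// -lerBlDl sub0r cos_geN1.
      over.
    by rewrite integral_abel_cos// ltry.
  - exact: integrable_abel_weight.
(* The imaginary part is odd: its integral equals its own opposite. *)
set f : R -> R := fun x => complex.Im (expi (t * x) * (abel_weight e x)%:C).
have fN x : f (- x) = - f x.
  by rewrite /f !ImM/= /abel_weight normrN !mulrN sinN cosN; ring.
have iI := cL1_Im L.
have : \int[leb]_x f x = \int[leb]_x f (- x).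
  have h := integral_measure_preserving (measure_preserving_opp R) (measurable_int _ iI).
  exact: (esym (congr1 fine h)).
under [in RHS]eq_Rintegral do rewrite fN -mulN1r.
rewrite RintegralZl// mulN1r => h.
have : 2 * \int[leb]_x f x = 0 by rewrite mulrDl mul1r {2}h subrr.
by move/eqP; rewrite mulf_eq0 pnatr_eq0/= => /eqP.
Qed.

End poisson_fourier.

Section poisson_integral.
Variable R : realType.
Local Notation leb := (@lebesgue_measure R).
Implicit Types (e t x : R).

Lemma is_derive_atan_poisson e x t : 0 < e ->
  is_derive t 1 (fun t => 2 * atan (e^-1 * (x + t))) (poisson e (x + t)).
Proof.
move=> e0.
have d1 : is_derive t 1 (fun t => x + t) (0 + 1).
  exact: (@is_deriveD _ _ _ (fun=> x) id).
have d2 : is_derive t 1 (fun t => e^-1 * (x + t)) (e^-1 * (0 + 1)).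
  exact: (@is_deriveZ R R^o R^o (fun t => x + t)).
have d3 := @is_derive1_comp R atan (fun t => e^-1 * (x + t)) t _ _
  (is_derive1_atan _) d2.
have := @is_deriveZ R R^o R^o (fun t => atan (e^-1 * (x + t))) 2 t 1 _ d3.
move=> /is_derive_eq; apply.
rewrite /GRing.scale/= /poisson.
have e0' : e != 0 by rewrite gt_eqF.
have d0 : e ^+ 2 + (x + t) ^+ 2 != 0.
  by rewrite gt_eqF// ltr_pwDl ?sqr_ge0 ?exprn_gt0.
have d1' : 1 + (e^-1 * (x + t)) ^+ 2 != 0.
  by rewrite gt_eqF// ltr_pwDl ?sqr_ge0.
have -> : 1 + (e^-1 * (x + t)) ^+ 2 = (e ^+ 2 + (x + t) ^+ 2) / e ^+ 2 by field.
by field; rewrite e0' d0.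
Qed.

Lemma continuous_poisson e : 0 < e -> continuous (poisson e).
Proof.
move=> e0 t; apply: cvgMr; apply: cvgV.
  by rewrite gt_eqF// ltr_pwDl ?sqr_ge0 ?exprn_gt0.
by apply: cvgD; [exact: cvg_cst|exact: exprn_continuous].
Qed.

Lemma measurable_poisson e : 0 < e ->
  measurable_fun [set: measurableTypeR R] (poisson e).
Proof. by move=> e0; apply: continuous_measurable_fun; exact: continuous_poisson. Qed.

Lemma integral_poisson e : 0 < e ->
  (\int[leb]_t (poisson e t)%:E = (2 * pi)%:E)%E.
Proof.
move=> e0.
rewrite ge0_symfun_integralT//; last 3 first.
- by move=> t; apply: poisson_ge0; exact: ltW.
- exact: continuous_poisson.
- by move=> t /=; rewrite /poisson sqrrN.
rewrite (_ : [set x | _] = `[0, +oo[%classic); last first.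
  by apply/seteqP; split => x /=; rewrite in_itv/= andbT.
have d t : is_derive t 1 (fun t => 2 * atan (e^-1 * (0 + t))) (poisson e t).
  by have := is_derive_atan_poisson 0 t e0; rewrite add0r.
rewrite (@ge0_continuous_FTC2y _ _ (fun t => 2 * atan (e^-1 * (0 + t))) 0 pi).
- by rewrite addr0 mulr0 atan0 mulr0 -EFinB subr0 -EFinM.
- by move=> t _; apply: poisson_ge0; exact: ltW.
- by apply: continuous_subspaceT; exact: continuous_poisson.
- rewrite (_ : pi = 2 * (pi / 2)); last by field.
  apply: cvgMr.
  under eq_cvg do rewrite add0r.
  apply: (cvg_comp (fun t => e^-1 * t) atan); last exact: cvgy_atan.
  by apply: gt0_cvgMry; rewrite ?invr_gt0.
- by move=> t _; have [] := d t.
- have c : {for 0, continuous (fun t => 2 * atan (e^-1 * (0 + t)))}.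
    by apply: differentiable_continuous; apply/derivable1_diffP; have [] := d 0.
  exact: cvg_at_right_filter c.
- by move=> t _; rewrite derive1E; have [] := d t.
Qed.

Lemma integral_poisson_shift e x : 0 < e ->
  (\int[leb]_t (poisson e (t + x))%:E = (2 * pi)%:E)%E.
Proof.
move=> e0; rewrite -(integral_poisson e0).
apply: (integral_measure_preserving (measure_preserving_shift x)
  (f := EFin \o poisson e)).
by apply/measurable_EFinP; exact: measurable_poisson.
Qed.

Lemma integral_poisson_itv e x (a b : R) : 0 < e -> a < b ->
  (\int[leb]_(t in `[a, b]) (poisson e (x + t))%:E =
   (2 * atan (e^-1 * (x + b)) - 2 * atan (e^-1 * (x + a)))%:E)%E.
Proof.
move=> e0 ab; have d t := is_derive_atan_poisson x t e0.
rewrite (@continuous_FTC2 _ _ (fun t => 2 * atan (e^-1 * (x + t))))//.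
- apply: continuous_subspaceT => t.
  apply: (cvg_comp (fun t => x + t) (poisson e)); last exact: continuous_poisson.
  by apply: cvgD; [exact: cvg_cst|exact: cvg_id].
- have c t : {for t, continuous (fun t => 2 * atan (e^-1 * (x + t)))}.
    by apply: differentiable_continuous; apply/derivable1_diffP; have [] := d t.
  split.
  + by move=> t _; have [] := d t.
  + by apply: cvg_at_right_filter; exact: c.
  + by apply: cvg_at_left_filter; exact: c.
- by move=> t _; rewrite derive1E; have [] := d t.
Qed.

(** Schur's test: u v <= (u^2 + v^2)/2, and in each of the two terms the kernel integrates to 2 pi
    over the free variable. The constant pi is uniform in [e], which later allows [e] to tend to
    0. *)
Lemma schur_poisson e (u v : measurableTypeR R -> R) : 0 < e ->
  measurable_fun setT u -> measurable_fun setT v ->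
  (forall x, 0 <= u x) -> (forall x, 0 <= v x) ->
  (\int[leb]_x \int[leb]_y (u x * (v y * poisson e (x + y)))%:E <=
   pi%:E * (\int[leb]_x (u x ^+ 2)%:E + \int[leb]_x (v x ^+ 2)%:E))%E.
Proof.
move=> e0 mu mv u0 v0.
have P0 t : 0 <= poisson e t by apply: poisson_ge0; exact: ltW.
pose h (w : measurableTypeR R -> R) (z : measurableTypeR R * measurableTypeR R) :=
  (w z.1 ^+ 2 / 2 * poisson e (z.1 + z.2))%:E.
pose h' (w : measurableTypeR R -> R) (z : measurableTypeR R * measurableTypeR R) :=
  (w z.2 ^+ 2 / 2 * poisson e (z.1 + z.2))%:E.
have h0 w z : (0 <= h w z)%E.
  by rewrite lee_fin mulr_ge0// divr_ge0// sqr_ge0.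
have h'0 w z : (0 <= h' w z)%E.
  by rewrite lee_fin mulr_ge0// divr_ge0// sqr_ge0.
have mP : measurable_fun setT
    (fun z : measurableTypeR R * measurableTypeR R => poisson e (z.1 + z.2)).
  apply: (@measurableT_comp _ _ _ _ _ _ (poisson e)); first exact: measurable_poisson.
  exact: measurable_funD.
have mh w : measurable_fun setT w -> measurable_fun setT (h w).
  move=> mw; apply/measurable_EFinP; apply: measurable_funM => //.
  apply: measurable_funM => //; apply: measurable_funX.
  exact: measurableT_comp.
have mh' w : measurable_fun setT w -> measurable_fun setT (h' w).
  move=> mw; apply/measurable_EFinP; apply: measurable_funM => //.
  apply: measurable_funM => //; apply: measurable_funX.
  exact: measurableT_comp.
have ih w : measurable_fun setT w ->
    (\int[leb]_x \int[leb]_y h w (x, y) = pi%:E * \int[leb]_x (w x ^+ 2)%:E)%E.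
  move=> mw; rewrite -ge0_integralZl//; last 3 first.
  - by apply/measurable_EFinP; exact: measurable_funX.
  - by move=> x _; rewrite lee_fin sqr_ge0.
  - by rewrite lee_fin pi_ge0.
  apply: eq_integral => x _; rewrite /h/=.
  transitivity ((w x ^+ 2 / 2)%:E * \int[leb]_y (poisson e (y + x))%:E)%E.
    rewrite -ge0_integralZl//.
    - by apply: eq_integral => y _; rewrite -EFinM addrC.
    - apply/measurable_EFinP.
      apply: (@measurableT_comp _ _ _ _ _ _ (poisson e)); first exact: measurable_poisson.
      exact: measurable_funD.
    - by move=> y _; rewrite lee_fin.
    - by rewrite lee_fin divr_ge0// sqr_ge0.
  rewrite integral_poisson_shift// -!EFinM; congr EFin; by field.
have ih' w : measurable_fun setT w ->
    (\int[leb]_x \int[leb]_y h' w (x, y) = pi%:E * \int[leb]_x (w x ^+ 2)%:E)%E.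
  move=> mw; transitivity (\int[leb]_y \int[leb]_x h' w (x, y))%E.
    exact: (fubini_tonelli (h' w) (mh' _ mw) (h'0 w)).
  rewrite -(ih _ mw).
  by apply: eq_integral => x _; apply: eq_integral => y _; rewrite /h /h'/= addrC.
have mF w : measurable_fun setT w ->
    measurable_fun setT (fun x => \int[leb]_y h w (x, y))%E.
  by move=> mw; exact: (measurable_fun_fubini_tonelli_F (h w) (mh _ mw) (h0 w)).
have mF' w : measurable_fun setT w ->
    measurable_fun setT (fun x => \int[leb]_y h' w (x, y))%E.
  by move=> mw; exact: (measurable_fun_fubini_tonelli_F (h' w) (mh' _ mw) (h'0 w)).
have mk : measurable_fun setT
    (fun z : measurableTypeR R * measurableTypeR R =>
     (u z.1 * (v z.2 * poisson e (z.1 + z.2)))%:E).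
  apply/measurable_EFinP; apply: measurable_funM; first exact: measurableT_comp.
  by apply: measurable_funM => //; exact: measurableT_comp.
have k0 z : (0 <= (u z.1 * (v z.2 * poisson e (z.1 + z.2)))%:E)%E.
  by rewrite lee_fin; apply: mulr_ge0 => //; exact: mulr_ge0.
rewrite ge0_muleDr; last 2 first.
- by apply: integral_ge0 => x _; rewrite lee_fin sqr_ge0.
- by apply: integral_ge0 => x _; rewrite lee_fin sqr_ge0.
rewrite -(ih _ mu) -(ih' _ mv).
rewrite -ge0_integralD//; last 4 first.
- by move=> x _; exact: integral_ge0.
- exact: mF.
- by move=> x _; exact: integral_ge0.
- exact: mF'.
apply: ge0_le_integral => //.
- by move=> x _; apply: integral_ge0 => y _; exact: (k0 (x, y)).
- exact: (measurable_fun_fubini_tonelli_F _ mk k0).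
- by apply: emeasurable_funD; [exact: mF|exact: mF'].
- move=> x _; rewrite -ge0_integralD//; last 2 first.
  + exact: (measurableT_comp (mh _ mu) (measurable_pair1 x)).
  + exact: (measurableT_comp (mh' _ mv) (measurable_pair1 x)).
  apply: ge0_le_integral => //.
  + by move=> y _; exact: (k0 (x, y)).
  + exact: (measurableT_comp mk (measurable_pair1 x)).
  + apply: emeasurable_funD.
      exact: (measurableT_comp (mh _ mu) (measurable_pair1 x)).
    exact: (measurableT_comp (mh' _ mv) (measurable_pair1 x)).
  + move=> y _; rewrite /h /h'/= -EFinD lee_fin -mulrDl mulrA ler_wpM2r//.
    by have := sqr_ge0 (u x - v y); rewrite sqrrB; lra.
Qed.

End poisson_integral.

(** * Boundedness of the Fourier transformation *)

Section square_integral.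
Context d (T : measurableType d) (R : realType).
Variable mu : {measure set T -> \bar R}.
Implicit Types f g : T -> R[i].

(** Extended-valued and defined on bare functions, so that bounds can be stated before membership in
    L^2 is known. *)
Definition sqint f : \bar R := (\int[mu]_x (normc (f x) ^+ 2)%:E)%E.

Lemma sqint_ge0 f : (0 <= sqint f)%E.
Proof. by apply: integral_ge0 => x _; rewrite lee_fin sqr_ge0. Qed.

Lemma measurable_normc_sqr f : cmeasurable f ->
  measurable_fun setT (fun x => (normc (f x) ^+ 2)%:E).
Proof.
by move=> mf; apply/measurable_EFinP; apply: measurable_funX; exact: cmeasurable_normc.
Qed.

Lemma cLnorm2E f : cLnorm mu 2%:E f = (sqint f `^ 2^-1)%E.
Proof.
rewrite /cLnorm unlock; congr (_ `^ _)%E; apply: eq_integral => x _.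
by rewrite /= ger0_norm ?normc_ge0// powR_mulrn ?normc_ge0.
Qed.

Lemma cLfun2P f :
  cLfun mu 2%:E f <-> cmeasurable f /\ (sqint f < +oo)%E.
Proof.
rewrite /cLfun/= cLnorm2E; split=> -[mf lf]; split => //; last exact: poweR_lty.
have := sqint_ge0 f; move: lf; case: (sqint f) => [r _ _|h _|//]; first by rewrite ltry.
by move: h; rewrite poweRyr// invr_neq0.
Qed.

Lemma ae_eq_sqint f g : cmeasurable f -> cmeasurable g ->
  (\forall x \ae mu, f x = g x) -> sqint f = sqint g.
Proof.
move=> mf mg fg; apply: ae_eq_integral => //; try exact: measurable_normc_sqr.
by apply: filterS fg => x ->.
Qed.

End square_integral.

Section L2_function_norm.
Context d (T : measurableType d) (R : realType).
Variable mu : {measure set T -> \bar R}.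
Local Notation L := (Lspc mu (lee1n 2)).

(** The norm of a normed module over [R[i]] has values in [R[i]]; this real version gives access to
    the order and the limits of [R]. *)
Definition rnorm (f : L) : R := fine (cLnorm mu 2%:E f).

Lemma normE_rnorm (f : L) : `|f| = (rnorm f)%:C. Proof. by []. Qed.

Lemma rnorm_ge0 (f : L) : 0 <= rnorm f.
Proof. by apply: fine_ge0; exact: cLnorm_ge0. Qed.

Lemma Lspc_cmeasurable (f : L) : cmeasurable f.
Proof. by have [] := Lspc_funP f. Qed.

Lemma rnorm_sqr (f : L) : (rnorm f ^+ 2)%:E = sqint mu f.
Proof.
have := Lspc_funP f => /cLfun2P[_ lf].
rewrite /rnorm cLnorm2E fine_poweR powR12_sqrt ?fine_ge0 ?sqint_ge0//.
by rewrite sqr_sqrtr ?fine_ge0 ?sqint_ge0// fineK// ge0_fin_numE// sqint_ge0.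
Qed.

Lemma rnorm_le (f : L) (M : R) : 0 <= M ->
  (sqint mu f <= (M ^+ 2)%:E)%E -> rnorm f <= M.
Proof.
by move=> M0; rewrite -rnorm_sqr lee_fin ler_pXn2r ?nnegrE ?rnorm_ge0.
Qed.

Lemma rnormD (f g : L) : rnorm (f + g) <= rnorm f + rnorm g.
Proof. by have := ler_normD f g; rewrite !normE_rnorm -rmorphD lecR. Qed.

Lemma rnormZ (a : R[i]) (f : L) : rnorm (a *: f) = normc a * rnorm f.
Proof.
have := normrZ a f; rewrite !normE_rnorm => h; apply: (@complexI R).
by rewrite rmorphM -h.
Qed.

Lemma rnormN (f : L) : rnorm (- f) = rnorm f.
Proof. by rewrite -scaleN1r rnormZ normcN normc1 mul1r. Qed.

Lemma rnorm_eq0 (f : L) : rnorm f = 0 -> f = 0.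
Proof. by move=> f0; apply: normr0_eq0; rewrite normE_rnorm f0. Qed.

Lemma cvg_rnormP (u : nat -> L) (l : L) :
  u @ \oo --> l <-> rnorm (l - u n) @[n --> \oo] --> 0.
Proof.
split => [/cvgrPdist_lt ul|ul].
  apply/cvgr0Pnorm_lt => e e0; have := ul e%:C.
  rewrite ltcR => /(_ e0); apply: filterS => n.
  by rewrite normE_rnorm ltcR ger0_norm ?rnorm_ge0.
(* A positive radius in [R[i]] has zero imaginary part, so real radii suffice. *)
apply/cvgrPdist_lt => -[e i].
rewrite ltcE/= => /andP[/eqP -> e0].
have /cvgr0Pnorm_lt /(_ e e0) := ul; apply: filterS => n.
by rewrite normE_rnorm ger0_norm ?rnorm_ge0// => h; rewrite -[_ +i* _]/(e%:C) ltcR.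
Qed.

End L2_function_norm.

Section cL1_L2.
Variable R : realType.
Local Notation leb := (@lebesgue_measure R).
Implicit Types f g : measurableTypeR R -> R[i].

Lemma cL1_sqr f : cLfun leb 2%:E f -> leb.-integrable setT
  (EFin \o (fun x => normc (f x) ^+ 2)).
Proof.
move=> /cLfun2P[mf lf]; apply/integrableP; split; first exact: measurable_normc_sqr.
by under eq_integral do rewrite /= ger0_norm ?sqr_ge0//.
Qed.

Lemma cL1M f g : cLfun leb 2%:E f -> cLfun leb 2%:E g -> cL1 (fun x => f x * g x).
Proof.
move=> Lf Lg.
apply: (@le_cL1 R _ (fun x => normc (f x) ^+ 2 + normc (g x) ^+ 2)).
- by apply: cmeasurableM; [case: Lf|case: Lg].
- move=> x; rewrite normcM; have := sqr_ge0 (normc (f x) - normc (g x)).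
  have := sqr_ge0 (normc (f x)); have := sqr_ge0 (normc (g x)).
  rewrite sqrrB; lra.
- exact: (integrableD measurableT (cL1_sqr Lf) (cL1_sqr Lg)).
Qed.

Lemma cauchy_schwarz (f g : L2 R) :
  (\int[leb]_x (normc (f x * g x))%:E <= (rnorm f * rnorm g)%:E)%E.
Proof.
have mf := cmeasurable_normc (Lspc_cmeasurable f).
have mg := cmeasurable_normc (Lspc_cmeasurable g).
have := @hoelder _ _ _ leb _ _ 2 2 mf mg.
rewrite !ltr0n => /(_ isT isT) h.
have -> : ((rnorm f * rnorm g)%:E = cLnorm leb 2%:E f * cLnorm leb 2%:E g)%E.
  rewrite EFinM /rnorm !fineK// ge0_fin_numE ?cLnorm_ge0//.
    by have [] := Lspc_funP g.
  by have [] := Lspc_funP f.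
apply: le_trans (h _); last by field.
rewrite Lnorm1; apply: ge0_le_integral => //.
- by move=> x _; rewrite lee_fin normc_ge0.
- apply: cmeasurable_normcE; apply: cmeasurableM; exact: Lspc_cmeasurable.
- apply: measurableT_comp => //; apply/measurable_EFinP; exact: measurable_funM.
- by move=> x _ /=; rewrite normcM lee_fin ger0_norm// mulr_ge0 ?normc_ge0.
Qed.

End cL1_L2.

Section fourier_L2_bound.
Variable R : realType.
Local Notation leb := (@lebesgue_measure R).
Implicit Types f g : measurableTypeR R -> R[i].

Lemma cintegral_conj f : cL1 f -> cintegral (fun x => (f x)^*) = (cintegral f)^*.
Proof.
move=> Lf; apply: eq_ReIm; rewrite /=.
  by apply: eq_Rintegral => x _; case: (f x).
have -> : \int[leb]_x complex.Im ((f x)^*) = \int[leb]_x (-1 * complex.Im (f x)).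
  by apply: eq_Rintegral => x _; case: (f x) => a b /=; rewrite mulN1r.
by rewrite RintegralZl ?mulN1r//; exact: cL1_Im.
Qed.

Lemma cL1_opp f : cL1 f -> cL1 (fun x => f (- x)).
Proof.
move=> [mf lf]; split.
  by apply: cmeasurable_comp => //; have [] := measure_preserving_opp R.
by rewrite (integral_measure_preserving (measure_preserving_opp R)
  (f := fun x => (normc (f x))%:E))//; exact: cmeasurable_normcE.
Qed.

Lemma fourier_integral_opp f : cL1 f ->
  fourier_integral (fun x => f (- x)) = (fun xi => fourier_integral f (- xi)).
Proof.
move=> Lf; apply/funext => xi.
rewrite -[LHS](cintegral_measure_preserving (measure_preserving_opp R)); last first.
  by have [] := cL1_expi xi (cL1_opp Lf).
by apply: eq_cintegral => x; rewrite opprK mulrN mulNr.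
Qed.

Lemma fourier_integral_conj_opp f : cL1 f ->
  fourier_integral (fun x => (f (- x))^*) = (fun xi => (fourier_integral f xi)^*).
Proof.
move=> Lf; rewrite (fourier_integral_opp (cL1_conj Lf)); apply/funext => xi.
rewrite -cintegral_conj; last exact: cL1_expi.
by apply: eq_cintegral => x; rewrite conjcM mulNr expiN.
Qed.

Lemma fourier_integral_modulation f a xi :
  fourier_integral (fun x => expi (a * x) * f x) xi = fourier_integral f (xi + a).
Proof. by apply: eq_cintegral => x; rewrite mulrA -expiD mulrDl. Qed.

(* Both sides are $\int f \cdot F (w \cdot F g)$, by the multiplication formula. *)
Lemma fourier_abel_mean f g e : 0 < e -> cL1 f -> cL1 g ->
  cintegral (fun xi => (abel_weight e xi)%:C *
    (fourier_integral f xi * fourier_integral g xi)) =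
  cintegral (fun x => f x * cintegral (fun y => g y * (poisson e (x + y))%:C)).
Proof.
move=> e0 Lf Lg; have Lw := cL1_abel_weight e0.
rewrite (_ : (fun x => f x * _) = (fun x => f x * fourier_integral
    (fun xi => (abel_weight e xi)%:C * fourier_integral g xi) x)); last first.
  apply/funext => x; congr (_ * _).
  transitivity (cintegral (fun y => g y *
      fourier_integral (fun xi => expi (x * xi) * (abel_weight e xi)%:C) y)).
    apply: eq_cintegral => y; rewrite fourier_integral_modulation.
    by rewrite fourier_integral_abel_weight// addrC.
  rewrite multiplication_formula//; last exact: cL1_expi.
  by apply: eq_cintegral => y; rewrite -!mulrA.
rewrite multiplication_formula//; last exact: cL1_Mfourier_integral.
by apply: eq_cintegral => x; ring.
Qed.

(** The mean is itself the Fourier integral of an L^1 function, namely the damped transform of [g],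
    and its measurability comes from there. *)
Lemma cmeasurable_poisson_mean g e : 0 < e -> cL1 g ->
  cmeasurable ((fun x => cintegral (fun y => g y * (poisson e (x + y))%:C))
    : measurableTypeR R -> R[i]).
Proof.
move=> e0 Lg; have Lw := cL1_abel_weight e0.
rewrite (_ : (fun x => _) = fourier_integral
    (fun xi => (abel_weight e xi)%:C * fourier_integral g xi)); last first.
  apply/funext => x.
  transitivity (cintegral (fun y => g y *
      fourier_integral (fun xi => expi (x * xi) * (abel_weight e xi)%:C) y)).
    apply: eq_cintegral => y; rewrite fourier_integral_modulation.
    by rewrite fourier_integral_abel_weight// addrC.
  rewrite multiplication_formula//; last exact: cL1_expi.
  by apply: eq_cintegral => y; rewrite -!mulrA.
by apply: cmeasurable_fourier_integral; exact: cL1_Mfourier_integral.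
Qed.

(** The constant is 2 * 2 * pi: each of the two nested complex integrals costs a factor 2, and
    [schur_poisson] contributes pi. *)
Lemma abel_mean_le f g e : 0 < e -> cL1 f -> cL1 g ->
  ((normc (cintegral (fun xi => (abel_weight e xi)%:C *
    (fourier_integral f xi * fourier_integral g xi))))%:E <=
   (4 * pi)%:E * (sqint leb f + sqint leb g))%E.
Proof.
move=> e0 Lf Lg; rewrite fourier_abel_mean//.
have [mf _] := Lf; have [mg _] := Lg.
have mG := cmeasurable_poisson_mean e0 Lg.
have P0 t : 0 <= poisson e t by apply: poisson_ge0; exact: ltW.
have mP (x : R) : measurable_fun [set: measurableTypeR R] (fun y => poisson e (x + y)).
  apply: (@measurableT_comp _ _ _ _ _ _ (poisson e)); first exact: measurable_poisson.
  exact: measurable_funD.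
apply: (le_trans (normc_cintegral_le (cmeasurableM mf mG))).
rewrite (_ : (4 * pi)%:E = (4%:E * pi%:E)%E) ?EFinM// -muleA.
have sch := schur_poisson e0 (cmeasurable_normc mf) (cmeasurable_normc mg)
  (fun x => normc_ge0 (f x)) (fun x => normc_ge0 (g x)).
have mk : measurable_fun setT
    (fun z : measurableTypeR R * measurableTypeR R =>
     (normc (f z.1) * (normc (g z.2) * poisson e (z.1 + z.2)))%:E).
  apply/measurable_EFinP; apply: measurable_funM.
    by apply: cmeasurable_normc; exact: cmeasurable_comp.
  apply: measurable_funM.
    by apply: cmeasurable_normc; exact: cmeasurable_comp.
  apply: (@measurableT_comp _ _ _ _ _ _ (poisson e)); first exact: measurable_poisson.
  exact: measurable_funD.
have k0 z : (0 <= (normc (f z.1) * (normc (g z.2) * poisson e (z.1 + z.2)))%:E)%E.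
  rewrite lee_fin; apply: mulr_ge0; first exact: normc_ge0.
  by apply: mulr_ge0 => //; exact: normc_ge0.
have mF := measurable_fun_fubini_tonelli_F (m2 := leb) _ mk k0.
apply: (@le_trans _ _ (2%:E * (2%:E * \int[leb]_x \int[leb]_y
    (normc (f x) * (normc (g y) * poisson e (x + y)))%:E))%E); last first.
  have -> : 4%:E = (2%:E * 2%:E)%E :> \bar R by rewrite -EFinM -natrM.
  by rewrite -muleA !lee_pmul2l.
rewrite lee_pmul2l// -ge0_integralZl//; last first.
  by move=> x _; apply: integral_ge0 => y _; exact: (k0 (x, y)).
apply: ge0_le_integral => //.
- by move=> x _; rewrite lee_fin normc_ge0.
- by apply: cmeasurable_normcE; exact: cmeasurableM.
- exact: measurable_funeM.
- move=> x _; rewrite normcM EFinM.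
  have -> : (\int[leb]_y (normc (f x) * (normc (g y) * poisson e (x + y)))%:E =
      (normc (f x))%:E * \int[leb]_y (normc (g y * (poisson e (x + y))%:C))%:E)%E.
    rewrite -ge0_integralZl//.
    - apply: eq_integral => y _; rewrite normcM normc_real ger0_norm//.
    - apply: cmeasurable_normcE; apply: cmeasurableM => //; exact: cmeasurable_real.
    - by move=> y _; rewrite lee_fin normc_ge0.
    - by rewrite lee_fin normc_ge0.
  rewrite muleCA; apply: lee_wpmul2l; first by rewrite lee_fin normc_ge0.
  apply: normc_cintegral_le; apply: cmeasurableM => //; exact: cmeasurable_real.
Qed.

Lemma sqint_conj_opp f : cmeasurable f ->
  sqint leb (fun x => (f (- x))^*) = sqint leb f.
Proof.
move=> mf; rewrite /sqint; under eq_integral do rewrite normc_conj.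
apply: (integral_measure_preserving (measure_preserving_opp R)
  (f := fun x => (normc (f x) ^+ 2)%:E)).
exact: measurable_normc_sqr.
Qed.

(** With g(x) the conjugate of f(-x), F g is the conjugate of F f, so the damped product in
    [abel_mean_le] becomes the weight times |F f|^2. The square integrals of f and g coincide, which
    doubles 4 pi. *)
Lemma abel_mean_fourier_sqr f e : 0 < e -> cL1 f ->
  (\int[leb]_xi (abel_weight e xi * normc (fourier_integral f xi) ^+ 2)%:E <=
   (8 * pi)%:E * sqint leb f)%E.
Proof.
move=> e0 Lf; have Lg : cL1 (fun x => (f (- x))^*) by apply/cL1_conj/cL1_opp.
have := abel_mean_le e0 Lf Lg.
have [mf _] := Lf; rewrite fourier_integral_conj_opp// sqint_conj_opp//.
have -> : ((4 * pi)%:E * (sqint leb f + sqint leb f) = (8 * pi)%:E * sqint leb f)%E.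
  rewrite (_ : 8 * pi = 4 * pi + 4 * pi :> R); last by ring.
  rewrite ge0_muleDr ?sqint_ge0// EFinD ge0_muleDl// lee_fin mulr_ge0// pi_ge0//.
apply: le_trans.
set h : measurableTypeR R -> R[i] := fun xi => (abel_weight e xi)%:C *
    (fourier_integral f xi * (fourier_integral f xi)^*).
have Lh : cL1 h.
  rewrite (_ : h = (fun xi => (fourier_integral f xi)^* *
     ((abel_weight e xi)%:C * fourier_integral f xi))); last first.
    by apply/funext => x; rewrite /h mulrA mulrC.
  apply: (@cL1_Mbnd R _ _ (2 * L1norm f)).
  - exact/cmeasurable_conj/cmeasurable_fourier_integral.
  - by move=> x; rewrite normc_conj; exact: fourier_integral_bounded.
  - by apply: cL1_Mfourier_integral => //; exact: cL1_abel_weight.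
(* [h] takes nonnegative real values, so the left-hand side is the real part of its complex
   integral. *)
apply: (@le_trans _ _ (complex.Re (cintegral h))%:E); last first.
  by rewrite lee_fin (le_trans (ler_norm _))// normr_Re_le.
rewrite -[complex.Re (cintegral h)]/(\int[leb]_x complex.Re (h x)).
rewrite /Rintegral fineK; last first.
  exact: (integrable_fin_num measurableT (cL1_Re Lh)).
rewrite le_eqVlt; apply/orP; left; apply/eqP; apply: eq_integral => x _.
by rewrite /h mulc_conj -rmorphM.
Qed.

Lemma harmonic_abel_cvg (x : R) :
  abel_weight (n.+1%:R^-1) x @[n --> \oo] --> (1 : R).
Proof.
have h : - (n.+1%:R^-1 * `|x|) @[n --> \oo] --> (0 : R).
  rewrite -oppr0; apply: cvgN; rewrite -(mul0r `|x|); apply: cvgMl.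
  exact: cvg_harmonic.
rewrite /abel_weight -[X in _ --> X](@expR0 R).
apply: (@cvg_comp _ _ _ (fun n : nat => - (n.+1%:R^-1 * `|x|)) expR \oo (nbhs 0) _ h).
exact: continuous_expR.
Qed.

Lemma limn_einf_le_cst (u : nat -> \bar R) (c : \bar R) :
  (forall n, (u n <= c)%E) -> (limn_einf u <= c)%E.
Proof.
move=> uc; rewrite limn_einf_lim; apply: lime_le; first exact: is_cvg_einfs.
apply: nearW => n; apply: le_trans (uc n); apply: ereal_inf_lbound.
by exists n => //=.
Qed.

(** The preceding bound is uniform in the damping, which tends to 0 along 1/(n+1); Fatou's lemma
    carries the bound to the limit. *)
Lemma sqint_fourier_le f : cL1 f ->
  (sqint leb (fourier_integral f : measurableTypeR R -> R[i]) <=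
   (8 * pi)%:E * sqint leb f)%E.
Proof.
move=> Lf; have mF := cmeasurable_fourier_integral Lf.
pose h n (x : measurableTypeR R) :=
  (abel_weight (n.+1%:R^-1) x * normc (fourier_integral f x) ^+ 2)%:E.
have mh n : measurable_fun setT (h n).
  apply/measurable_EFinP; apply: measurable_funM; first exact: measurable_abel_weight.
  by apply: measurable_funX; exact: cmeasurable_normc.
have h0 n x : (0 <= h n x)%E.
  by rewrite lee_fin mulr_ge0 ?sqr_ge0 ?(ltW (abel_weight_gt0 _ _)).
have := @fatou _ _ _ leb _ measurableT h mh (fun n x _ => h0 n x).
have -> : (\int[leb]_x limn_einf (h ^~ x) = sqint leb (fourier_integral f : measurableTypeR R -> R[i]))%E.
  apply: eq_integral => x _.
  have hx : h n x @[n --> \oo] --> (normc (fourier_integral f x) ^+ 2)%:E.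
    apply: cvg_EFin; first by apply: nearW.
    rewrite -[X in _ --> X]mul1r; apply: cvgMl; exact: harmonic_abel_cvg.
  by rewrite (cvg_limn_einf_sup hx).1.
move=> /le_trans; apply.
by apply: limn_einf_le_cst => n; exact: abel_mean_fourier_sqr.
Qed.

End fourier_L2_bound.

(** * Fourier inversion tested on intervals *)

Section fourier_interval.
Variable R : realType.
Local Notation leb := (@lebesgue_measure R).
Implicit Types f g : measurableTypeR R -> R[i].

Lemma cvg_dist_squeeze (u w : nat -> R) (v : R) : (forall n, `|u n - v| <= w n) ->
  w n @[n --> \oo] --> 0 -> u n @[n --> \oo] --> v.
Proof.
move=> uw w0; apply/cvgrPdist_le => e e0.
have /cvgr0_norm_le /(_ e e0) := w0; apply: filterS => n we.
by rewrite distrC (le_trans (uw n))// (le_trans (ler_norm _)).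
Qed.

Lemma eq_cvg_lim (u v : nat -> R) (l l' : R) : u =1 v ->
  v n @[n --> \oo] --> l' -> l' = l -> u n @[n --> \oo] --> l.
Proof. by move=> uv vl <-; rewrite (funext uv). Qed.

Lemma Rintegral_cvg (h : nat -> measurableTypeR R -> R) (l k : measurableTypeR R -> R) :
  (forall n, measurable_fun setT (h n)) -> measurable_fun setT l ->
  (forall x, h n x @[n --> \oo] --> l x) ->
  (forall n x, `|h n x| <= k x) -> leb.-integrable setT (EFin \o k) ->
  \int[leb]_x h n x @[n --> \oo] --> \int[leb]_x l x.
Proof.
move=> mh ml hl hk ik.
have [] := @dominated_convergence _ _ _ leb _ measurableT
  (fun n => EFin \o h n) (EFin \o l) (EFin \o k) _ _ _ ik _.
- by move=> n; exact/measurable_EFinP.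
- exact/measurable_EFinP.
- apply: nearW => x _; apply: cvg_EFin; first exact: nearW.
  exact: hl.
- by apply: nearW => x n _; rewrite lee_fin.
move=> il _ cl; apply: fine_cvg; rewrite fineK//.
exact: (integrable_fin_num measurableT il).
Qed.

Lemma cintegral_cvg (h : nat -> measurableTypeR R -> R[i])
    (l : measurableTypeR R -> R[i]) (k : measurableTypeR R -> R) :
  (forall n, cmeasurable (h n)) -> cmeasurable l ->
  (forall x, normc (h n x - l x) @[n --> \oo] --> 0) ->
  (forall n x, normc (h n x) <= k x) -> leb.-integrable setT (EFin \o k) ->
  (complex.Re (cintegral (h n)) @[n --> \oo] --> complex.Re (cintegral l)) /\
  (complex.Im (cintegral (h n)) @[n --> \oo] --> complex.Im (cintegral l)).
Proof.
move=> mh ml hl hk ik.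
split.
  apply: (@Rintegral_cvg (fun n x => complex.Re (h n x)) (fun x => complex.Re (l x)) k) => //.
  - by move=> n; have [] := mh n.
  - by case: ml.
  - by move=> x; apply: cvg_dist_squeeze (hl x) => n; rewrite -raddfB normr_Re_le.
  - by move=> n x; rewrite (le_trans (normr_Re_le _)).
apply: (@Rintegral_cvg (fun n x => complex.Im (h n x)) (fun x => complex.Im (l x)) k) => //.
- by move=> n; have [] := mh n.
- by case: ml.
- by move=> x; apply: cvg_dist_squeeze (hl x) => n; rewrite -raddfB normr_Im_le.
- by move=> n x; rewrite (le_trans (normr_Im_le _)).
Qed.

Lemma atan_sg_cvg (t : R) :
  atan (n.+1%:R * t) @[n --> \oo] --> Num.sg t * (pi / 2).
Proof.
have pos (s : R) : 0 < s -> atan (n.+1%:R * s) @[n --> \oo] --> pi / 2.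
  move=> s0.
  have h : (n.+1%:R : R) * s @[n --> \oo] --> +oo.
    have h1 : (n.+1%:R : R) @[n --> \oo] --> +oo.
      apply/cvgryPge => A; have /cvgryPge /(_ A) := @cvgr_idn R.
      by apply: filterS => n /le_trans; apply; rewrite ler_nat.
    exact: (cvg_comp _ _ h1 (gt0_cvgMly s0 cvg_id)).
  exact: (cvg_comp _ _ h (@cvgy_atan R)).
have [t0|t0|->] := ltgtP t 0.
- rewrite ltr0_sg// mulN1r.
  apply: (@eq_cvg_lim _ (fun n => - atan (n.+1%:R * - t)) _ (- (pi / 2))) => //.
    by move=> n; rewrite mulrN atanN opprK.
  by apply: cvgN; apply: pos; rewrite oppr_gt0.
- by rewrite gtr0_sg// mul1r; exact: pos.
- rewrite sgr0 mul0r; under eq_cvg do rewrite mulr0 atan0.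
  exact: cvg_cst.
Qed.

Definition itv_indic (a b : R) (x : measurableTypeR R) : R[i] :=
  (\1_(`[a, b]%classic : set R) x : R)%:C.

Lemma normc_itv_indic a b x : normc (itv_indic a b x) = \1_(`[a, b]%classic) x.
Proof. by rewrite normc_real ger0_norm. Qed.

Lemma cmeasurable_itv_indic a b : cmeasurable (itv_indic a b).
Proof. by apply: cmeasurable_real; apply: measurable_indic; exact: measurable_itv. Qed.

Lemma cL1_itv_indic a b : cL1 (itv_indic a b).
Proof.
split; first exact: cmeasurable_itv_indic.
under eq_integral do rewrite normc_itv_indic.
rewrite integral_indic//= ?setIT.
by rewrite lebesgue_measure_itv/=; case: ifPn => _; rewrite ?ltry// -EFinB ltry.
Qed.

Lemma cLfun_itv_indic a b : cLfun leb 2%:E (itv_indic a b).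
Proof.
apply/cLfun2P; split; first exact: cmeasurable_itv_indic.
apply: le_lt_trans (cL1_itv_indic a b).2; apply: ge0_le_integral => //.
- by move=> x _; rewrite lee_fin sqr_ge0.
- exact/measurable_normc_sqr/cmeasurable_itv_indic.
- exact/cmeasurable_normcE/cmeasurable_itv_indic.
- move=> x _; rewrite lee_fin normc_itv_indic indicE.
  by case: (_ \in _); rewrite ?expr1n ?expr0n.
Qed.

Lemma cLfun_fourier_integral f : cL1 f -> cLfun leb 2%:E f ->
  cLfun leb 2%:E (fourier_integral f : measurableTypeR R -> R[i]).
Proof.
move=> Lf /cLfun2P[mf lf]; apply/cLfun2P; split.
  exact: cmeasurable_fourier_integral.
apply: le_lt_trans (sqint_fourier_le Lf) _.
by rewrite lte_mul_pinfty// lee_fin mulr_ge0// pi_ge0.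
Qed.

Lemma poisson_mean_itv (e a b x : R) : 0 < e -> a < b ->
  cintegral (fun y => itv_indic a b y * (poisson e (x + y))%:C) =
  (2 * atan (e^-1 * (x + b)) - 2 * atan (e^-1 * (x + a)))%:C.
Proof.
move=> e0 ab; apply: eq_ReIm; rewrite /=.
  have /(congr1 fine) /= <- := integral_poisson_itv x e0 ab.
  rewrite integral_mkcond; congr fine; apply: eq_integral => y _.
  rewrite /= patchE indicE; case: ifPn => _; first by rewrite mul0r subr0 mul1r.
  by rewrite !mul0r subr0.
rewrite /Rintegral (eq_integral (fun=> 0%E)) ?integral0// => y _.
by rewrite mulr0 mul0r addr0.
Qed.

(* The Poisson means of the indicator function of $[a, b]$ converge boundedly
   to it, so that dominated convergence is enough: no density argument and no
   Fourier inversion are needed. *)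
Lemma fourier_itv_indic f (a b : R) : a < b -> cL1 f -> cLfun leb 2%:E f ->
  cintegral (fun xi => fourier_integral f xi * fourier_integral (itv_indic a b) xi) =
  (2 * pi)%:C * cintegral (fun x => f x * itv_indic a b (- x)).
Proof.
move=> ab L1f L2f; have L1g := cL1_itv_indic a b; have L2g := cLfun_itv_indic a b.
have [mf _] := L1f.
have L1FF := cL1M (cLfun_fourier_integral L1f L2f) (cLfun_fourier_integral L1g L2g).
set g := itv_indic a b.
pose w n x : R := abel_weight (n.+1%:R^-1) x.
pose A n := cintegral (fun xi => (w n xi)%:C *
    (fourier_integral f xi * fourier_integral g xi)).
(* The limit of the Poisson means: 2 pi inside (-b, -a), 0 outside [-b, -a], and pi at the two
   endpoints. *)
pose l (x : measurableTypeR R) := pi * (Num.sg (x + b) - Num.sg (x + a)).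
pose G n x : R := 2 * atan (n.+1%:R * (x + b)) - 2 * atan (n.+1%:R * (x + a)).
have AE n : A n = cintegral (fun x => f x * (G n x)%:C).
  rewrite /A fourier_abel_mean//; apply: eq_cintegral => x.
  by rewrite poisson_mean_itv// invrK.
have [ARe AIm] : (complex.Re (A n) @[n --> \oo] --> complex.Re (cintegral
    (fun xi => fourier_integral f xi * fourier_integral g xi))) /\
   (complex.Im (A n) @[n --> \oo] --> complex.Im (cintegral
    (fun xi => fourier_integral f xi * fourier_integral g xi))).
  apply: (cintegral_cvg _ _ _ _ (cL1_integrable L1FF)).
  - move=> n; apply: cmeasurableM; last by case: L1FF.
    by apply: cmeasurable_real; exact: measurable_abel_weight.
  - by case: L1FF.
  - move=> x; set C := normc (fourier_integral f x * fourier_integral g x).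
    apply: (@eq_cvg_lim _ (fun n => `|w n x - 1| * C) _ (`|1 - 1| * C)).
    + move=> n; rewrite -[X in _ - X]mul1r -mulrBl normcM.
      by rewrite -(rmorph1 (real_complex R)) -rmorphB normc_real.
    + apply: cvgMl; apply: cvg_norm; apply: cvgB; last exact: cvg_cst.
      exact: harmonic_abel_cvg.
    + by rewrite subrr normr0 mul0r.
  - move=> n x; rewrite normcM normc_real ger0_norm ?(ltW (abel_weight_gt0 _ _))//.
    by rewrite ler_piMl ?normc_ge0// abel_weight_le1.
have mG n : measurable_fun [set: measurableTypeR R] (G n).
  have m1 (c : R) : measurable_fun [set: measurableTypeR R]
      (fun x => 2 * atan (n.+1%:R * (x + c))).
    apply: measurable_funM => //.
    apply: (@measurableT_comp _ _ _ _ _ _ (@atan R)).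
      by apply: continuous_measurable_fun; exact: continuous_atan.
    by apply: measurable_funM => //; exact: measurable_funD.
  by apply: measurable_funB; exact: m1.
have Gl x : G n x @[n --> \oo] --> l x.
  rewrite (_ : l x = 2 * (Num.sg (x + b) * (pi / 2)) - 2 * (Num.sg (x + a) * (pi / 2))); last first.
    by rewrite /l; field.
  by apply: cvgB; apply: cvgMr; exact: atan_sg_cvg.
have ml : measurable_fun setT l.
  by apply: (@measurable_fun_cvg _ _ _ _ G) => // x _; exact: Gl.
have [BRe BIm] : (complex.Re (A n) @[n --> \oo] --> complex.Re (cintegral
    (fun x => f x * (l x)%:C))) /\
   (complex.Im (A n) @[n --> \oo] --> complex.Im (cintegral
    (fun x => f x * (l x)%:C))).
  under eq_cvg do rewrite AE.
  under [in X in _ /\ X]eq_cvg do rewrite AE.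
  (* An arctangent lies between -pi/2 and pi/2, so |G n x| stays below 2 pi. *)
  apply: (cintegral_cvg (k := fun x => 2 * pi * normc (f x))).
  - by move=> n; apply: cmeasurableM => //; exact: cmeasurable_real.
  - by apply: cmeasurableM => //; exact: cmeasurable_real.
  - move=> x.
    apply: (@eq_cvg_lim _ (fun n => normc (f x) * `|G n x - l x|) _
      (normc (f x) * `|l x - l x|)); last by rewrite subrr normr0 mulr0.
      by move=> n; rewrite -mulrBr normcM -rmorphB normc_real.
    by apply: cvgMr; apply: cvg_norm; apply: cvgB; [exact: Gl|exact: cvg_cst].
  - move=> n x; rewrite normcM mulrC normc_real ler_wpM2r ?normc_ge0//.
    have := @atan_ltpi2 R (n.+1%:R * (x + b)); have := @atan_gtNpi2 R (n.+1%:R * (x + b)).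
    have := @atan_ltpi2 R (n.+1%:R * (x + a)); have := @atan_gtNpi2 R (n.+1%:R * (x + a)).
    by rewrite ler_norml /G => *; apply/andP; split; lra.
  - exact: (integrableZl measurableT (2 * pi) (cL1_integrable L1f)).
have -> : cintegral (fun xi => fourier_integral f xi * fourier_integral g xi) =
    cintegral (fun x => f x * (l x)%:C).
  apply: eq_ReIm.
    exact: (cvg_unique _ ARe BRe).
  exact: (cvg_unique _ AIm BIm).
have Lfg : cL1 (fun x => f x * g (- x)).
  rewrite (_ : (fun x => _) = (fun x => g (- x) * f x)); last first.
    by apply/funext => x; rewrite mulrC.
  apply: (@cL1_Mbnd R _ _ 1) => //; first by case: (cL1_opp L1g).
  by move=> x; rewrite normc_itv_indic indicE lern1; case: (_ \in _).
rewrite -cintegralZ//; apply: ae_eq_cintegral.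
- by apply: cmeasurableM => //; exact: cmeasurable_real.
- by apply: cmeasurableM; [exact: cmeasurable_cst|case: Lfg].
(* The endpoints are discarded: there [l] takes the value pi, half of what the indicator demands. *)
have Nab : leb.-negligible [set - a; - b].
  by apply: negligibleU; [exists [set - a]|exists [set - b]]; split => //;
    exact: lebesgue_measure_set1.
apply: negligibleS Nab => x /= h; apply: contrapT => /not_orP[/eqP xa /eqP xb]; apply: h.
rewrite mulrCA; congr (_ * _).
rewrite /g /itv_indic -rmorphM; congr (_%:C).
have xa' : x + a != 0 by rewrite addr_eq0.
have xb' : x + b != 0 by rewrite addr_eq0.
rewrite /l indicE; case: (boolP (_ \in _)) => /=.
  rewrite inE/= in_itv/= => /andP[h1 h2].
  have h1' : x + a < 0 by rewrite lt_neqAle xa'; lra.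
  have h2' : 0 < x + b by rewrite lt_neqAle eq_sym xb'; lra.
  by rewrite (ltr0_sg h1') (gtr0_sg h2'); ring.
rewrite notin_setE/= in_itv/= => /negP; rewrite negb_and -!ltNge => /orP[h1|h1].
  have h1' : 0 < x + a by lra.
  have h2' : 0 < x + b by lra.
  by rewrite (gtr0_sg h1') (gtr0_sg h2'); ring.
have h1' : x + a < 0 by lra.
have h2' : x + b < 0 by lra.
by rewrite (ltr0_sg h1') (ltr0_sg h2'); ring.
Qed.

End fourier_interval.

(** * Completeness and density in L^2 *)

Section L2_complete.
Context d (T : measurableType d) (R : realType).
Variable mu : {measure set T -> \bar R}.
Local Notation L := (Lspc mu (lee1n 2)).

Lemma LspcBE (f g : L) : \forall x \ae mu, (f - g : L) x = f x - g x.
Proof.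
rewrite -scaleN1r; have h1 := LspcDE f (-1 *: g); have h2 := LspcZE (-1) g.
by apply: filterS2 h1 h2 => x -> ->; rewrite mulN1r.
Qed.

Lemma cmeasurableB (f g : T -> R[i]) : cmeasurable f -> cmeasurable g ->
  cmeasurable (fun x => f x - g x).
Proof.
move=> mf mg.
rewrite (_ : (fun x => _) = (fun x => f x + -1 * g x)).
  by apply: cmeasurableD => //; apply: cmeasurableM => //; exact: cmeasurable_cst.
by apply/funext => x; rewrite mulN1r.
Qed.

Lemma sqint_sub (f g : L) :
  sqint mu (fun x => f x - g x) = (rnorm (f - g) ^+ 2)%:E.
Proof.
rewrite rnorm_sqr; apply: ae_eq_sqint.
- by apply: cmeasurableB; exact: Lspc_cmeasurable.
- exact: Lspc_cmeasurable.
- by apply: filterS (LspcBE f g) => x ->.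
Qed.

Lemma geometric_increments_cvg (a : nat -> R) (C : R) : 0 <= C ->
  (forall k, `|a k.+1 - a k| <= C / 2 ^+ k) -> cvgn a.
Proof.
move=> C0 ha.
have : cvgn (series (telescope a)).
  apply: normed_cvg.
  apply: (@series_le_cvg _ _ (geometric C (2^-1))) => [n|n|n|].
  - exact: normr_ge0.
  - by rewrite mulr_ge0// exprn_ge0.
  - by rewrite /geometric /= exprVn; exact: ha.
  - by apply: is_cvg_geometric_series; rewrite ger0_norm// invf_lt1// ltr1n.
move=> h; rewrite (_ : a = (fun n => a 0%N + series (telescope a) n)).
  by apply: is_cvgD => //; exact: is_cvg_cst.
by apply/funext => n; exact: eq_sum_telescope.
Qed.

(** Weighted by 4^k, the squared increments still have integrals at most 16^-k. Their sum S is
    therefore integrable, hence finite almost everywhere, and each increment is at most sqrt(S) /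
    2^k. *)
Lemma ae_cvg_of_fast_cauchy (f : nat -> T -> R[i]) :
  (forall k, cmeasurable (f k)) ->
  (forall k, (sqint mu (fun x => f k.+1 x - f k x)%R <= ((64 ^+ k)^-1)%:E)%E) ->
  \forall x \ae mu, cvgn (fun k => complex.Re (f k x)) /\
                    cvgn (fun k => complex.Im (f k x)).
Proof.
move=> mf hf.
pose w k x : \bar R := (4 ^+ k * normc (f k.+1 x - f k x) ^+ 2)%:E.
have w0 k x : (0 <= w k x)%E.
  by rewrite lee_fin; apply: mulr_ge0; [exact: exprn_ge0|exact: sqr_ge0].
have mw k : measurable_fun setT (w k).
  apply/measurable_EFinP; apply: measurable_funM => //; apply: measurable_funX.
  by apply: cmeasurable_normc; exact: cmeasurableB.
have iw k : (\int[mu]_x w k x <= ((16 ^+ k)^-1)%:E)%E.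
  rewrite /w; under eq_integral do rewrite EFinM.
  rewrite ge0_integralZl//; last 2 first.
  - by apply: measurable_normc_sqr; exact: cmeasurableB.
  - by move=> x _; rewrite lee_fin sqr_ge0.
  apply: (@le_trans _ _ ((4 ^+ k)%:E * ((64 ^+ k)^-1)%:E)%E).
    apply: lee_wpmul2l; last exact: hf.
    by rewrite lee_fin; exact: exprn_ge0.
  rewrite -EFinM lee_fin (_ : 64 = 4 * 16 :> R); last by rewrite -natrM.
  by rewrite exprMn invfM mulrA mulfV ?mul1r// expf_neq0.
pose S x := (\sum_(0 <= k <oo) w k x)%E.
have iS : mu.-integrable setT S.
  apply/integrableP; split; first exact: ge0_emeasurable_sum.
  under eq_integral do rewrite gee0_abs ?nneseries_ge0//.
  rewrite integral_nneseries//.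
  apply: (@le_lt_trans _ _ (\sum_(0 <= k <oo) (geometric 1 (16^-1) k)%:E)%E).
    apply: lee_nneseries => k *; first exact: integral_ge0.
    by rewrite /geometric/= mul1r exprVn.
  have cg : cvgn (series (geometric 1 (16^-1) : nat -> R)).
    by apply: is_cvg_geometric_series; rewrite ger0_norm// invf_lt1// ltr1n.
  rewrite (_ : limn _ = (limn (series (geometric 1 (16^-1) : nat -> R)))%:E) ?ltry//.
  rewrite -EFin_lim//; apply/congr_lim/funext => n /=.
  by rewrite /series/= -sumEFin.
apply: filterS (integrable_ae measurableT iS) => x /(_ I) Sx.
(* As (1 + S)^2 >= S, this bound replaces sqrt(S) and no root is taken. *)
pose C := 1 + fine (S x).
have S0 : 0 <= fine (S x) by apply: fine_ge0; exact: nneseries_ge0.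
have C0 : 0 <= C by rewrite addr_ge0.
have hw k : normc (f k.+1 x - f k x) <= C / 2 ^+ k.
  have wS : (w k x <= S x)%E.
    apply: (@le_trans _ _ (\sum_(0 <= i < k.+1) w i x)%E).
      by rewrite big_nat_recr//= leeDr// sume_ge0.
    exact: nneseries_lim_ge.
  rewrite ler_pdivlMr ?exprn_gt0//.
  rewrite -(@ler_pXn2r _ 2)// ?nnegrE ?mulr_ge0 ?exprn_ge0 ?normc_ge0//.
  rewrite exprMn mulrC -exprM mulnC exprM -natrX -lee_fin.
  apply: (le_trans wS); rewrite -(fineK Sx) lee_fin /C.
  by rewrite sqrrD; have := sqr_ge0 (fine (S x)); lra.
split; apply: geometric_increments_cvg C0 _ => k.
  by rewrite -raddfB; exact: le_trans (normr_Re_le _) (hw k).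
by rewrite -raddfB; exact: le_trans (normr_Im_le _) (hw k).
Qed.

(** The Riesz-Fischer argument: a fast subsequence converges almost everywhere, and Fatou's lemma
    identifies its pointwise limit as the L^2 limit. The rate 8^-k has square 64^-k, the rate asked
    for by [ae_cvg_of_fast_cauchy]. *)
Lemma L2_complete (u : nat -> L) :
  (forall e : R, 0 < e -> exists N, forall m n, (N <= m)%N -> (N <= n)%N ->
     rnorm (u m - u n) <= e) ->
  exists l : L, u @ \oo --> l.
Proof.
move=> cu.
have e0 k : 0 < (8 ^+ k)^-1 :> R by rewrite invr_gt0 exprn_gt0.
have [N hN] := choice (fun k => cu _ (e0 k)).
(* Summing puts [phi k] beyond all of N 0, ..., N k although [N] need not be monotone. *)
pose phi k := (\sum_(j < k.+1) N j)%N.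
have Nphi j k : (j <= k)%N -> (N j <= phi k)%N.
  by move=> jk; rewrite /phi (bigD1 (Ordinal (jk : (j < k.+1)%N)))//= leq_addr.
pose f k : T -> R[i] := u (phi k).
have mf k : cmeasurable (f k) by exact: Lspc_cmeasurable.
have fast k : (sqint mu (fun x => f k.+1 x - f k x)%R <= ((64 ^+ k)^-1)%:E)%E.
  rewrite sqint_sub lee_fin (_ : 64 = 8 ^+ 2 :> R); last by rewrite -natrX.
  rewrite -exprM mulnC exprM -exprVn ler_pXn2r ?nnegrE ?rnorm_ge0 ?(ltW (e0 k))//.
  by apply: hN; exact: Nphi.
have cvgf := ae_cvg_of_fast_cauchy mf fast.
(* Upper limits are measurable without any convergence and agree with the limit where it exists,
   that is almost everywhere. *)
pose Fr x := fine (limn_esup (fun k => (complex.Re (f k x))%:E)).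
pose Fi x := fine (limn_esup (fun k => (complex.Im (f k x))%:E)).
pose F x : R[i] := Fr x +i* Fi x.
have mF : cmeasurable F.
  split; apply: (@measurableT_comp _ _ _ _ _ _ (@fine R)) => //.
    apply: (@measurable_fun_limn_esup _ _ _ _ (fun k x => (complex.Re (f k x))%:E)) => k.
    by apply/measurable_EFinP; case: (mf k).
  apply: (@measurable_fun_limn_esup _ _ _ _ (fun k x => (complex.Im (f k x))%:E)) => k.
  by apply/measurable_EFinP; case: (mf k).
have limF : \forall x \ae mu, (complex.Re (f k x) @[k --> \oo] --> Fr x) /\
    (complex.Im (f k x) @[k --> \oo] --> Fi x).
  have aux (a : nat -> R) : cvgn a ->
      a @ \oo --> fine (limn_esup (fun k => (a k)%:E)).
    move=> ca; have h : (a k)%:E @[k --> \oo] --> (limn a)%:E.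
      by apply: cvg_EFin; [exact: nearW|exact: ca].
    by rewrite (cvg_limn_einf_sup h).2.
  by apply: filterS cvgf => x [cr ci]; split; exact: aux.
(* Fatou's lemma runs along the subsequence with [n] fixed, so the estimate concerns every late term
   of [u] and not only those of the subsequence. *)
have key j n : (N j <= n)%N ->
    (sqint mu (fun x => F x - u n x)%R <= ((8 ^+ j)^-1 ^+ 2)%:E)%E.
  move=> jn; pose h k x := (normc (f (j + k)%N x - u n x) ^+ 2)%:E.
  have mh k : measurable_fun setT (h k).
    by apply: measurable_normc_sqr; apply: cmeasurableB => //; exact: Lspc_cmeasurable.
  have h0 k x : (0 <= h k x)%E by rewrite lee_fin sqr_ge0.
  have := @fatou _ _ _ mu _ measurableT h mh (fun k x _ => h0 k x).
  rewrite (_ : (\int[mu]_x limn_einf (h^~ x))%E = sqint mu (fun x => F x - u n x)%R).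
    move=> /le_trans; apply; apply: limn_einf_le_cst => k.
    rewrite [leLHS]sqint_sub lee_fin ler_pXn2r ?nnegrE ?rnorm_ge0 ?(ltW (e0 j))//.
    by apply: hN => //; apply: Nphi; exact: leq_addr.
  apply: ae_eq_integral => //.
  - apply: (@measurableT_comp _ _ _ _ _ _ (@oppe R)) => //.
    apply: (@measurable_fun_limn_esup _ _ _ _ (fun k x => (- h k x)%E)) => k.
    exact: measurableT_comp.
  - by apply: measurable_normc_sqr; apply: cmeasurableB => //; exact: Lspc_cmeasurable.
  - apply: filterS limF => x [cr ci] _.
    have hx : h k x @[k --> \oo] --> (normc (F x - u n x) ^+ 2)%:E.
      apply: cvg_EFin; first exact: nearW.
      rewrite /h normc_sqr !raddfB/=.
      have -> : fine \o (h ^~ x) = (fun k =>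
         (complex.Re (f (j + k)%N x) - complex.Re (u n x)) ^+ 2 +
         (complex.Im (f (j + k)%N x) - complex.Im (u n x)) ^+ 2).
        by apply/funext => k /=; rewrite normc_sqr !raddfB.
      have sh (a : nat -> R) (l : R) : a @ \oo --> l -> a (j + k)%N @[k --> \oo] --> l.
        by rewrite -(cvg_shiftn j); under eq_fun do rewrite addnC.
      apply: cvgD; (apply: (@cvg_comp _ _ _ _ (fun x => x ^+ 2)); last exact: exprn_continuous).
        by apply: cvgB; [exact: (sh (fun k => complex.Re (f k x)))|exact: cvg_cst].
      by apply: cvgB; [exact: (sh (fun k => complex.Im (f k x)))|exact: cvg_cst].
    by rewrite (cvg_limn_einf_sup hx).1.
have LF : cLfun mu 2%:E F.
  have LD : cLfun mu 2%:E (fun x => F x - u (N 0%N) x).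
    apply/cLfun2P; split; first by apply: cmeasurableB => //; exact: Lspc_cmeasurable.
    by rewrite (le_lt_trans (key 0%N _ _))// ltry.
  rewrite (_ : F = (fun x => (F x - u (N 0%N) x) + u (N 0%N) x)).
    by apply: cLfunD => //; [exact: lee1n|exact: Lspc_funP].
  by apply/funext => x; rewrite subrK.
exists (Lcls mu (lee1n 2) F); apply/cvg_rnormP.
apply/cvgr0Pnorm_le => e epos.
have [j je] : exists j, (8 ^+ j)^-1 <= e.
  have /cvgr0_norm_le /(_ e epos) [j _ /(_ j (leqnn j))] : geometric 1 (8^-1 : R) @ \oo --> 0.
    by apply: cvg_geometric; rewrite ger0_norm// invf_lt1// ltr1n.
  by rewrite /geometric /= mul1r => h; exists j; rewrite -exprVn (le_trans (ler_norm _)).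
exists (N j) => // n /= jn.
rewrite ger0_norm ?rnorm_ge0// (le_trans _ je)//.
apply: rnorm_le; first exact: ltW.
rewrite -rnorm_sqr -sqint_sub; apply: le_trans (key j n jn).
rewrite (_ : sqint mu _ = sqint mu (fun x => F x - u n x)%R)//.
apply: ae_eq_sqint.
- by apply: cmeasurableB; exact: Lspc_cmeasurable.
- by apply: cmeasurableB => //; exact: Lspc_cmeasurable.
- by apply: filterS (LclsE (lee1n 2) LF) => x ->.
Qed.

End L2_complete.

(** * Bounded linear maps, weighted compositions and density in L^2 *)

Section bounded_linear_theory.
Variable R : realType.
Implicit Types X Y Z : normedModType R[i].

(** The constant of [bounded_linear] lives in [R[i]]. Its product with a norm dominates a norm,
    hence is nonnegative and equal to its modulus, so the modulus of the constant serves as well. *)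
Lemma bounded_linear_pos X Y (T : X -> Y) : bounded_linear T ->
  linear T /\ exists2 M : R, 0 <= M & forall x, `|T x| <= M%:C * `|x|.
Proof.
move=> [lT [M TM]]; split=> //; exists (normc M); first exact: normc_ge0.
move=> x; rewrite -[(normc M)%:C]/(`|M|) -[`|x|]normr_id -normrM.
by rewrite ger0_norm//; exact: le_trans (normr_ge0 _) (TM x).
Qed.

Lemma bounded_linearI X Y (T : X -> Y) (M : R) : linear T ->
  (forall x, `|T x| <= M%:C * `|x|) -> bounded_linear T.
Proof. by move=> lT TM; split => //; exists M%:C. Qed.

Lemma bounded_linear_comp X Y Z (S : Y -> Z) (T : X -> Y) :
  bounded_linear S -> bounded_linear T -> bounded_linear (S \o T).
Proof.
move=> /bounded_linear_pos[lS [M M0 SM]] /bounded_linear_pos[lT [N N0 TN]].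
apply: (@bounded_linearI _ _ _ (M * N)) => [a x y|x] /=; first by rewrite lT lS.
rewrite (le_trans (SM _))// rmorphM -mulrA ler_wpM2l ?TN//.
by rewrite lecR.
Qed.

Lemma bounded_linearD X Y (S T : X -> Y) :
  bounded_linear S -> bounded_linear T -> bounded_linear (fun x => S x + T x).
Proof.
move=> /bounded_linear_pos[lS [M M0 SM]] /bounded_linear_pos[lT [N N0 TN]].
apply: (@bounded_linearI _ _ _ (M + N)) => [a x y|x] /=.
  by rewrite lT lS scalerDr addrACA.
by rewrite (le_trans (ler_normD _ _))// rmorphD mulrDl lerD.
Qed.

Lemma bounded_linearZ X Y (c : R[i]) (T : X -> Y) :
  bounded_linear T -> bounded_linear (fun x => c *: T x).
Proof.
move=> /bounded_linear_pos[lT [N N0 TN]].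
apply: (@bounded_linearI _ _ _ (normc c * N)) => [a x y|x] /=.
  by rewrite lT scalerDr !scalerA mulrC.
by rewrite normrZ rmorphM -mulrA ler_wpM2l.
Qed.

Lemma bounded_linear_id X : bounded_linear (@id X).
Proof. by apply: (@bounded_linearI _ _ _ 1) => // x; rewrite mul1r. Qed.

Lemma linear_lin0 X Y (T : X -> Y) : linear T -> T 0 = 0.
Proof. by move=> lT; have := lT (-1) 0 0; rewrite scaler0 addr0 scaleN1r addNr. Qed.

Lemma linear_linZ X Y (T : X -> Y) (a : R[i]) x : linear T -> T (a *: x) = a *: T x.
Proof. by move=> lT; rewrite -[a *: x]addr0 lT linear_lin0// addr0. Qed.

Lemma linear_linD X Y (T : X -> Y) x y : linear T -> T (x + y) = T x + T y.
Proof. by move=> lT; rewrite -[x in LHS]scale1r lT scale1r. Qed.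

Lemma linear_linB X Y (T : X -> Y) x y : linear T -> T (x - y) = T x - T y.
Proof.
by move=> lT; rewrite linear_linD// -scaleN1r linear_linZ// scaleN1r.
Qed.

Lemma linear_lin_sum X Y (T : X -> Y) n (c : 'I_n -> R[i]) (x : 'I_n -> X) :
  linear T -> T (\sum_(i < n) c i *: x i) = \sum_(i < n) c i *: T (x i).
Proof.
move=> lT; elim/big_ind2: _ => [|a b a' b' <- <-|i _].
- exact: linear_lin0.
- exact: linear_linD.
- exact: linear_linZ.
Qed.

End bounded_linear_theory.

Section L2_operators.
Context d (T : measurableType d) d' (T' : measurableType d') (R : realType).
Variables (mu : {measure set T -> \bar R}) (nu : {measure set T' -> \bar R}).
Local Notation L := (Lspc mu (lee1n 2)).
Local Notation L' := (Lspc nu (lee1n 2)).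

Lemma bounded_linear_rnorm (A : L -> L') (M : R) : linear A ->
  (forall f, rnorm (A f) <= M * rnorm f) -> bounded_linear A.
Proof.
move=> lA AM; apply: (bounded_linearI lA (M := M)) => f.
by rewrite !normE_rnorm -rmorphM lecR.
Qed.

(* Covers translations, reflection, restriction to the half-line and extension
   by zero; where [c = 0], as in the last case, [psi] may be singular. *)
Variables (c : T' -> R[i]) (psi : T' -> T).

Definition weighted_comp (f : L) : L' :=
  Lcls nu (lee1n 2) (fun y => c y * f (psi y)).

Hypothesis mc : cmeasurable c.
Hypothesis mpsi : measurable_fun [set: T'] psi.
Hypothesis ae_psi : forall P : T -> Prop, (\forall x \ae mu, P x) ->
  \forall y \ae nu, c y != 0 -> P (psi y).
Hypothesis sqint_psi : forall f : T -> R[i], cmeasurable f ->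
  (sqint nu (fun y => c y * f (psi y))%R <= sqint mu f)%E.

Lemma weighted_comp_cLfun (f : T -> R[i]) : cLfun mu 2%:E f ->
  cLfun nu 2%:E (fun y => c y * f (psi y)).
Proof.
move=> /cLfun2P[mf lf]; apply/cLfun2P; split.
  by apply: cmeasurableM => //; exact: cmeasurable_comp.
exact: le_lt_trans (sqint_psi mf) lf.
Qed.

Lemma weighted_compE (f : L) :
  \forall y \ae nu, weighted_comp f y = c y * f (psi y).
Proof. by apply: LclsE; apply: weighted_comp_cLfun; exact: Lspc_funP. Qed.

Lemma weighted_comp_ae (f : L) (g : T -> R[i]) : (\forall x \ae mu, f x = g x) ->
  \forall y \ae nu, weighted_comp f y = c y * g (psi y).
Proof.
move=> fg; apply: filterS2 (weighted_compE f) (ae_psi fg) => y -> h.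
by have [->|/h ->//] := eqVneq (c y) 0; rewrite !mul0r.
Qed.

Lemma bounded_linear_weighted_comp : bounded_linear weighted_comp.
Proof.
apply: (@bounded_linear_rnorm _ 1) => [a f g|f].
  have h : \forall x \ae mu, (a *: f + g : L) x = a * (f : L) x + (g : L) x.
    apply: filterS2 (LspcDE (a *: f) g) (LspcZE a f) => x -> ->; reflexivity.
  apply: Lspc_eq; near=> y.
  rewrite (near (LspcDE (a *: weighted_comp f) (weighted_comp g)) y)//.
  rewrite (near (LspcZE a (weighted_comp f)) y)//.
  rewrite (near (weighted_compE f) y)// (near (weighted_compE g) y)//.
  rewrite (near (weighted_comp_ae h) y)//.
  by ring.
rewrite mul1r; apply: rnorm_le; first exact: rnorm_ge0.
rewrite rnorm_sqr -rnorm_sqr rnorm_sqr.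
rewrite (@ae_eq_sqint _ _ _ nu _ (fun y => c y * f (psi y))).
- by apply: sqint_psi; exact: Lspc_cmeasurable.
- exact: Lspc_cmeasurable.
- by apply: cmeasurableM => //; apply: cmeasurable_comp => //; exact: Lspc_cmeasurable.
- exact: weighted_compE.
Unshelve. all: by end_near. Qed.

End L2_operators.

Section L2_density.
Variable R : realType.
Local Notation leb := (@lebesgue_measure R).
Local Notation cls := (Lcls leb (lee1n 2)).
Implicit Types f g : measurableTypeR R -> R[i].

Definition L12 f := cL1 f /\ cLfun leb 2%:E f.

Lemma truncationE n (f : R -> R[i]) :
  truncation n f = (fun x => itv_indic (- n%:R) n%:R x * f x).
Proof.
apply/funext => x; rewrite /truncation /itv_indic indicE mem_setE.
by case: (_ \in _); rewrite ?mul1r ?mul0r.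
Qed.

Lemma L12_truncation n f : cLfun leb 2%:E f -> L12 (truncation n f).
Proof.
move=> Lf; rewrite truncationE; split.
  by apply: cL1M => //; exact: cLfun_itv_indic.
apply: (@cLfunM _ _ _ leb 2%:E (lee1n 2) _ _ 1) => //.
  exact: cmeasurable_itv_indic.
apply: nearW => x; rewrite normc_itv_indic indicE.
by case: (_ \in _).
Qed.

Lemma cLfun_truncation n f : cLfun leb 2%:E f -> cLfun leb 2%:E (truncation n f).
Proof. by move=> /(L12_truncation n)[]. Qed.

Lemma truncation_cvg (f : L2 R) : cls (truncation n f) @[n --> \oo] --> f.
Proof.
apply/cvg_rnormP.
have Lf := Lspc_funP f; have mf := Lspc_cmeasurable f.
have Ltr n := cLfun_truncation n Lf.
pose h n (x : measurableTypeR R) := normc (f x - truncation n f x) ^+ 2.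
have mh n : measurable_fun setT (h n).
  apply: measurable_funX; apply: cmeasurable_normc; apply: cmeasurableB => //.
  by case: (Ltr n).
have hle n x : `|h n x| <= normc (f x) ^+ 2.
  rewrite ger0_norm ?sqr_ge0// /h /truncation; case: ifPn => _.
    by rewrite subrr normc0 expr0n/= sqr_ge0.
  by rewrite subr0.
have hE n : \int[leb]_x h n x = rnorm (f - cls (truncation n f)) ^+ 2.
  apply: EFin_inj; rewrite -sqint_sub /Rintegral fineK.
    apply: ae_eq_integral => //.
    - exact/measurable_EFinP.
    - by apply: measurable_normc_sqr; apply: cmeasurableB => //; exact: Lspc_cmeasurable.
    - by apply: filterS (LclsE (lee1n 2) (Ltr n)) => x ->.
  apply: (integrable_fin_num measurableT).
  apply: le_integrable (cL1_sqr Lf) => //; first exact/measurable_EFinP.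
  by move=> x _ /=; rewrite lee_fin [leRHS]ger0_norm ?sqr_ge0.
have : \int[leb]_x h n x @[n --> \oo] --> \int[leb]_(x in [set: measurableTypeR R]) (0 : R).
  apply: (Rintegral_cvg mh _ _ hle (cL1_sqr Lf)).
    exact: measurable_cst.
  (* At a fixed point the truncation error is 0 as soon as n reaches |x|. *)
  move=> x; apply: (@cvg_near_cst).
  have [n nx] : exists n : nat, `|x| <= n%:R.
    by exists (Num.bound `|x|); exact/ltW/archi_boundP.
  exists n => // m /= nm; rewrite /h /truncation ifT ?subrr ?normc0 ?expr0n//.
  by rewrite in_itv/= -ler_norml (le_trans nx)// ler_nat.
rewrite Rintegral_cst// mul0r; under eq_cvg do rewrite hE.
move=> h0; have := (cvg_comp _ _ h0 (@sqrt_continuous R 0)); rewrite sqrtr0.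
apply: cvg_trans; apply: near_eq_cvg; apply: nearW => n /=.
by rewrite sqrtr_sqr ger0_norm ?rnorm_ge0.
Qed.

Lemma cvg_rnorm_unique (u : nat -> L2 R) (l l' : L2 R) :
  u @ \oo --> l -> u @ \oo --> l' -> l = l'.
Proof.
move=> /cvg_rnormP ul /cvg_rnormP ul'.
apply/eqP; rewrite -subr_eq0; apply/eqP; apply: rnorm_eq0.
apply/eqP; rewrite eq_le rnorm_ge0 andbT; apply/ler_addgt0Pr => e e0.
rewrite add0r; have e2 : 0 < e / 2 by rewrite divr_gt0.
have /cvgr0_norm_le /(_ _ e2) [N _ h] := ul.
have /cvgr0_norm_le /(_ _ e2) [N' _ h'] := ul'.
pose n := maxn N N'.
have -> : l - l' = (l - u n) + - (l' - u n) by rewrite opprB addrA subrK.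
rewrite (le_trans (rnormD _ _))// rnormN (splitr e) lerD//.
  exact: le_trans (ler_norm _) (h n (leq_maxl N N')).
exact: le_trans (ler_norm _) (h' n (leq_maxr N N')).
Qed.

(** Truncations of f lie in L^1 and L^2 and converge to f, so |A f - B f| is at most (M + N) times a
    truncation error. Identities for [fourier] thereby reduce to functions whose transform is an
    honest integral. *)
Lemma bounded_linear_dense (V : normedModType R[i]) (A B : L2 R -> V) :
  bounded_linear A -> bounded_linear B ->
  (forall f, L12 f -> A (cls f) = B (cls f)) -> A =1 B.
Proof.
move=> /bounded_linear_pos[lA [M M0 AM]] /bounded_linear_pos[lB [N N0 BN]] AB f.
apply/eqP; rewrite -subr_eq0 -normr_eq0; apply/eqP.
have /cvg_rnormP trf := @truncation_cvg f.
have le n : `|A f - B f| <= ((M + N) * rnorm (f - cls (truncation n f)))%:C.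
  set t := cls _.
  have ABt : A t = B t by apply: AB; exact/L12_truncation/Lspc_funP.
  have -> : A f - B f = A (f - t) - B (f - t).
    by rewrite (linear_linB f t lA) (linear_linB f t lB) ABt opprB addrA subrK.
  rewrite (le_trans (ler_normB _ _))// mulrDl rmorphD !rmorphM.
  by apply: lerD; [exact: AM|exact: BN].
have [x xE] : exists x : R, `|A f - B f| = x%:C.
  exists (complex.Re `|A f - B f|).
  have := normr_ge0 (A f - B f); case: `|_| => a b /=.
  by rewrite lecE/= => /andP[/eqP -> _].
have x0 : 0 <= x by rewrite -lecR -xE normr_ge0.
have lim0 : (M + N) * rnorm (f - cls (truncation n f)) @[n --> \oo] --> 0.
  by rewrite -[X in _ --> X](mulr0 (M + N)); apply: cvgMr.
rewrite xE; congr (_%:C); apply/eqP; rewrite eq_le x0 andbT.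
rewrite -(cvg_lim _ lim0)//; apply: limr_ge; first exact: cvgP lim0.
by apply: nearW => n; rewrite -lecR -xE.
Qed.

End L2_density.

(** * The bilinear pairing on L^2 *)

Section bilinear_form.
Variable R : realType.
Local Notation leb := (@lebesgue_measure R).
Local Notation cls := (Lcls leb (lee1n 2)).

(** There is no conjugation, so that the multiplication formula becomes symmetry of [fourier]. The
    target is [R[i]^o], a normed module, so that the density principle applies to the pairing. *)
Definition bform (f g : L2 R) : R[i]^o := cintegral (fun x => f x * g x).

Lemma bformC f g : bform f g = bform g f.
Proof. by apply: eq_cintegral => x; rewrite mulrC. Qed.

Lemma bform_L1 (f g : L2 R) : cL1 (fun x => f x * g x).
Proof. by apply: cL1M; exact: Lspc_funP. Qed.

Lemma bform_ae (f g : L2 R) (f' g' : measurableTypeR R -> R[i]) :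
  cmeasurable f' -> cmeasurable g' ->
  (\forall x \ae leb, f x = f' x) -> (\forall x \ae leb, g x = g' x) ->
  bform f g = cintegral (fun x => f' x * g' x).
Proof.
move=> mf' mg' ff' gg'; apply: ae_eq_cintegral.
- by have [] := bform_L1 f g.
- exact: cmeasurableM.
- by apply: filterS2 ff' gg' => x -> ->.
Qed.

Lemma bform_bounded_linear (g : L2 R) :
  bounded_linear ((fun f : L2 R => bform f g) : L2 R -> R[i]^o).
Proof.
apply: (bounded_linearI (M := 2 * rnorm g)) => [a f h|f].
  have L1f := bform_L1 f g; have L1h := bform_L1 h g.
  transitivity (cintegral (fun x => a * ((f : L2 R) x * g x) + (h : L2 R) x * g x)); last first.
    by rewrite (cintegralD (cL1Z a L1f) L1h) cintegralZ.
  apply: ae_eq_cintegral.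
  - by have [] := bform_L1 (a *: f + h) g.
  - by apply: cmeasurableD; [have [] := cL1Z a L1f|case: L1h].
  - apply: filterS2 (LspcDE (a *: f) h) (LspcZE a f) => x -> ->.
    by rewrite mulrDl mulrA.
rewrite [`|bform f g|]/(normc (bform f g))%:C normE_rnorm -rmorphM lecR -lee_fin.
apply: (le_trans (normc_cintegral_le (bform_L1 f g).1)).
rewrite -mulrA EFinM lee_pmul2l// mulrC; exact: cauchy_schwarz.
Qed.

Lemma bform_bounded_linear_r (f : L2 R) :
  bounded_linear (bform f : L2 R -> R[i]^o).
Proof.
rewrite (_ : bform f = fun g : L2 R => bform g f); first exact: bform_bounded_linear.
by apply/funext => g; rewrite bformC.
Qed.

Lemma cL1_L2_itv (h : L2 R) (a b : R) : cL1 (fun x => h x * itv_indic a b x).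
Proof. by apply: cL1M; [exact: Lspc_funP|exact: cLfun_itv_indic]. Qed.

(** Lebesgue differentiation: the primitive of [h] vanishes identically, and its derivative is [h]
    almost everywhere. *)
Lemma Rintegral_itv_ae_eq0 (h : measurableTypeR R -> R) :
  measurable_fun setT h ->
  (forall a b : R, leb.-integrable `[a, b] (EFin \o h)) ->
  (forall a b : R, a < b -> \int[leb]_(x in `[a, b]) h x = 0) ->
  \forall x \ae leb, h x = 0.
Proof.
move=> mh ih h0.
(* A primitive based at -n gives information to the right of -n only; countably many base points
   cover the line. *)
pose P (n : nat) (x : measurableTypeR R) := - n%:R < (x : R) -> h x = 0.
have H n : \forall x \ae leb, P n x.
  have li : locally_integrable setT h.
    split => //; first exact: openT.
    move=> K _ cK; have [M [Mreal KM]] := compact_bounded cK.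
    have mK : measurable (K : set (measurableTypeR R)).
      exact: compact_measurable.
    have KI : K `<=` `[- (`|M| + 1), `|M| + 1].
      move=> x Kx /=; rewrite in_itv/= -ler_norml; apply: (KM _ _ _ Kx).
      by rewrite (le_lt_trans (ler_norm M))// ltrDl.
    have /integrableP[_] : leb.-integrable K (EFin \o h).
      exact: integrableS _ mK KI (ih _ _).
    exact.
  have /= F1 := @FTC1 R h (BLeft (- n%:R)) (fun y => ih _ y) li.
  have {}F1 : \forall x \ae leb, (fun x : measurableTypeR R => ((- n%:R)%:E < x%:E)%E ->
      derivable (fun x0 : R => \int[leb]_(t in `[- n%:R, x0]) h t) x 1 /\
      (fun x0 : R => \int[leb]_(t in `[- n%:R, x0]) h t)^`()%classic x = h x) x.
    exact: F1.
  apply: filterS F1 => x hx nx; have [_ <-] := hx nx.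
  rewrite (_ : (fun x => _) = cst 0) ?derive1_cst//.
  apply/funext => y /=; have [ny|yn|->] := ltgtP (- n%:R) y.
  - exact: h0.
  - by rewrite set_itv_ge ?Rintegral_set0// bnd_simp -ltNge.
  - by rewrite set_itv1 Rintegral_set1.
have Hn : \forall x \ae leb, forall n : nat, P n x.
  by apply/ae_foralln => n; exact: H.
apply: filterS Hn => x /(_ (Num.bound `|x|)); apply.
rewrite ltrNl (le_lt_trans (ler_norm _))// normrN.
exact: archi_boundP.
Qed.

Lemma bform_itv_eq0 (h : L2 R) :
  (forall a b : R, a < b -> bform h (cls (itv_indic a b)) = 0) -> h = 0.
Proof.
move=> h0; have [mr mi] := Lspc_cmeasurable h.
have E a b : a < b -> cintegral (fun x => h x * itv_indic a b x) = 0.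
  move=> ab; rewrite -(h0 a b ab); apply/esym/bform_ae.
  - exact: Lspc_cmeasurable.
  - exact: cmeasurable_itv_indic.
  - exact: nearW.
  - by apply: LclsE; exact: cLfun_itv_indic.
have ind (p : R[i] -> R) (a b : R) : (forall x, p (h x * itv_indic a b x) =
    p (h x) * \1_(`[a, b]%classic) x) -> forall x,
    ((fun x => p (h x)) \_ `[a, b]) x = p (h x * itv_indic a b x).
  move=> ph x; rewrite ph patchE indicE; case: ifPn => _; first by rewrite mulr1.
  by rewrite mulr0.
have indRe a b x : ((fun x => complex.Re (h x)) \_ `[a, b]) x =
    complex.Re (h x * itv_indic a b x).
  by apply: ind => y; rewrite ReM/= mulr0 subr0.
have indIm a b x : ((fun x => complex.Im (h x)) \_ `[a, b]) x =
    complex.Im (h x * itv_indic a b x).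
  by apply: ind => y; rewrite ImM/= mulr0 add0r.
have re0 : \forall x \ae leb, complex.Re (h x) = 0.
  apply: Rintegral_itv_ae_eq0 => // [a b|a b ab].
    apply: eq_integrable (integrableS measurableT _ _ (cL1_Re (cL1_L2_itv h a b))) => // x xab.
    by rewrite /= -indRe patchE xab.
  rewrite Rintegral_mkcond; under eq_Rintegral do rewrite indRe.
  by have /(congr1 (@complex.Re R)) := E a b ab.
have im0 : \forall x \ae leb, complex.Im (h x) = 0.
  apply: Rintegral_itv_ae_eq0 => // [a b|a b ab].
    apply: eq_integrable (integrableS measurableT _ _ (cL1_Im (cL1_L2_itv h a b))) => // x xab.
    by rewrite /= -indIm patchE xab.
  rewrite Rintegral_mkcond; under eq_Rintegral do rewrite indIm.
  by have /(congr1 (@complex.Im R)) := E a b ab.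
apply: Lspc_eq; have z := Lspc0E leb (lee1n 2).
apply: filterS3 re0 im0 z => x r0 i0 ->; exact: eq_ReIm.
Qed.

End bilinear_form.

Lemma subr_sub_sub (V : zmodType) (a b c : V) : b - c = (a - c) + - (a - b).
Proof. by rewrite opprB [RHS]addrC addrA subrK. Qed.

(** * The Fourier transformation on L^2 *)

Section fourier_L2.
Variable R : realType.
Local Notation leb := (@lebesgue_measure R).
Local Notation cls := (Lcls leb (lee1n 2)).
Implicit Types f g : measurableTypeR R -> R[i].

Definition fourier_L12 f : L2 R := cls (fourier_integral f).

Lemma fourier_L12E f : L12 f ->
  \forall x \ae leb, fourier_L12 f x = fourier_integral f x.
Proof. by move=> [L1f L2f]; apply: LclsE; exact: cLfun_fourier_integral. Qed.

Lemma fourier_L12_linear (a : R[i]) f g : L12 f -> L12 g ->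
  fourier_L12 (fun x => a * f x + g x) = a *: fourier_L12 f + fourier_L12 g.
Proof.
move=> Lf Lg; have [L1f L2f] := Lf; have [L1g L2g] := Lg.
have Lafg : L12 (fun x => a * f x + g x).
  split; first exact: cL1D (cL1Z a L1f) L1g.
  by apply: cLfunD (cLfunZ _ _ L2f) L2g; exact: lee1n.
apply: Lspc_eq; near=> x.
rewrite (near (fourier_L12E Lafg) x)//.
rewrite (near (LspcDE (a *: fourier_L12 f) (fourier_L12 g)) x)//.
rewrite (near (LspcZE a (fourier_L12 f)) x)//.
rewrite (near (fourier_L12E Lf) x)// (near (fourier_L12E Lg) x)//.
by rewrite fourier_integralD ?fourier_integralZ//; exact: cL1Z.
Unshelve. all: by end_near. Qed.

(** Square root of the constant in [sqint_fourier_le]. *)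
Let K : R := Num.sqrt (8 * pi).

Let K0 : 0 <= K. Proof. exact: sqrtr_ge0. Qed.

Lemma rnorm_fourier_L12 f : L12 f -> rnorm (fourier_L12 f) <= K * rnorm (cls f).
Proof.
move=> Lf; have [L1f L2f] := Lf; have [mf _] := L1f.
apply: rnorm_le; first by rewrite mulr_ge0 ?rnorm_ge0.
rewrite (@ae_eq_sqint _ _ _ leb _ (fourier_integral f)); last 3 first.
- exact: Lspc_cmeasurable.
- exact: cmeasurable_fourier_integral.
- exact: fourier_L12E.
rewrite exprMn EFinM rnorm_sqr sqr_sqrtr ?mulr_ge0 ?pi_ge0//.
rewrite (@ae_eq_sqint _ _ _ leb (cls f) f) ?Lspc_cmeasurable//.
- exact: sqint_fourier_le.
- exact: Lspc_cmeasurable.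
- exact: LclsE.
Qed.

Lemma ae_eq_fourier_L12 f g : L12 f -> L12 g ->
  (\forall x \ae leb, f x = g x) -> fourier_L12 f = fourier_L12 g.
Proof.
move=> [[mf _] _] [[mg _] _] fg.
by rewrite /fourier_L12 (ae_eq_fourier_integral mf mg fg).
Qed.

Lemma L12_cls f : L12 f -> \forall x \ae leb, cls f x = f x.
Proof. by move=> [_ Lf]; exact: LclsE. Qed.

Lemma cls_sub f g : L12 f -> L12 g ->
  cls (fun x => -1 * f x + g x) = cls g - cls f.
Proof.
move=> Lf Lg; have [_ L2f] := Lf; have [_ L2g] := Lg.
have Lh : cLfun leb 2%:E (fun x => -1 * f x + g x).
  by apply: cLfunD (cLfunZ _ _ L2f) L2g; exact: lee1n.
apply: Lspc_eq; near=> x.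
rewrite (near (LclsE (lee1n 2) Lh) x)// (near (LspcBE (cls g) (cls f)) x)//.
by rewrite (near (L12_cls Lf) x)// (near (L12_cls Lg) x)// mulN1r addrC.
Unshelve. all: by end_near. Qed.

Lemma rnorm_fourier_L12B f g : L12 f -> L12 g ->
  rnorm (fourier_L12 g - fourier_L12 f) <= K * rnorm (cls g - cls f).
Proof.
move=> Lf Lg; rewrite -(cls_sub Lf Lg) addrC -scaleN1r -fourier_L12_linear//.
apply: rnorm_fourier_L12; have [L1f L2f] := Lf; have [L1g L2g] := Lg.
split; first exact: cL1D (cL1Z _ L1f) L1g.
by apply: cLfunD (cLfunZ _ _ L2f) L2g; exact: lee1n.
Qed.

(** A [lim] is meaningful only once convergence is known. Here the L^2 bound makes the transformed
    truncations a Cauchy sequence, and completeness supplies the limit. *)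
Lemma fourier_cvg (f : L2 R) :
  fourier_L12 (truncation n f) @[n --> \oo] --> fourier f.
Proof.
have Lt n := L12_truncation n (Lspc_funP f).
suff [l ul] : exists l : L2 R, fourier_L12 (truncation n f) @[n --> \oo] --> l.
  have := cvgP _ ul; exact.
apply: L2_complete => e e0.
have /cvg_rnormP/cvgr0_norm_le trf := @truncation_cvg R f.
(* Two truncation errors are added and multiplied by [K]; [K + 1] keeps the denominator visibly
   positive. *)
have d0 : 0 < e / (2 * (K + 1)).
  by rewrite divr_gt0// mulr_gt0// ltr_wpDl.
have [N _ hN] := trf _ d0.
exists N => m n Nm Nn.
rewrite (le_trans (rnorm_fourier_L12B (Lt n) (Lt m)))//.
have -> : cls (truncation m f) - cls (truncation n f) =
    (f - cls (truncation n f)) + - (f - cls (truncation m f)).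
  exact: subr_sub_sub.
have h : rnorm ((f - cls (truncation n f)) + - (f - cls (truncation m f))) <=
    e / (K + 1).
  rewrite (le_trans (rnormD _ _))// rnormN.
  have h1 := le_trans (ler_norm _) (hN _ Nn).
  have h2 := le_trans (ler_norm _) (hN _ Nm).
  rewrite (le_trans (lerD h1 h2))//.
  have K1 : K + 1 != 0 by rewrite gt_eqF// ltr_wpDl.
  by rewrite le_eqVlt; apply/orP; left; apply/eqP; field.
rewrite (le_trans (ler_wpM2l K0 h))// mulrCA ler_piMr ?(ltW e0)//.
by rewrite ler_pdivrMr ?ltr_wpDl// mul1r lerDl.
Qed.

(** Consistency of the two definitions: the truncations of f also converge under [fourier_L12], by
    its L^2 bound, and limits are unique. *)
Lemma fourierE f : L12 f -> fourier (cls f) = fourier_L12 f.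
Proof.
move=> Lf; apply: cvg_rnorm_unique (@fourier_cvg (cls f)) _.
apply/cvg_rnormP.
have /cvg_rnormP trf := @truncation_cvg R (cls f).
have lim0 : K * rnorm (cls f - cls (truncation n (cls f))) @[n --> \oo] --> 0.
  by rewrite -[X in _ --> X](mulr0 K); apply: cvgMr.
apply: squeeze_cvgr (cvg_cst 0) lim0.
apply: nearW => n; rewrite rnorm_ge0/=; apply: rnorm_fourier_L12B => //.
exact/L12_truncation/Lspc_funP.
Qed.

(** Both properties pass to the limit along truncations: linearity since truncation is pointwise
    linear, the bound since truncations and their transforms both converge in norm. *)
Lemma fourier_bounded_linear : bounded_linear (@fourier R).
Proof.
have Lt (f : L2 R) n := L12_truncation n (Lspc_funP f).
apply: (@bounded_linear_rnorm _ _ _ _ R leb leb _ K) => [a f g|f].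
  apply: cvg_rnorm_unique (@fourier_cvg (a *: f + g)) _.
  rewrite (_ : (fun n => _) = (fun n => a *: fourier_L12 (truncation n (f : L2 R)) +
      fourier_L12 (truncation n (g : L2 R)))).
    by apply: cvgD; [apply: cvgZr|]; exact: fourier_cvg.
  apply/funext => n; rewrite -fourier_L12_linear//.
  apply: ae_eq_fourier_L12 => //.
    split; first by apply: cL1D (cL1Z a (Lt f n).1) (Lt g n).1.
    by apply: cLfunD (cLfunZ _ _ (Lt f n).2) (Lt g n).2; exact: lee1n.
  apply: filterS2 (LspcDE (a *: f) g) (LspcZE a f) => x h1 h2.
  by rewrite /truncation h1 h2; case: ifP => //; rewrite mulr0 addr0.
have /cvg_rnormP trF := @fourier_cvg f.
have /cvg_rnormP trf := @truncation_cvg R f.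
apply/ler_addgt0Pr => e e0.
(* Errors d before and after the transformation contribute d + K d, which is e / 2 for this d. *)
have e2 : 0 < e / (K + 1) / 2 by rewrite !divr_gt0// ltr_wpDl.
have /cvgr0_norm_le /(_ _ e2) [N1 _ h1] := trF.
have /cvgr0_norm_le /(_ _ e2) [N2 _ h2] := trf.
pose n := maxn N1 N2.
have n1 : rnorm (fourier f - fourier_L12 (truncation n f)) <= e / (K + 1) / 2.
  exact: le_trans (ler_norm _) (h1 n (leq_maxl N1 N2)).
have n2 : rnorm (f - cls (truncation n f)) <= e / (K + 1) / 2.
  exact: le_trans (ler_norm _) (h2 n (leq_maxr N1 N2)).
set t := truncation n f in n1 n2 *.
have n3 : rnorm (cls t) <= rnorm f + e / (K + 1) / 2.
  have -> : cls t = f + - (f - cls t) by rewrite (subKr f (cls t)).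
  by rewrite (le_trans (rnormD _ _))// rnormN lerD.
have n4 := rnorm_fourier_L12 (Lt f n).
rewrite -(subrK (fourier_L12 t) (fourier f)) (le_trans (rnormD _ _))//.
have n5 := ler_wpM2l K0 n3.
have K1 : K + 1 != 0 by rewrite gt_eqF// ltr_wpDl.
have : e / (K + 1) / 2 + K * (e / (K + 1) / 2) = e / 2 by field.
move: n1 n4 n5; rewrite -/t mulrDr.
lra.
Qed.

End fourier_L2.

Section multiplication_operator.
Context d (T : measurableType d) (R : realType).
Variable mu : {measure set T -> \bar R}.
Local Notation L := (Lspc mu (lee1n 2)).
Local Notation Li := (Lspc mu (leey 1)).

Definition supnorm (phi : Li) : R := fine (cLnorm mu +oo%E phi).

Lemma normE_supnorm (phi : Li) : `|phi| = (supnorm phi)%:C. Proof. by []. Qed.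

Lemma supnorm_ge0 (phi : Li) : 0 <= supnorm phi.
Proof. by apply: fine_ge0; exact: cLnorm_ge0. Qed.

Lemma normc_le_supnorm (phi : Li) :
  \forall x \ae mu, normc (phi x) <= supnorm phi.
Proof.
have [_ lphi] := Lspc_funP phi.
have fphi : cLnorm mu +oo%E phi = (supnorm phi)%:E.
  by rewrite fineK// ge0_fin_numE// cLnorm_ge0.
move: fphi; rewrite /cLnorm unlock /Lnorm.
(* At exponent [+oo] the norm is 0 by convention on a space of measure 0, where everything holds
   almost everywhere. *)
case: ifPn => [_ h|mu0 _]; last first.
  exists setT; split => //.
  by apply/eqP; rewrite eq_le measure_ge0 andbT leNgt.
apply: filterS (ess_sup_ge mu (abse \o (fun x => (normc (phi x))%:E))) => x.
by rewrite h /= lee_fin ger0_norm ?normc_ge0.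
Qed.

Lemma Li_cmeasurable (phi : Li) : cmeasurable phi.
Proof. by have [] := Lspc_funP phi. Qed.

Lemma rnorm_Lmul (phi : Li) (f : L) : rnorm (Lmul phi f) <= supnorm phi * rnorm f.
Proof.
apply: rnorm_le; first by rewrite mulr_ge0 ?supnorm_ge0 ?rnorm_ge0.
rewrite exprMn EFinM rnorm_sqr.
have mf := Lspc_cmeasurable f; have mphi := Li_cmeasurable phi.
rewrite /sqint -ge0_integralZl//; last 3 first.
- exact: measurable_normc_sqr.
- by move=> x _; rewrite lee_fin sqr_ge0.
- by rewrite lee_fin sqr_ge0.
apply: ae_ge0_le_integral => //.
- by move=> x _; rewrite lee_fin sqr_ge0.
- by apply: measurable_normc_sqr; exact: Lspc_cmeasurable.
- by move=> x _; rewrite mule_ge0// lee_fin sqr_ge0.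
- by apply: measurable_funeM; exact: measurable_normc_sqr.
- apply: filterS2 (LmulE phi f) (normc_le_supnorm phi) => x -> h _.
  rewrite normcM exprMn EFinM lee_wpmul2r ?lee_fin ?sqr_ge0//.
  by rewrite ler_pXn2r ?nnegrE ?normc_ge0 ?supnorm_ge0.
Qed.

Lemma Lmul_linear (phi : Li) : linear (@Lmul _ _ _ mu 2%:E (lee1n 2) phi).
Proof.
move=> a f g; apply: Lspc_eq; near=> x.
rewrite (near (LmulE phi (a *: f + g)) x)//.
rewrite (near (LspcDE (a *: f) g) x)// (near (LspcZE a f) x)//.
rewrite (near (LspcDE (a *: Lmul phi f) (Lmul phi g)) x)//.
rewrite (near (LspcZE a (Lmul phi f)) x)//.
rewrite (near (LmulE phi f) x)// (near (LmulE phi g) x)//.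
by rewrite mulrDr mulrCA.
Unshelve. all: by end_near. Qed.

Lemma Lmul_bounded_linear (phi : Li) :
  bounded_linear (@Lmul _ _ _ mu 2%:E (lee1n 2) phi).
Proof. exact: bounded_linear_rnorm (Lmul_linear phi) (rnorm_Lmul phi). Qed.

Lemma Lmul_linearl (a : R[i]) (phi psi : Li) (f : L) :
  Lmul (a *: phi + psi) f = a *: Lmul phi f + Lmul psi f.
Proof.
apply: Lspc_eq; near=> x.
rewrite (near (LmulE (a *: phi + psi) f) x)//.
rewrite (near (LspcDE (a *: phi) psi) x)// (near (LspcZE a phi) x)//.
rewrite (near (LspcDE (a *: Lmul phi f) (Lmul psi f)) x)//.
rewrite (near (LspcZE a (Lmul phi f)) x)//.
rewrite (near (LmulE phi f) x)// (near (LmulE psi f) x)//.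
by rewrite mulrDl mulrA.
Unshelve. all: by end_near. Qed.

Lemma LmulA (phi psi : Li) (f : L) : Lmul (Lmul phi psi) f = Lmul phi (Lmul psi f).
Proof.
apply: Lspc_eq; near=> x.
rewrite (near (LmulE (Lmul phi psi) f) x)// (near (LmulE phi psi) x)//.
rewrite (near (LmulE phi (Lmul psi f)) x)// (near (LmulE psi f) x)//.
by rewrite mulrA.
Unshelve. all: by end_near. Qed.

End multiplication_operator.

(** * Reflection, translation and Fourier inversion *)

Section fourier_inversion.
Variable R : realType.
Local Notation leb := (@lebesgue_measure R).
Local Notation cls := (Lcls leb (lee1n 2)).

Section composition_with_measure_preserving.
Variable psi : measurableTypeR R -> measurableTypeR R.
Hypothesis pspsi : measure_preserving psi.

Definition mp_comp (f : L2 R) : L2 R := cls (fun x => f (psi x)).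

Let mc : cmeasurable (fun _ : measurableTypeR R => 1 : R[i]).
Proof. exact: cmeasurable_cst. Qed.

Let ae_psi (P : measurableTypeR R -> Prop) : (\forall x \ae leb, P x) ->
  \forall y \ae leb, (1 : R[i]) != 0 -> P (psi y).
Proof. by move/(ae_measure_preserving pspsi); apply: filterS. Qed.

Let sqint_psi (f : measurableTypeR R -> R[i]) : cmeasurable f ->
  (sqint leb (fun y => 1 * f (psi y))%R <= sqint leb f)%E.
Proof.
move=> mf; rewrite le_eqVlt; apply/orP; left; apply/eqP.
rewrite /sqint; under eq_integral do rewrite mul1r.
apply: (integral_measure_preserving pspsi (f := fun x => (normc (f x) ^+ 2)%:E)).
exact: measurable_normc_sqr.
Qed.

Let mp_compE0 : mp_comp = weighted_comp leb (fun=> 1) psi.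
Proof. by apply/funext => f; congr Lcls; apply/funext => x; rewrite mul1r. Qed.

Lemma mp_comp_bounded_linear : bounded_linear mp_comp.
Proof.
rewrite mp_compE0; apply: bounded_linear_weighted_comp => //.
by case: pspsi.
Qed.

Lemma mp_compE (f : L2 R) (g : R -> R[i]) : (\forall x \ae leb, f x = g x) ->
  \forall x \ae leb, mp_comp f x = g (psi x).
Proof.
have [mpsi _] := pspsi.
rewrite mp_compE0 => /(weighted_comp_ae mc mpsi ae_psi sqint_psi).
by apply: filterS => x; rewrite mul1r.
Qed.

Lemma cL1_mp f : cL1 f -> cL1 (fun x => f (psi x)).
Proof.
have [mpsi _] := pspsi.
move=> [mf lf]; split; first exact: cmeasurable_comp.
rewrite (integral_measure_preserving pspsi (f := fun x => (normc (f x))%:E))//.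
exact: cmeasurable_normcE.
Qed.

Lemma L12_mp f : L12 f -> L12 (fun x => f (psi x)).
Proof.
move=> [L1f /cLfun2P[mf lf]]; split; first exact: cL1_mp.
have [mpsi _] := pspsi.
apply/cLfun2P; split; first exact: cmeasurable_comp.
have := sqint_psi mf; rewrite /sqint; under eq_integral do rewrite mul1r.
by move=> /le_lt_trans; apply.
Qed.

Lemma mp_comp_cls f : L12 f -> mp_comp (cls f) = cls (fun x => f (psi x)).
Proof.
move=> Lf; have Lfp := L12_mp Lf; apply: Lspc_eq.
by apply: filterS2 (mp_compE (L12_cls Lf)) (L12_cls Lfp) => x -> ->.
Qed.

End composition_with_measure_preserving.

Lemma reflectionE : @reflection R 2%:E (lee1n 2) = mp_comp (fun x => - x).
Proof. by []. Qed.

Lemma reflection_bounded_linear :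
  bounded_linear (@reflection R 2%:E (lee1n 2)).
Proof. by rewrite reflectionE; apply: mp_comp_bounded_linear; exact: measure_preserving_opp. Qed.

Lemma reflection_ae (f : L2 R) (g : R -> R[i]) : (\forall x \ae leb, f x = g x) ->
  \forall x \ae leb, reflection f x = g (- x).
Proof. by rewrite reflectionE; apply: mp_compE; exact: measure_preserving_opp. Qed.

Lemma reflectionK (f : L2 R) : reflection (reflection f) = f.
Proof.
apply: Lspc_eq.
have h : \forall x \ae leb, reflection f x = f (- x) by apply: reflection_ae; exact: nearW.
by apply: filterS (reflection_ae h) => x ->; rewrite opprK.
Qed.

Definition translation (l : R) (f : L2 R) : L2 R := cls (fun x => f (x - l)).

Lemma translationE l : translation l = mp_comp (fun x => x + - l).
Proof. by []. Qed.

Lemma translation_bounded_linear l : bounded_linear (translation l).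
Proof. by rewrite translationE; apply: mp_comp_bounded_linear; exact: measure_preserving_shift. Qed.

Lemma translation_ae l (f : L2 R) (g : R -> R[i]) : (\forall x \ae leb, f x = g x) ->
  \forall x \ae leb, translation l f x = g (x - l).
Proof. by rewrite translationE; apply: mp_compE; exact: measure_preserving_shift. Qed.

Lemma translationD l m (f : L2 R) : translation l (translation m f) = translation (l + m) f.
Proof.
apply: Lspc_eq.
have h : \forall x \ae leb, translation m f x = f (x - m) by apply: translation_ae; exact: nearW.
have h' : \forall x \ae leb, translation (l + m) f x = f (x - (l + m)) by apply: translation_ae; exact: nearW.
by apply: filterS2 (translation_ae l h) h' => x -> ->; rewrite opprD addrA.
Qed.

Lemma translation0 (f : L2 R) : translation 0 f = f.
Proof.
apply: Lspc_eq; apply: filterS (@translation_ae 0 f f _) => [x ->|]; first by rewrite subr0.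
exact: nearW.
Qed.

Lemma fourier_reflection (f : L2 R) : fourier (reflection f) = reflection (fourier f).
Proof.
have bF := fourier_bounded_linear R; have bJ := reflection_bounded_linear.
apply: (bounded_linear_dense (bounded_linear_comp bF bJ) (bounded_linear_comp bJ bF)) => g Lg /=.
have Lgp := L12_mp (measure_preserving_opp R) Lg.
rewrite reflectionE (mp_comp_cls (measure_preserving_opp R) Lg) !fourierE// -reflectionE.
apply: Lspc_eq; apply: filterS2 (fourier_L12E Lgp) (reflection_ae (fourier_L12E Lg)) => x -> ->.
by rewrite fourier_integral_opp//; case: Lg.
Qed.

Lemma cLfun_expi (l : R) : cLfun leb +oo%E (fun x : measurableTypeR R => expi (l * x)).
Proof.
split; first exact: cmeasurable_expi.
rewrite /cLnorm unlock /Lnorm; case: ifPn => // _.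
apply: (@le_lt_trans _ _ 1%:E); last exact: ltry.
apply/ess_supP; apply: nearW => x /=.
by rewrite -[Num.sqrt _]/(normc (expi (l * x))) normc_expi normr1.
Qed.

Lemma e_E (l : R) : \forall x \ae leb, e_ l x = expi (l * x).
Proof. by apply: LclsE; exact: cLfun_expi. Qed.

(** With the kernel e^{i xi x}, a shift to the right by l produces the factor e^{i l xi}. This sign
    convention makes the symbols e_l with l <= 0 act as shifts to the left. *)
Lemma fourier_translation l (f : L2 R) :
  fourier (translation l f) = Lmul (e_ l) (fourier f).
Proof.
have bF := fourier_bounded_linear R; have bT := translation_bounded_linear l.
have bM := Lmul_bounded_linear (e_ l).
apply: (bounded_linear_dense (bounded_linear_comp bF bT) (bounded_linear_comp bM bF)) => g Lg /=.
have Lgp := L12_mp (measure_preserving_shift (- l)) Lg.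
rewrite translationE (mp_comp_cls (measure_preserving_shift (- l)) Lg) !fourierE//.
apply: Lspc_eq; near=> x.
rewrite (near (LmulE (e_ l) (fourier_L12 g)) x)// (near (e_E l) x)//.
rewrite (near (fourier_L12E Lg) x)// (near (fourier_L12E Lgp) x)//.
have [L1g _] := Lg.
rewrite /fourier_integral -cintegralZ; last exact: cL1_expi.
rewrite -(cintegral_measure_preserving (measure_preserving_shift l)).
  apply: eq_cintegral => y; rewrite addrK mulrA -expiD; congr (expi _ * _); ring.
by have [] := cL1_expi x Lgp.1.
Unshelve. all: by end_near. Qed.

Lemma bform_reflection (f g : L2 R) : bform (reflection f) g = bform f (reflection g).
Proof.
have mf := Lspc_cmeasurable f; have mg := Lspc_cmeasurable g.
have [mo _] := measure_preserving_opp R.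
have E (h : L2 R) : \forall x \ae leb, reflection h x = h (- x).
  by apply: reflection_ae; exact: nearW.
rewrite (bform_ae (f' := fun x => f (- x)) (g' := g) _ _ (E f))//; last 2 first.
- exact: cmeasurable_comp.
- exact: nearW.
rewrite (bform_ae (f' := f) (g' := fun x => g (- x)) _ _ _ (E g))//; last 2 first.
- exact: cmeasurable_comp.
- exact: nearW.
rewrite -(cintegral_measure_preserving (measure_preserving_opp R)).
  by apply: eq_cintegral => x; rewrite opprK.
by apply: cmeasurableM => //; exact: cmeasurable_comp.
Qed.

(** The multiplication formula, extended by density in one argument at a time. *)
Lemma bform_fourier (f g : L2 R) : bform (fourier f) g = bform f (fourier g).
Proof.
have bF := fourier_bounded_linear R.
suff H g' : L12 g' -> forall f : L2 R, bform (fourier f) (cls g') = bform f (fourier (cls g')).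
  apply: (bounded_linear_dense (bform_bounded_linear_r (fourier f))
    (bounded_linear_comp (bform_bounded_linear_r f) bF)) => g' Lg' /=.
  exact: H.
move=> Lg'; apply: (bounded_linear_dense
  (bounded_linear_comp (bform_bounded_linear (cls g')) bF)
  (bform_bounded_linear (fourier (cls g')))) => f' Lf' /=.
have [[mf' _] _] := Lf'; have [[mg' _] _] := Lg'.
rewrite !fourierE//.
rewrite (bform_ae _ _ (fourier_L12E Lf') (L12_cls Lg'))//; last first.
  by apply: cmeasurable_fourier_integral; case: Lf'.
rewrite (bform_ae _ _ (L12_cls Lf') (fourier_L12E Lg'))//; last first.
  by apply: cmeasurable_fourier_integral; case: Lg'.
rewrite [RHS]multiplication_formula; [|by case: Lf'|by case: Lg'].
by apply: eq_cintegral => x; rewrite mulrC.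
Qed.

(** Density lifts [fourier_itv_indic] to all f in L^2 while the interval stays fixed. *)
Lemma bform_fourier_itv (f : L2 R) (a b : R) : a < b ->
  bform (fourier f) (fourier (cls (itv_indic a b))) =
  (2 * pi)%:C * bform (reflection f) (cls (itv_indic a b)).
Proof.
move=> ab; have bF := fourier_bounded_linear R; have bJ := reflection_bounded_linear.
have Li : L12 (itv_indic a b) by split; [exact: cL1_itv_indic|exact: cLfun_itv_indic].
pose G := cls (itv_indic a b).
apply: (bounded_linear_dense
  (bounded_linear_comp (bform_bounded_linear (fourier G)) bF)
  (bounded_linearZ (2 * pi)%:C (bounded_linear_comp (bform_bounded_linear G) bJ))) => g Lg /=.
rewrite bform_reflection /G.
have [L1g L2g] := Lg; have [mg _] := L1g; have [L1i _] := Li; have [mi _] := L1i.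
have [mo _] := measure_preserving_opp R.
rewrite !fourierE// (bform_ae _ _ (fourier_L12E Lg) (fourier_L12E Li)); last 2 first.
- exact: cmeasurable_fourier_integral.
- exact: cmeasurable_fourier_integral.
rewrite (bform_ae (g' := fun x => itv_indic a b (- x)) _ _ (L12_cls Lg) (reflection_ae (L12_cls Li)))//.
  exact: fourier_itv_indic.
exact: cmeasurable_comp.
Qed.

(* Boundedness of the Fourier transformation and this identity replace
   Plancherel's theorem; the isometry is never needed. *)
Lemma fourier_fourier (f : L2 R) : fourier (fourier f) = (2 * pi)%:C *: reflection f.
Proof.
apply/eqP; rewrite -subr_eq0; apply/eqP; apply: bform_itv_eq0 => a b ab.
have [lB _] := bform_bounded_linear (cls (itv_indic a b)).
rewrite (linear_linB _ _ lB) (linear_linZ _ _ lB).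
by rewrite bform_fourier bform_fourier_itv// subrr.
Qed.

Lemma pi2_neq0 : (2 * pi)%:C != 0 :> R[i].
Proof. by rewrite fmorph_eq0 mulf_neq0// gt_eqF// pi_gt0. Qed.

Lemma fourier_left_inverse (f : L2 R) :
  reflection ((2 * pi)%:C^-1 *: fourier (fourier f)) = f.
Proof.
rewrite (fourier_fourier f) scalerA mulVf ?pi2_neq0// scale1r.
exact: reflectionK.
Qed.

Lemma fourier_inj : injective (@fourier R).
Proof.
move=> f g fg.
have h := congr1 (fun u => reflection ((2 * pi)%:C^-1 *: fourier u)) fg.
exact: (etrans (esym (fourier_left_inverse f)) (etrans h (fourier_left_inverse g))).
Qed.

Lemma fourier_surj (g : L2 R) :
  fourier ((2 * pi)%:C^-1 *: reflection (fourier g)) = g.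
Proof.
have [lF _] := fourier_bounded_linear R; have [lJ _] := reflection_bounded_linear.
rewrite (linear_linZ _ _ lF) fourier_reflection fourier_fourier.
by rewrite (linear_linZ _ _ lJ) reflectionK scalerA mulVf ?pi2_neq0// scale1r.
Qed.

(** [xget] returns its default 0 on an empty set; surjectivity of [fourier] excludes this. *)
Lemma inverse_fourierK (g : L2 R) : fourier (inverse_fourier g) = g.
Proof.
suff : [set f | fourier f = g] (inverse_fourier g) by [].
by apply: xgetPex; eexists; exact: fourier_surj.
Qed.

Lemma inverse_fourierE (g : L2 R) :
  inverse_fourier g = (2 * pi)%:C^-1 *: reflection (fourier g).
Proof. by apply: fourier_inj; rewrite inverse_fourierK fourier_surj. Qed.

Lemma fourierK (f : L2 R) : inverse_fourier (fourier f) = f.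
Proof. by apply: fourier_inj; rewrite inverse_fourierK. Qed.

Lemma inverse_fourier_bounded_linear : bounded_linear (@inverse_fourier R).
Proof.
rewrite (_ : @inverse_fourier R = fun g => (2 * pi)%:C^-1 *: reflection (fourier g)).
  apply: bounded_linearZ; apply: (bounded_linear_comp reflection_bounded_linear).
  exact: fourier_bounded_linear.
by apply/funext => g; exact: inverse_fourierE.
Qed.

End fourier_inversion.

(** * One-sided inverses and Fredholm properties *)

Section fredholm_theory.
Variable R : realType.
Implicit Types X Y : normedModType R[i].

Definition linearly_independent X (x : nat -> X) :=
  forall n (a : 'I_n -> R[i]), \sum_(k < n) a k *: x k = 0 -> forall k, a k = 0.

(** A relation among the [x k] is mapped by [B] to the same relation among the [y k]. This
    transports an explicit independent family through the invertible outer factors. *)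
Lemma linearly_independent_lift X Y (B : X -> Y) (x : nat -> X) (y : nat -> Y) :
  linear B -> (forall k, B (x k) = y k) ->
  linearly_independent y -> linearly_independent x.
Proof.
move=> lB Bx iy n a ax; apply: iy; have := congr1 B ax.
rewrite (linear_lin0 lB) (linear_lin_sum a (fun k => x k) lB) => h; rewrite -[RHS]h.
by apply: eq_bigr => k _; rewrite Bx.
Qed.

(** If n vectors spanned the kernel, the coordinates of n + 1 of the [x k] would form an (n+1) by n
    matrix, whose rows are dependent. *)
Lemma not_finite_nullity X Y (T : X -> Y) (x : nat -> X) :
  (forall k, T (x k) = 0) -> linearly_independent x -> ~ finite_nullity T.
Proof.
move=> Tx ix [n [v [_ vT]]].
have [c xc] := choice (fun k => vT (x k) (Tx k)).
pose C : 'M[R[i]]_(n.+1, n) := \matrix_(k, i) c k i.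
have : kermx C != 0.
  rewrite kermx_eq0 /row_free neq_ltn; apply/orP; left.
  by rewrite ltnS rank_leq_col.
move=> /rowV0Pn[a /sub_kermxP aC a0].
have : \sum_(k < n.+1) a 0 k *: x k = 0.
  transitivity (\sum_(k < n.+1) \sum_(i < n) (a 0 k * C k i) *: v i).
    apply: eq_bigr => k _; have /eqP := xc k; rewrite subr_eq0 => /eqP ->.
    by rewrite scaler_sumr; apply: eq_bigr => i _; rewrite scalerA mxE.
  rewrite exchange_big/= big1// => i _; rewrite -scaler_suml.
  have : (a *m C) 0 i = 0 by rewrite aC mxE.
  by rewrite mxE => ->; rewrite scale0r.
move/(ix _ (fun k => a 0 k)) => az; case/eqP: a0.
by apply/rowP => k; rewrite az mxE.
Qed.

(** Near a point x of the closure there is z with B z = 0, and |B x| = |B (x - z)| <= M |x - z| is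
    arbitrarily small. *)
Lemma closed_kernel X Y (B : X -> Y) : bounded_linear B -> closed [set x | B x = 0].
Proof.
move=> /bounded_linear_pos[lB [M M0 BM]] x xcl /=.
apply/eqP; rewrite -normr_eq0; apply/eqP.
have [b bE] : exists b : R, `|B x| = b%:C.
  exists (complex.Re `|B x|); have := normr_ge0 (B x); case: `|_| => a b /=.
  by rewrite lecE/= => /andP[/eqP -> _].
have b0 : 0 <= b by rewrite -lecR -bE normr_ge0.
rewrite bE; congr (_%:C); apply/eqP; rewrite eq_le b0 andbT.
apply/ler_addgt0Pr => e e0; rewrite add0r.
have d0 : 0 < e / (M + 1) by rewrite divr_gt0// ltr_wpDl.
have [] := xcl (ball x (e / (M + 1))%:C).
  by apply: nbhsx_ballx; rewrite ltcR.
move=> z [/= Bz0]; rewrite -ball_normE/= => xz.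
rewrite -lecR -bE -[B x]subr0 -Bz0 -(linear_linB _ _ lB).
rewrite (le_trans (BM _))// (le_trans (ler_wpM2l _ (ltW xz))) ?lecR//.
rewrite -rmorphM lecR mulrCA ler_piMr ?(ltW e0)//.
by rewrite ler_pdivrMr ?ltr_wpDl// mul1r lerDl.
Qed.

Lemma right_invertible_Fredholm X Y (T : X -> Y) (S : Y -> X) :
  bounded_linear T -> bounded_linear S -> cancel S T -> ~ finite_nullity T ->
  properly_right_Fredholm T /\ right_invertible T.
Proof.
move=> bT bS ST nT.
have rT : range T = setT by apply/seteqP; split => // y _; exists (S y).
split; last by split => //; exists S.
split => //.
- by split => //; rewrite rT; exact: closedT.
(* [T] is onto, so the empty family already spans the quotient by its range. *)
- exists 0%N, (fun=> 0); split => // y _; exists (fun=> 0).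
  by rewrite rT.
Qed.

(** The range of [T] is the kernel of T S - 1, hence closed. The projection 1 - T S has range ker S,
    so ker S is a copy of the cokernel of [T] and infinite nullity of [S] is infinite deficiency of
    [T]. *)
Lemma left_invertible_Fredholm X Y (T : X -> Y) (S : Y -> X) :
  bounded_linear T -> bounded_linear S -> cancel T S -> ~ finite_nullity S ->
  properly_left_Fredholm T /\ left_invertible T.
Proof.
move=> bT bS TS nS; have [lT _] := bT; have [lS _] := bS.
have bP : bounded_linear (fun y => T (S y) + (-1) *: y).
  apply: bounded_linearD; first exact: bounded_linear_comp.
  exact: bounded_linearZ (bounded_linear_id _).
split; last by split => //; exists S.
split.
- split => //; rewrite (_ : range T = [set y | T (S y) + (-1) *: y = 0]).
    exact: closed_kernel bP.
  apply/seteqP; split => [_ [x _ <-]|y] /=; first by rewrite TS scaleN1r subrr.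
  by rewrite scaleN1r => /eqP; rewrite subr_eq0 => /eqP h; exists (S y).
- exists 0%N, (fun=> 0); split => [_ /=|x /= Tx]; first exact: linear_lin0 lT.
  exists (fun=> 0).
  by rewrite big_ord0 subr0 -(TS x) Tx (linear_lin0 lS).
- move=> [n [v [_ vT]]]; apply: nS.
  (* The projection 1 - T S sends a family spanning the quotient to one spanning ker S: it kills the
     range of [T] and fixes ker S. *)
  exists n, (fun i => v i - T (S (v i))); split => [i|y Sy] /=.
    by rewrite (linear_linB _ _ lS) TS subrr.
  have [c [x _ Tx]] := vT y I; exists c => /=.
  have lP : linear (fun y => y - T (S y)).
    move=> a u w; rewrite lS lT scalerBr opprD addrACA; reflexivity.
  have h : y - \sum_(i < n) c i *: v i - T (S (y - \sum_(i < n) c i *: v i)) = 0.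
    by rewrite -Tx TS subrr.
  rewrite -[RHS]h (linear_linB _ _ lP) (linear_lin_sum c v lP).
  by congr (_ - _); rewrite Sy (linear_lin0 lT) subr0.
Qed.

End fredholm_theory.

(** * Fourier multipliers *)

Section fourier_multipliers.
Variable R : realType.
Local Notation leb := (@lebesgue_measure R).
Local Notation cls := (Lcls leb (lee1n 2)).
Implicit Types (phi psi : Linf R) (f g : L2 R).

Definition multiplier phi f : L2 R := inverse_fourier (Lmul phi (fourier f)).

Lemma multiplier_bounded_linear phi : bounded_linear (multiplier phi).
Proof.
apply: (bounded_linear_comp (inverse_fourier_bounded_linear R)).
exact: (bounded_linear_comp (Lmul_bounded_linear phi) (fourier_bounded_linear R)).
Qed.

(** Continuity in the symbol is what carries a property of the operators from generators to limits
    of symbols. *)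
Lemma multiplier_bounded_linearl f :
  bounded_linear (fun phi : Linf R => multiplier phi f).
Proof.
apply: (bounded_linear_comp (inverse_fourier_bounded_linear R)
  (T := fun phi : Linf R => Lmul phi (fourier f) : L2 R)).
apply: (bounded_linearI (M := rnorm (fourier f))) => [a phi psi|phi].
  exact: Lmul_linearl.
rewrite normE_rnorm normE_supnorm -rmorphM lecR mulrC; exact: rnorm_Lmul.
Qed.

Lemma multiplierM phi psi f :
  multiplier (Lmul phi psi) f = multiplier phi (multiplier psi f).
Proof. by rewrite /multiplier inverse_fourierK LmulA. Qed.

Lemma cLfun_cst1 : cLfun leb +oo%E (fun _ : measurableTypeR R => 1).
Proof.
split; first exact: cmeasurable_cst.
rewrite /cLnorm unlock /Lnorm; case: ifPn => // _.
apply: (@le_lt_trans _ _ 1%:E); last exact: ltry.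
by apply/ess_supP; apply: nearW => x; rewrite /comp normc1 /= normr1.
Qed.

Lemma multiplier1 f : multiplier (Linf1 R) f = f.
Proof.
rewrite /multiplier (_ : Lmul (Linf1 R) (fourier f) = fourier f); first exact: fourierK.
apply: Lspc_eq.
apply: filterS2 (LmulE (Linf1 R) (fourier f)) (LclsE (leey 1) cLfun_cst1) => x -> h.
by rewrite [Linf1 R x]h mul1r.
Qed.

Lemma multiplier_e (l : R) f : multiplier (e_ l) f = translation l f.
Proof. by rewrite /multiplier -fourier_translation fourierK. Qed.

Lemma Linf_mulC phi psi : Lmul phi psi = Lmul psi phi.
Proof.
apply: Lspc_eq; apply: filterS2 (LmulE phi psi) (LmulE psi phi) => x -> ->.
exact: mulrC.
Qed.

Lemma reflection_LinfE phi : \forall x \ae leb, reflection phi x = phi (- x).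
Proof.
apply: LclsE; have [mo _] := measure_preserving_opp R.
have m1 : cmeasurable (fun x : measurableTypeR R => phi (- x)).
  have h := Li_cmeasurable phi.
  exact: (cmeasurable_comp h mo).
split => //; rewrite /cLnorm unlock /Lnorm; case: ifPn => // _.
apply: (@le_lt_trans _ _ (supnorm phi)%:E); last exact: ltry.
apply/ess_supP.
apply: filterS (ae_measure_preserving (measure_preserving_opp R) (normc_le_supnorm phi)) => x h.
by rewrite /comp /= lee_fin ger0_norm ?normc_ge0.
Qed.

Lemma multiplier_reflection phi f : reflection phi = phi ->
  multiplier phi (reflection f) = reflection (multiplier phi f).
Proof.
move=> phi_even; rewrite /multiplier fourier_reflection.
apply: fourier_inj; rewrite fourier_reflection !inverse_fourierK.
have E : \forall x \ae leb, reflection (fourier f) x = fourier f (- x).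
  by apply: reflection_ae; exact: nearW.
have E' : \forall x \ae leb, reflection (Lmul phi (fourier f)) x =
    phi (- x) * fourier f (- x).
  apply: (reflection_ae (g := fun x => phi x * fourier f x)); exact: LmulE.
apply: Lspc_eq; near=> x.
rewrite (near (LmulE phi (reflection (fourier f))) x)//.
rewrite (near E x)// (near E' x)//; congr (_ * _).
by rewrite -{1}phi_even; near: x; exact: reflection_LinfE.
Unshelve. all: by end_near. Qed.

Lemma multiplier_inverse phi psi : Lmul phi psi = Linf1 R ->
  (forall f, multiplier phi (multiplier psi f) = f) /\
  (forall f, multiplier psi (multiplier phi f) = f).
Proof.
move=> h; split=> f; rewrite -multiplierM; last rewrite Linf_mulC.
  by rewrite h multiplier1.
by rewrite h multiplier1.
Qed.

(** Commutation with J passes from an invertible operator to its inverse; evenness of [psi] itself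
    is never computed. *)
Lemma multiplier_inverse_reflection phi psi f : reflection phi = phi ->
  Lmul phi psi = Linf1 R ->
  multiplier psi (reflection f) = reflection (multiplier psi f).
Proof.
move=> phi_even /multiplier_inverse[hl hr].
have h := multiplier_reflection (multiplier psi f) phi_even.
have h2 : reflection f = multiplier phi (reflection (multiplier psi f)).
  by rewrite h; congr reflection; rewrite hl.
by rewrite h2; exact: hr.
Qed.

End fourier_multipliers.

(** * Operators on the half-line *)

Section half_line_operators.
Variable R : realType.
Local Notation leb := (@lebesgue_measure R).
Local Notation nu := (mrestr leb (@measurable_half_line R)).
Local Notation cls := (Lcls leb (lee1n 2)).
Local Notation Y := (L2_half_line R).

Let D : set (measurableTypeR R) := @half_line R.
Let mD : measurable D. Proof. exact: measurable_half_line. Qed.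

(** Elements of [L2_half_line] are classes of functions on the whole line for a measure carried by
    the half-line, so the complement of the half-line is one more null set. *)
Lemma ae_half_lineP (P : measurableTypeR R -> Prop) :
  (\forall x \ae nu, P x) <-> (\forall x \ae leb, D x -> P x).
Proof.
split => [[A [mA A0 PA]]|[A [mA A0 PA]]].
  exists (A `&` D); split => //; first exact: measurableI.
  move=> x /= /not_implyP[Dx Px]; split => //; exact: PA.
exists (A `|` ~` D); split.
- by apply: measurableU => //; exact: measurableC.
- rewrite /mrestr setIUl setICl setU0; apply/eqP; rewrite eq_le measure_ge0 andbT.
  rewrite -[leRHS]A0; apply: le_measure; rewrite ?inE//; exact: measurableI.
- move=> x /= Px; have [Dx|] := pselect (D x); last by right.
  by left; apply: PA => /= h; apply: Px; exact: h.
Qed.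

Lemma integral_half_line (h : measurableTypeR R -> \bar R) :
  measurable_fun setT h -> (forall x, (0 <= h x)%E) ->
  (\int[leb]_x h x = \int[nu]_x h x + \int[mrestr leb (measurableC mD)]_x h x)%E.
Proof.
move=> mh h0.
rewrite -ge0_integral_measure_add//.
apply: eq_measure_integral => A mA _ /=.
rewrite /msum/= big_ord_recl big_ord1/= /mrestr -measureU//.
- by rewrite -setIUr setUv setIT.
- exact: measurableI.
- by apply: measurableI => //; exact: measurableC.
- by rewrite setIACA setICr setI0.
Qed.

Lemma restriction_sqint (f : measurableTypeR R -> R[i]) : cmeasurable f ->
  (sqint nu (fun y => 1 * f y)%R <= sqint leb f)%E.
Proof.
move=> mf; rewrite /sqint; under eq_integral do rewrite mul1r.
rewrite [leRHS]integral_half_line.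
- by rewrite leeDl// integral_ge0// => x _; rewrite lee_fin sqr_ge0.
- exact: measurable_normc_sqr.
- by move=> x; rewrite lee_fin sqr_ge0.
Qed.

Lemma restrictionE : @restriction R = weighted_comp nu (fun=> 1) id.
Proof. by apply/funext => f; congr Lcls; apply/funext => x; rewrite mul1r. Qed.

Lemma restriction_ae_psi (P : measurableTypeR R -> Prop) : (\forall x \ae leb, P x) ->
  \forall y \ae nu, (1 : R[i]) != 0 -> P y.
Proof. by move=> h; apply/ae_half_lineP; apply: filterS h. Qed.

Lemma restriction_bounded_linear : bounded_linear (@restriction R).
Proof.
rewrite restrictionE; apply: bounded_linear_weighted_comp.
- exact: cmeasurable_cst.
- exact: measurable_id.
- exact: restriction_ae_psi.
- exact: restriction_sqint.
Qed.

Lemma restriction_ae (f : L2 R) (g : R -> R[i]) : (\forall x \ae leb, f x = g x) ->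
  \forall x \ae leb, D x -> restriction f x = g x.
Proof.
move=> fg; apply/ae_half_lineP; rewrite restrictionE.
have := weighted_comp_ae (cmeasurable_cst _ _) (@measurable_id _ _ _) restriction_ae_psi restriction_sqint fg.
by apply: filterS => x ->; rewrite mul1r.
Qed.

Definition half_line_indic (x : measurableTypeR R) : R[i] := (\1_D x : R)%:C.

Lemma half_line_indicT x : D x -> half_line_indic x = 1.
Proof. by move=> Dx; rewrite /half_line_indic indicE mem_set. Qed.

Lemma half_line_indicF x : ~ D x -> half_line_indic x = 0.
Proof. by move=> Dx; rewrite /half_line_indic indicE memNset. Qed.

Lemma cmeasurable_half_line_indic : cmeasurable half_line_indic.
Proof. by apply: cmeasurable_real; exact: measurable_indic. Qed.

(** The indicator erases the values of a representative off the half-line, which are arbitrary. *)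
Definition zero_extension : Y -> L2 R := weighted_comp leb half_line_indic id.

Lemma extension_ae_psi (P : measurableTypeR R -> Prop) : (\forall x \ae nu, P x) ->
  \forall y \ae leb, half_line_indic y != 0 -> P y.
Proof.
move=> /ae_half_lineP; apply: filterS => x h h0; apply: h; apply: contrapT => Dx.
by rewrite half_line_indicF// eqxx in h0.
Qed.

Lemma extension_sqint (f : measurableTypeR R -> R[i]) : cmeasurable f ->
  (sqint leb (fun y => half_line_indic y * f y)%R <= sqint nu f)%E.
Proof.
move=> mf; have mDf := cmeasurableM cmeasurable_half_line_indic mf.
rewrite [leLHS]integral_half_line; last 2 first.
- exact: measurable_normc_sqr.
- by move=> x; rewrite lee_fin sqr_ge0.
rewrite [X in (_ + X)%E](_ : _ = 0%E) ?adde0.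
  apply: ge0_le_integral => //.
  - by move=> x _; rewrite lee_fin sqr_ge0.
  - exact: measurable_normc_sqr.
  - exact: measurable_normc_sqr.
  - move=> x _; have [Dx|Dx] := pselect (D x).
      by rewrite half_line_indicT// mul1r.
    by rewrite half_line_indicF// mul0r normc0 expr0n lee_fin sqr_ge0.
rewrite (ae_eq_integral (cst 0%E)) ?integral0//.
  exact: measurable_normc_sqr.
exists D; split => //.
  by rewrite [LHS]/(leb (D `&` ~` D)) setICr measure0.
move=> x /= /not_implyP[_ hx]; apply: contrapT => Dx; apply: hx.
by rewrite half_line_indicF// mul0r normc0 expr0n.
Qed.

Lemma zero_extension_bounded_linear : bounded_linear zero_extension.
Proof.
apply: bounded_linear_weighted_comp.
- exact: cmeasurable_half_line_indic.
- exact: measurable_id.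
- exact: extension_ae_psi.
- exact: extension_sqint.
Qed.

Lemma zero_extensionE (f : Y) :
  \forall x \ae leb, zero_extension f x = half_line_indic x * f x.
Proof.
exact: (weighted_compE cmeasurable_half_line_indic (@measurable_id _ _ _) extension_sqint).
Qed.

Lemma restrictionK (y : Y) : restriction (zero_extension y) = y.
Proof.
apply: Lspc_eq; apply/ae_half_lineP.
apply: filterS (restriction_ae (zero_extensionE y)) => x h Dx.
by rewrite h// half_line_indicT// mul1r.
Qed.

Lemma restriction_eq0P (f : L2 R) :
  restriction f = 0 <-> \forall x \ae leb, D x -> f x = 0.
Proof.
have rE : \forall x \ae leb, D x -> restriction f x = f x.
  by apply: restriction_ae; exact: nearW.
split => h.
  have h0 : \forall x \ae leb, D x -> (restriction f) x = 0.
    by apply/ae_half_lineP; rewrite h; exact: Lspc0E.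
  by apply: filterS2 rE h0 => x hx h0x Dx; rewrite -hx// h0x.
apply: Lspc_eq; apply/ae_half_lineP.
have z : \forall x \ae leb, D x -> (0 : Y) x = 0 by apply/ae_half_lineP; exact: Lspc0E.
by apply: filterS3 rE h z => x hx h0x zx Dx; rewrite hx// h0x// zx.
Qed.

Lemma restriction_subK (f : L2 R) :
  restriction (f - zero_extension (restriction f)) = 0.
Proof.
have [lr _] := restriction_bounded_linear.
by rewrite (linear_linB _ _ lr) restrictionK subrr.
Qed.

(** f and Z r f differ by a function vanishing on the half-line, and so do their images under [B]
    there. This removes the cut-off between two factors. *)
Lemma restriction_eqP (B : L2 R -> L2 R) (f : L2 R) : linear B ->
  (forall g, restriction g = 0 -> restriction (B g) = 0) ->
  restriction (B (zero_extension (restriction f))) = restriction (B f).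
Proof.
move=> lB Bneg; have [lr _] := restriction_bounded_linear.
have := Bneg _ (restriction_subK f).
by rewrite (linear_linB _ _ lB) (linear_linB _ _ lr) => /eqP; rewrite subr_eq0 => /eqP.
Qed.

Definition preserves_negative (phi : Linf R) :=
  forall f : L2 R, restriction f = 0 -> restriction (multiplier phi f) = 0.

Lemma translation_negative (l : R) (f : L2 R) : l <= 0 ->
  restriction f = 0 -> restriction (translation l f) = 0.
Proof.
move=> l0 /restriction_eq0P f0; apply/restriction_eq0P.
have tE : \forall x \ae leb, translation l f x = f (x - l).
  by apply: translation_ae; exact: nearW.
apply: filterS2 tE (ae_measure_preserving (measure_preserving_shift (- l)) f0) => x -> h Dx.
apply: h; move: Dx; rewrite /D /half_line /= !in_itv/= !andbT => x0.
by rewrite ltr_wpDr// oppr_ge0.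
Qed.

(** Closedness is the point: the set is the intersection, over f vanishing on the half-line, of the
    kernels of the bounded linear maps phi -> r W(phi) f. *)
Lemma preserves_negative_subalgebra : closed_subalgebra preserves_negative.
Proof.
have br := restriction_bounded_linear; have [lr _] := br.
split.
- rewrite (_ : preserves_negative = \bigcap_(f in [set f : L2 R | restriction f = 0])
      [set phi | restriction (multiplier phi f) = 0]).
    apply: closed_bigI => f _; apply: closed_kernel.
    exact: bounded_linear_comp br (multiplier_bounded_linearl f).
  by apply/seteqP; split => phi h f; exact: h.
- move=> f _; have [lm _] := multiplier_bounded_linearl f.
  by rewrite (linear_lin0 lm) (linear_lin0 lr).
- move=> a phi psi hphi hpsi f f0; have [lm _] := multiplier_bounded_linearl f.
  by rewrite lm lr hphi// hpsi// scaler0 addr0.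
- by move=> phi psi hphi hpsi f f0; rewrite multiplierM; apply/hphi/hpsi.
Qed.

Lemma APminus_preserves_negative (phi : Linf R) : @APminus R phi -> preserves_negative phi.
Proof.
(* Membership in [APminus] quantifies over all closed subalgebras containing the generators; it is
   applied to [preserves_negative]. *)
apply; split; first exact: preserves_negative_subalgebra.
move=> _ [l /= l0 <-] f f0; rewrite multiplier_e; exact: translation_negative.
Qed.

Definition even_extension (y : Y) : L2 R :=
  zero_extension y + reflection (zero_extension y).

Lemma even_extension_bounded_linear : bounded_linear even_extension.
Proof.
apply: bounded_linearD; first exact: zero_extension_bounded_linear.
exact: bounded_linear_comp (reflection_bounded_linear R) zero_extension_bounded_linear.
Qed.

Lemma restriction_reflection_zero_extension (y : Y) :
  restriction (reflection (zero_extension y)) = 0.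
Proof.
apply/restriction_eq0P.
apply: filterS (reflection_ae (zero_extensionE y)) => x ->.
rewrite /D /half_line /= in_itv/= andbT => x0.
rewrite half_line_indicF ?mul0r//= /D /half_line/= in_itv/= andbT.
by apply/negP; rewrite -leNgt oppr_le0 ltW.
Qed.

Lemma even_extensionK (y : Y) : restriction (even_extension y) = y.
Proof.
have [lr _] := restriction_bounded_linear.
by rewrite (linear_linD _ _ lr) restrictionK restriction_reflection_zero_extension addr0.
Qed.

Lemma reflection_even_extension (y : Y) :
  reflection (even_extension y) = even_extension y.
Proof.
have [lJ _] := reflection_bounded_linear R.
by rewrite (linear_linD _ _ lJ) reflectionK addrC.
Qed.

Lemma ae_neq0 : \forall x \ae leb, (x : R) <> 0.
Proof.
exists [set 0]; split => //; first exact: lebesgue_measure_set1.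
by move=> x /= /contrapT ->.
Qed.

Lemma even_extension_restriction (h : L2 R) : reflection h = h ->
  even_extension (restriction h) = h.
Proof.
move=> h_even; apply: Lspc_eq.
pose g x := half_line_indic x * h x.
have zE : \forall x \ae leb, zero_extension (restriction h) x = g x.
  have rE : \forall x \ae leb, D x -> restriction h x = h x.
    by apply: restriction_ae; exact: nearW.
  apply: filterS2 (zero_extensionE (restriction h)) rE => x -> hx.
  have [Dx|Dx] := pselect (D x); first by rewrite hx.
  by rewrite /g half_line_indicF// !mul0r.
have hE : \forall x \ae leb, h x = h (- x).
  have JhE : \forall x \ae leb, reflection h x = h (- x).
    by apply: reflection_ae; exact: nearW.
  by apply: filterS JhE => x <-; rewrite h_even.
have sE := LspcDE (zero_extension (restriction h)) (reflection (zero_extension (restriction h))).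
have JE := reflection_ae zE.
near=> x.
rewrite /even_extension (near sE x)// (near zE x)// (near JE x)// /g.
(* At the origin both halves of the even extension vanish whatever [h] is; this single point is
   excluded as a null set. *)
have : x <> 0 :> R by near: x; exact: ae_neq0.
move/eqP; rewrite neq_lt => /orP[x0|x0].
  rewrite half_line_indicF ?mul0r ?add0r; last first.
    by rewrite /D /half_line/= in_itv/= andbT; apply/negP; rewrite -leNgt ltW.
  rewrite half_line_indicT ?mul1r; last by rewrite /D /half_line/= in_itv/= andbT oppr_gt0.
  by rewrite -(near hE x).
rewrite half_line_indicT ?mul1r; last by rewrite /D /half_line/= in_itv/= andbT.
rewrite half_line_indicF ?mul0r ?addr0//.
by rewrite /D /half_line/= in_itv/= andbT; apply/negP; rewrite -leNgt oppr_le0 ltW.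
Unshelve. all: by end_near. Qed.

Definition L2_plus_restriction (f : L2_plus R) : Y := restriction (val f).

Lemma zero_extension_supp (y : Y) : zero_extension y \in @supp_half_line R.
Proof.
apply/asboolP; apply: filterS (zero_extensionE y) => x -> nz.
apply: subset_closure; apply: contrapT => Dx.
by move/eqP: nz; apply; rewrite half_line_indicF// mul0r.
Qed.

Definition L2_plus_extension (y : Y) : L2_plus R := L2Plus (zero_extension_supp y).

Lemma L2_plus_restriction_bounded_linear : bounded_linear L2_plus_restriction.
Proof.
have [lr rM] := restriction_bounded_linear.
split; last by have [M hM] := rM; exists M => f; exact: hM.
move=> a f g; rewrite /L2_plus_restriction -lr; congr restriction.
Qed.

Lemma L2_plus_extension_bounded_linear : bounded_linear L2_plus_extension.
Proof.
have [lz zM] := zero_extension_bounded_linear.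
split; last by have [M hM] := zM; exists M => f; exact: hM.
move=> a f g; apply: val_inj; exact: (lz a f g).
Qed.

Lemma L2_plus_extensionK : cancel L2_plus_extension L2_plus_restriction.
Proof. by move=> y; exact: restrictionK. Qed.

Lemma closure_half_line : closure (@half_line R) `<=` [set x : R | 0 <= x].
Proof.
rewrite [X in _ `<=` X]((closure_id _).1 (@closed_ge R 0)).
by apply: closure_subset => x; rewrite /half_line /= in_itv/= andbT => /ltW.
Qed.

Lemma L2_plus_restrictionK : cancel L2_plus_restriction L2_plus_extension.
Proof.
move=> f; apply: val_inj; apply: Lspc_eq.
have /asboolP fsupp := L2_plusP f.
have rE : \forall x \ae leb, D x -> restriction (val f) x = (val f : L2 R) x.
  by apply: restriction_ae; exact: nearW.
have zE := zero_extensionE (restriction (val f)).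
near=> x.
rewrite [LHS](near zE x)//.
have [Dx|Dx] := pselect (D x).
  by rewrite half_line_indicT// mul1r; exact: (near rE x).
rewrite half_line_indicF// mul0r; apply/esym/eqP; apply: contrapT => /negP nz.
(* The support condition only places x in the closed half-line; the endpoint 0 is again a null
   set. *)
have : 0 <= (x : R).
  by apply: closure_half_line; move: nz; near: x; exact: fsupp.
rewrite le_eqVlt => /orP[/eqP x0|x0].
  by have : x <> 0 :> R by [near: x; exact: ae_neq0]; rewrite -x0.
by apply: Dx; rewrite /D /half_line /= in_itv/= andbT.
Unshelve. all: by end_near. Qed.

(* the middle factor of the Wiener-Hopf plus Hankel operator with symbol
   [phi_minus * e_l * phi_e] *)
Definition folded_shift (l : R) (y : Y) : Y :=
  restriction (translation l (even_extension y)).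

Lemma folded_shift_bounded_linear l : bounded_linear (folded_shift l).
Proof.
apply: (bounded_linear_comp restriction_bounded_linear).
exact: bounded_linear_comp (translation_bounded_linear l) even_extension_bounded_linear.
Qed.

(** The reflected half lives on the left, and a shift to the left never brings it into the
    half-line. *)
Lemma folded_shift_npos (l : R) (y : Y) : l <= 0 ->
  folded_shift l y = restriction (translation l (zero_extension y)).
Proof.
move=> l0; have [lr _] := restriction_bounded_linear.
have [lt _] := translation_bounded_linear l.
rewrite /folded_shift (linear_linD _ _ lt) (linear_linD _ _ lr).
rewrite [X in _ + X](translation_negative l0) ?addr0//.
exact: restriction_reflection_zero_extension.
Qed.

(** By [folded_shift_npos] the outer operator is r tau Z with tau the left shift by l. As tau
    preserves functions vanishing on the half-line, Z r cancels in the middle; the shifts then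
    cancel and r Q = id remains. *)
Lemma folded_shiftK (l : R) : 0 <= l -> cancel (folded_shift l) (folded_shift (- l)).
Proof.
move=> l0 y; have l0' : - l <= 0 by rewrite oppr_le0.
rewrite folded_shift_npos// /folded_shift.
have [lt _] := translation_bounded_linear (- l).
rewrite (restriction_eqP _ lt); last by move=> g; exact: translation_negative.
by rewrite translationD addNr translation0 even_extensionK.
Qed.

(** A function vanishing beyond l is pushed off the half-line by the left shift of length l. *)
Lemma folded_shift_ker (l : R) (f : L2 R) : 0 < l ->
  (\forall x \ae leb, l < x -> f x = 0) -> folded_shift (- l) (restriction f) = 0.
Proof.
move=> l0 f0; have l0' : - l <= 0 by rewrite oppr_le0 ltW.
rewrite folded_shift_npos//.
have [lt _] := translation_bounded_linear (- l).
rewrite (restriction_eqP _ lt); last by move=> g; exact: translation_negative.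
apply/restriction_eq0P.
have tE : \forall x \ae leb, translation (- l) f x = f (x - - l).
  by apply: translation_ae; exact: nearW.
apply: filterS2 tE (ae_measure_preserving (measure_preserving_shift (- - l)) f0) => x -> h Dx.
apply: h; move: Dx; rewrite /D /half_line /= in_itv/= andbT => x0.
by rewrite opprK ltrDr.
Qed.

End half_line_operators.

(** * An infinite independent family in the kernel of a left shift *)

Section infinite_dimensional_kernel.
Variable R : realType.
Local Notation leb := (@lebesgue_measure R).
Local Notation cls := (Lcls leb (lee1n 2)).

Lemma ae_exists_itv (P : measurableTypeR R -> Prop) (a b : R) : a < b ->
  (\forall x \ae leb, P x) -> exists2 x : R, a <= x <= b & P x.
Proof.
move=> ab [N [mN N0 PN]]; apply: contrapT => h.
have abN : (`[a, b]%classic : set (measurableTypeR R)) `<=` N.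
  move=> x /=; rewrite in_itv/= => xab; apply: PN => /= Px; apply: h.
  by exists x.
have : (leb `[a, b]%classic <= 0)%E.
  by rewrite -N0; apply: le_measure => //; rewrite inE.
by rewrite lebesgue_measure_itv/= lte_fin ab -EFinD lee_fin subr_le0 leNgt ab.
Qed.

Lemma Lspc_sumE n (c : 'I_n -> R[i]) (g : nat -> L2 R)
    (h : nat -> measurableTypeR R -> R[i]) :
  (forall k, \forall x \ae leb, g k x = h k x) ->
  \forall x \ae leb, (\sum_(k < n) c k *: g k : L2 R) x = \sum_(k < n) c k * h k x.
Proof.
move=> gh; elim: n c => [|n IHn] c.
  rewrite big_ord0; apply: filterS (Lspc0E leb (lee1n 2)) => x ->.
  by rewrite big_ord0.
rewrite big_ord_recr /=.
set S := \sum_(i < n) _; have := IHn (fun i => c (widen_ord (leqnSn n) i)).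
rewrite -/S => SE; have gE := gh n.
near=> x; rewrite (near (LspcDE S (c ord_max *: g n)) x)//.
rewrite (near (LspcZE (c ord_max) (g n)) x)// (near SE x)// (near gE x)//.
by rewrite big_ord_recr.
Unshelve. all: by end_near. Qed.

(** Every second interval between consecutive points l/m is used, so the closed intervals do not
    even share endpoints, and all of them lie in (0, l/2]. *)
Definition gap_itv (l : R) (k : nat) : measurableTypeR R -> R[i] :=
  itv_indic (l / (2 * k + 3)%:R) (l / (2 * k + 2)%:R).

Lemma gap_itv_disjoint (l : R) (j k : nat) (x : R) : 0 < l ->
  l / (2 * j + 3)%:R <= x <= l / (2 * j + 2)%:R ->
  gap_itv l k x = (k == j)%:R.
Proof.
move=> l0 xj; rewrite /gap_itv /itv_indic indicE mem_setE in_itv/=.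
have [->|kj] := eqVneq k j; first by rewrite xj.
have sep m m' : (m < m')%N -> l / (2 * m' + 2)%:R < l / (2 * m + 3)%:R.
  move=> mm'; rewrite ltr_pM2l// ltf_pV2 ?posrE ?ltr0n ?addn_gt0 ?orbT//.
  rewrite ltr_nat; lia.
case/andP: xj => xj1 xj2; rewrite (_ : _ && _ = false)//; apply/negP => /andP[xk1 xk2].
move: kj; rewrite neq_ltn => /orP[/sep h|/sep h].
  by have := le_lt_trans (le_trans xk1 xj2) h; rewrite ltxx.
by have := le_lt_trans (le_trans xj1 xk2) h; rewrite ltxx.
Qed.

Lemma gap_itv_lt (l : R) (k : nat) (x : R) : 0 < l -> l < x -> gap_itv l k x = 0.
Proof.
move=> l0 lx; rewrite /gap_itv /itv_indic indicE mem_setE in_itv/=.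
rewrite (_ : _ && _ = false)//; apply/negP => /andP[_ h].
have : l / (2 * k + 2)%:R <= l by rewrite ler_pdivrMr ?ltr0n ?addn_gt0 ?orbT// ler_peMr ?(ltW l0)// ler1n addn_gt0 orbT.
by move=> /(le_trans h); rewrite leNgt lx.
Qed.

Definition gap_family (l : R) (k : nat) : L2_half_line R := restriction (cls (gap_itv l k)).

(** The j-th interval has positive measure, so it contains a point where all the almost-everywhere
    identities hold. There the combination reduces to its j-th coefficient. *)
Lemma gap_family_independent (l : R) : 0 < l -> linearly_independent (gap_family l).
Proof.
move=> l0 n c h j; have [lr _] := restriction_bounded_linear R.
have gE k : \forall x \ae leb, cls (gap_itv l k) x = gap_itv l k x.
  by apply: LclsE; exact: cLfun_itv_indic.
move: h; rewrite -(linear_lin_sum c (fun k : 'I_n => cls (gap_itv l k)) lr).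
move=> /restriction_eq0P S0.
have jl : l / (2 * j + 3)%:R < l / (2 * j + 2)%:R.
  by rewrite ltr_pM2l// ltf_pV2 ?posrE ?ltr0n ?addn_gt0 ?orbT// ltr_nat ltn_add2l.
have SE := @Lspc_sumE n c (fun k => cls (gap_itv l k)) _ gE.
pose S : L2 R := \sum_(k < n) c k *: cls (gap_itv l k).
pose P (x : measurableTypeR R) := (half_line x -> S x = 0) /\
  S x = \sum_(k < n) c k * gap_itv l k x.
have PE : \forall x \ae leb, P x by apply: filterS2 S0 SE => x Sx0 Sx; split.
have [x xj [Sx0 Sx]] := ae_exists_itv jl PE.
have x0 : 0 < x.
  by case/andP: xj => + _; apply: lt_le_trans; rewrite divr_gt0// ltr0n addn_gt0 orbT.
have : \sum_(k < n) c k * gap_itv l k x = 0.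
  by rewrite -Sx; apply: Sx0; rewrite /half_line /= in_itv/= andbT.
rewrite (bigD1 j)//= (gap_itv_disjoint j l0 xj) eqxx mulr1 big1 ?addr0// => k kj.
by rewrite (gap_itv_disjoint k l0 xj) (negbTE (_ : nat_of_ord k != j)) ?mulr0.
Qed.

Lemma folded_shift_gap_family (l : R) (k : nat) : 0 < l ->
  folded_shift (- l) (gap_family l k) = 0.
Proof.
move=> l0; apply: folded_shift_ker => //.
have gE : \forall x \ae leb, cls (gap_itv l k) x = gap_itv l k x.
  by apply: LclsE; exact: cLfun_itv_indic.
by apply: filterS gE => x -> lx; exact: gap_itv_lt.
Qed.

End infinite_dimensional_kernel.

(** * The operator factorization and the conclusion *)

Section factorization.
Variable R : realType.
Local Notation Y := (L2_half_line R).
Implicit Types phi psi : Linf R.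

Definition minus_factor phi (y : Y) : Y :=
  restriction (multiplier phi (zero_extension y)).

Definition even_factor phi (y : Y) : Y :=
  restriction (multiplier phi (even_extension y)).

Lemma minus_factor_bounded_linear phi : bounded_linear (minus_factor phi).
Proof.
apply: (bounded_linear_comp (restriction_bounded_linear R)).
exact: bounded_linear_comp (multiplier_bounded_linear phi) (zero_extension_bounded_linear R).
Qed.

Lemma even_factor_bounded_linear phi : bounded_linear (even_factor phi).
Proof.
apply: (bounded_linear_comp (restriction_bounded_linear R)).
exact: bounded_linear_comp (multiplier_bounded_linear phi) (even_extension_bounded_linear R).
Qed.

(** The cut-off between the two multipliers is absorbed by the left one, which preserves functions
    vanishing on the half-line. *)
Lemma minus_factorK phi psi : preserves_negative phi ->
  (forall f, multiplier phi (multiplier psi f) = f) ->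
  cancel (minus_factor psi) (minus_factor phi).
Proof.
move=> phi_neg phiK y; rewrite /minus_factor.
have [lm _] := multiplier_bounded_linear phi.
by rewrite (restriction_eqP _ lm phi_neg) phiK restrictionK.
Qed.

(** W(psi) sends the even function Q y to an even function, which Q r leaves unchanged. *)
Lemma even_factorK phi psi :
  (forall f : L2 R, multiplier psi (reflection f) = reflection (multiplier psi f)) ->
  (forall f, multiplier phi (multiplier psi f) = f) ->
  cancel (even_factor psi) (even_factor phi).
Proof.
move=> psiJ phiK y; rewrite /even_factor even_extension_restriction; last first.
  by rewrite -psiJ reflection_even_extension.
by rewrite phiK even_extensionK.
Qed.

(** Since f + J f = Q r f on L^2_+, the operator is r W(phi) Q r. Multiplicativity of W splits the
    symbol, and Z r and Q r can then be inserted between the factors. *)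
Lemma wiener_hopf_plus_hankelE phi phi_minus phi_e (l : R) :
  preserves_negative phi_minus -> reflection phi_e = phi_e ->
  phi = Lmul (Lmul phi_minus (e_ l)) phi_e ->
  wiener_hopf_plus_hankel phi = minus_factor phi_minus \o folded_shift l \o
    even_factor phi_e \o (@L2_plus_restriction R).
Proof.
move=> pm_neg pe_even phiE; apply/funext => f /=.
have [lr _] := restriction_bounded_linear R.
have [lm _] := multiplier_bounded_linear phi.
have [lmm _] := multiplier_bounded_linear phi_minus.
have -> : wiener_hopf_plus_hankel phi f =
    restriction (multiplier phi (val f + reflection (val f))).
  by rewrite (linear_linD _ _ lm) (linear_linD _ _ lr).
have -> : val f + reflection (val f) = even_extension (L2_plus_restriction f).
  by rewrite /even_extension -[zero_extension _]/(val (L2_plus_extension _)) L2_plus_restrictionK.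
set y := L2_plus_restriction f.
rewrite phiE !multiplierM multiplier_e.
(* Z r may stand after W(phi_-), because phi_- preserves functions vanishing on the half-line. *)
have h := restriction_eqP (translation l (even_extension (even_factor phi_e y)))
  lmm pm_neg.
(* Q r may stand before the shift, because W(phi_e) Q y is even. *)
have e2 : even_extension (even_factor phi_e y) = multiplier phi_e (even_extension y).
  apply: even_extension_restriction.
  exact: (etrans (esym (multiplier_reflection (even_extension y) pe_even))
    (congr1 (multiplier phi_e) (reflection_even_extension y))).
apply/esym; apply: (etrans h).
exact: (congr1 (fun u => restriction (multiplier phi_minus (translation l u))) e2).
Qed.

End factorization.

Theorem theorem5p1 (R : realType) (phi phi_minus phi_e : Linf R) (lambda : R) :
  invertibles (@AP R) phi ->
  AP_asymmetric_factorization phi phi_minus lambda phi_e ->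
  [/\ lambda < 0 -> properly_right_Fredholm (wiener_hopf_plus_hankel phi) /\
                    right_invertible (wiener_hopf_plus_hankel phi),
      0 < lambda -> properly_left_Fredholm (wiener_hopf_plus_hankel phi) /\
                    left_invertible (wiener_hopf_plus_hankel phi)
    & lambda = 0 -> two_sided_invertible (wiener_hopf_plus_hankel phi)].
Proof.
move=> _ [[APm [psi_minus APpsi m_inv]] [_ [psi_e _ e_inv]] e_even phiE].
have m_neg := APminus_preserves_negative APm.
have psi_neg := APminus_preserves_negative APpsi.
have [mK mK'] := multiplier_inverse m_inv.
have [eK eK'] := multiplier_inverse e_inv.
have AK := minus_factorK m_neg mK; have AK' := minus_factorK psi_neg mK'.
have DK := even_factorK (fun f => multiplier_inverse_reflection f e_even e_inv) eK.
have DK' := even_factorK (fun f => multiplier_reflection f e_even) eK'.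
have UK := @L2_plus_extensionK R; have UK' := @L2_plus_restrictionK R.
have bA := @minus_factor_bounded_linear R.
have bD := @even_factor_bounded_linear R.
have bM := @folded_shift_bounded_linear R.
have bU := L2_plus_restriction_bounded_linear R.
have bZ := L2_plus_extension_bounded_linear R.
have TE := wiener_hopf_plus_hankelE m_neg e_even phiE.
set T := wiener_hopf_plus_hankel phi in TE *.
(* One candidate for all three cases: the inverse symbols in the outer factors and the opposite
   shift in the middle. It is a right inverse for lambda <= 0 and a left inverse for lambda >= 0. *)
pose S := (@L2_plus_extension R) \o even_factor psi_e \o folded_shift (- lambda) \o
  minus_factor psi_minus.
have bT : bounded_linear T.
  rewrite TE; apply: (bounded_linear_comp _ bU).
  exact: bounded_linear_comp (bounded_linear_comp (bA _) (bM _)) (bD _).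
have bS : bounded_linear S.
  apply: (bounded_linear_comp _ (bA _)); apply: (bounded_linear_comp _ (bM _)).
  exact: bounded_linear_comp bZ (bD _).
have ST : lambda <= 0 -> cancel S T.
  move=> l0 y; rewrite TE /S /= UK DK.
  (* Reading lambda as the opposite of -lambda >= 0 puts the two shifts in the order of
     [folded_shiftK]. *)
  by rewrite -{1}(opprK lambda) folded_shiftK ?oppr_ge0// AK.
have TS : 0 <= lambda -> cancel T S.
  by move=> l0 f; rewrite TE /S /= AK' folded_shiftK// DK' UK'.
have [lA _] := bA phi_minus; have [lA' _] := bA psi_minus.
have [lD _] := bD phi_e; have [lD' _] := bD psi_e; have [lU _] := bU; have [lZ _] := bZ.
split => l0.
- have nl0 : 0 < - lambda by rewrite oppr_gt0.
  apply: (right_invertible_Fredholm bT bS); first exact/ST/ltW.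
  (* Preimages of the gap family under the invertible right-hand factors of [T]; the middle factor,
     a left shift by -lambda, kills the family. *)
  pose x k := L2_plus_extension (even_factor psi_e (gap_family (- lambda) k)).
  apply: (@not_finite_nullity _ _ _ _ x) => [k|].
    have h0 : folded_shift lambda (gap_family (- lambda) k) = 0.
      by have := folded_shift_gap_family k nl0; rewrite opprK.
    rewrite TE /x /= UK DK h0; exact: linear_lin0 lA.
  apply: (linearly_independent_lift (B := even_factor phi_e \o (@L2_plus_restriction R))
    _ _ (gap_family_independent nl0)) => [|k] /=; last by rewrite UK DK.
  by move=> a u v /=; rewrite lU lD.
- apply: (left_invertible_Fredholm bT bS); first exact/TS/ltW.
  (* [S] first undoes [minus_factor phi_minus] and then shifts to the left by lambda, which kills
     the gap family. *)
  pose x k := minus_factor phi_minus (gap_family lambda k).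
  apply: (@not_finite_nullity _ _ _ _ x) => [k|].
    rewrite /S /x /= AK' folded_shift_gap_family//.
    by rewrite (linear_lin0 lD') (linear_lin0 lZ).
  apply: (linearly_independent_lift lA' _ (gap_family_independent l0)) => k.
  exact: AK'.
- split => //; exists S => //.
  by split; [apply: TS|apply: ST]; rewrite l0.
Qed.
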